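(* Let $0<p<\infty$ and let $F\in H^p(\mathbb{D}^\infty)$. Then for quasi-every $\alpha\in\mathbb{C}$, $$\lim_{\sigma\to0^+}\int_{\mathbb{T}^\infty}\log|F_\sigma(\chi)-\alpha|\,dm_\infty(\chi)=\int_{\mathbb{T}^\infty}\log|F(\chi)-\alpha|\,dm_\infty(\chi).$$
   Context: $\mathbb{T}^\infty$ is the countably infinite product of the unit circle, with normalized Haar measure $m_\infty$. Each $\chi=(\chi_1,\chi_2,\dots)\in\mathbb{T}^\infty$ is identified with the completely multiplicative function $\chi:\mathbb{N}\to\mathbb{T}$ with $\chi(p_j)=\chi_j$, where $p_j$ is the $j$th prime. $H^p(\mathbb{D}^\infty)$ is the closure in $L^p(\mathbb{T}^\infty)$ of the analytic polynomials $\sum_{n\le N}a_n\chi(n)$ (polynomials in finitely many of the variables $\chi_j$). An element $F$ has coefficients $(a_n)_{n\ge1}$ and is written $F(\chi)=\sum_{n\ge1}a_n\chi(n)$. For $\sigma>0$, $F_\sigma(\chi)=\sum_{n\ge1}a_n\chi(n)n^{-\sigma}$, which converges for almost every $\chi$. ''Quasi-every'' means outside a set of logarithmic capacity zero. *)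

(* Defs.v *)
From HB Require Import structures.
From mathcomp Require Import all_boot all_order all_algebra.
From mathcomp Require Import complex.
From mathcomp Require Import all_classical all_reals all_analysis.

Set Implicit Arguments.
Unset Strict Implicit.
Unset Printing Implicit Defensive.

Import Order.TTheory GRing.Theory Num.Theory.
Import numFieldNormedType.Exports.

Local Open Scope ring_scope.
Local Open Scope complex_scope.
Local Open Scope classical_set_scope.

(* R[i] with its usual topology, the norm being the R[i]-valued modulus.  The
   R-valued modulus of z is [normc z]. *)
HB.instance Definition _ (R : realType) := NormedModule.copy R[i] R[i]^o.

Notation normc := ComplexField.Normc.normc.

Definition borel (T : ptopologicalType) := g_sigma_algebraType (@open T).
HB.instance Definition _ (T : ptopologicalType) := Measurable.on (borel T).

Section InfiniteTorus.
Variable R : realType.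

Definition unit_circle : set R[i] := [set z | normc z = 1].

Lemma unit_circle1 : unit_circle 1.
Proof. exact: ComplexField.Normc.normc1. Qed.

Lemma unit_circleM (z w : unit_circle) : unit_circle (set_val z * set_val w).
Proof.
rewrite /unit_circle /= ComplexField.Normc.normcM.
by rewrite (set_mem (valP z)) (set_mem (valP w)) mulr1.
Qed.

Definition circle1 : unit_circle := SigSub (mem_set unit_circle1).
Definition circle_mul (z w : unit_circle) : unit_circle :=
  SigSub (mem_set (unit_circleM z w)).

(* Coordinates are numbered from 0: [chi j] is the value at the (j+1)st prime. *)
Definition torus := prod_topology (fun _ : nat => unit_circle).

HB.instance Definition _ := Topological.copy torus
  (prod_topology (fun _ : nat => unit_circle)).
HB.instance Definition _ := isPointed.Build torus (fun=> circle1).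

Definition torus_mul (w chi : torus) : torus :=
  fun j => circle_mul (w j) (chi j).

Definition normalized_haar (m : probability (borel torus) R) :=
  forall (w : torus) (A : set (borel torus)), measurable A ->
    m (torus_mul w @^-1` A) = m A.

(* The number of primes below p, so that [prime_index] of the (j+1)st prime is
   j. *)
Definition prime_index (p : nat) : nat := count prime (iota 0 p).

(* The completely multiplicative function attached to chi; meaningful for
   0 < n. *)
Definition torus_eval (chi : torus) (n : nat) : R[i] :=
  \prod_(p <- primes n) set_val (chi (prime_index p)) ^+ logn p n.

Lemma torus_eval_prime (chi : torus) (p : nat) : prime p ->
  torus_eval chi p = set_val (chi (prime_index p)).
Proof.
move=> pp; rewrite /torus_eval primes_prime// big_seq1.
by rewrite logn_prime// eqxx expr1.
Qed.

Lemma torus_evalM (chi : torus) (a b : nat) : (0 < a)%N -> (0 < b)%N ->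
  torus_eval chi (a * b) = torus_eval chi a * torus_eval chi b.
Proof.
move=> a0 b0; set f := fun p => set_val (chi (prime_index p)).
have ext n : (0 < n)%N -> (n %| a * b)%N ->
    torus_eval chi n = \prod_(p <- primes (a * b)) f p ^+ logn p n.
  move=> n0 nab; rewrite [RHS](bigID (mem (primes n)))/= [X in _ * X]big1 ?mulr1.
    rewrite -big_filter; apply: perm_big; apply: uniq_perm.
    - exact: primes_uniq.
    - by rewrite filter_uniq// primes_uniq.
    move=> p; rewrite mem_filter !mem_primes muln_gt0 a0 b0 n0 /=.
    case: (prime p) => //=; case: (boolP (p %| n)%N) => //= pn.
    by rewrite (dvdn_trans pn nab).
  move=> p; rewrite mem_primes n0/= => pn.
  have [pp|/negbTE np] := boolP (prime p); last by rewrite lognE np expr0.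
  by rewrite pp/= in pn; rewrite lognE pp n0 (negbTE pn) expr0.
rewrite (ext (a * b)%N) ?muln_gt0 ?a0 ?b0// (ext a) ?dvdn_mulr//.
rewrite (ext b) ?dvdn_mull// -big_split/=.
by apply: eq_bigr => p _; rewrite -exprD lognM.
Qed.

(* The entry at index 0 of the coefficient list s is not used. *)
Definition analytic_poly (s : seq R[i]) (chi : torus) : R[i] :=
  \sum_(1 <= n < size s) s`_n * torus_eval chi n.

End InfiniteTorus.

Section HardySpace.
Variables (R : realType) (m : probability (borel (torus R)) R) (p : R).
Implicit Types F G : torus R -> R[i].

(* The L^p (quasi-)norm of F - G. *)
Definition Lp_dist F G : \bar R :=
  Lnorm m p%:E (fun chi => (normc (F chi - G chi))%:E).

Definition Lp_space : set (torus R -> R[i]) :=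
  [set F | measurable_fun setT (F : borel (torus R) -> borel R[i]) /\
           (Lp_dist F (fun=> 0%R) < +oo)%E].

Definition Hardy : set (torus R -> R[i]) :=
  [set F | Lp_space F /\
    forall e : R, 0 < e -> exists s, (Lp_dist F (analytic_poly s) < e%:E)%E].

(* The n-th coefficient (0 < n) of an element F of [Hardy]: the continuous
   extension to the closure of the n-th coefficient of analytic polynomials.
   For 1 <= p it is the Fourier coefficient of F at n, an integral that need
   not exist when p < 1. *)
Definition Hardy_coef F (n : nat) : R[i] :=
  get [set c : R[i] | forall s : nat -> seq R[i],
    Lp_dist F (analytic_poly (s k)) @[k --> \oo] --> 0%E ->
    (s k)`_n @[k --> \oo] --> c].

(* F_sigma; the value is arbitrary on the null set where the series
   diverges. *)
Definition Hardy_shift F (sigma : R) (chi : torus R) : R[i] :=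
  lim (\sum_(1 <= n < N.+1)
         Hardy_coef F n * torus_eval chi n * (n%:R `^ (- sigma))%:C
       @[N --> \oo]).

End HardySpace.

Section LogarithmicCapacity.
Variable R : realType.
Local Open Scope ereal_scope.

(* [lne 0 = -oo], whereas [ln 0 = 0]. *)
Definition logmod (z : R[i]) : \bar R := lne (normc z)%:E.

Definition log_energy (mu : probability (borel R[i]) R) : \bar R :=
  \int[mu]_z \int[mu]_w logmod ((z : R[i]) - w)%R.

(* The supremum of exp (I mu) over the Borel probability measures mu with
   compact support in E; 0 is added for the case of the empty set. *)
Definition log_capacity (E : set R[i]) : \bar R :=
  ereal_sup ([set 0] `|`
    [set expeR (log_energy mu) | mu in [set mu : probability (borel R[i]) R |
       exists K : set R[i], [/\ compact K, K `<=` E & mu K = 1]]]).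

(* The exceptional set is required to be Borel, as the capacity above is an
   inner capacity. *)
Definition quasi_every (P : R[i] -> Prop) :=
  exists E : set R[i],
    [/\ measurable (E : set (borel R[i])), log_capacity E = 0 &
        forall alpha, ~ E alpha -> P alpha].

End LogarithmicCapacity.

(* Main.v *)
Require Import Defs.
From mathcomp Require Import all_boot all_order all_algebra.
From mathcomp Require Import complex.
From mathcomp Require Import all_classical all_reals all_analysis.
From mathcomp Require Import measurable_realfun.
From mathcomp Require Import ring lra zify.

(* Let q = 2 / 2^l be at most 1 and p.  The outer part of a polynomial in one
   variable has a 2^l-th root, so Parseval's formula for the root shows that the
   dilation Q(z) -> Q(r z), 0 <= r <= 1, decreases the q-th moment of Q on the
   circle and, for small r, that it maps L^q boundedly into L^2.  Carried out one
   prime after the other, this gives the same for F -> F_sigma: the q-th moments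
   of F_sigma - alpha increase to at most that of F - alpha as sigma decreases to
   0, F_sigma tends to F, and a Rademacher-Menshov argument yields the almost
   everywhere convergence of the series of F_sigma.

   Since log x is the decreasing limit of (x^q - 1)/q as q -> 0, the integrals
   u_sigma(alpha) of log |F_sigma - alpha| also increase, to at most u(alpha), the
   integral of log |F - alpha|.  The exceptional set is E = {sup u_sigma < u}.

   Let mu be a probability measure on E, and A1 a subset of E on which the
   potentials of mu truncated at scale epsilon tend to 0 uniformly with epsilon.
   By the maximum principle they are then small everywhere, so integrating
   u - u_sigma over A1 and using Tonelli's theorem gives u = sup u_sigma mu-almost
   everywhere on A1, whence mu A1 = 0.  By Egorov's theorem the potential of mu is
   -oo mu-almost everywhere, and its energy is -oo. *)

Set Implicit Arguments.
Unset Strict Implicit.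
Unset Printing Implicit Defensive.

Import Order.TTheory GRing.Theory Num.Theory.
Import numFieldNormedType.Exports.

Local Open Scope ring_scope.
Local Open Scope complex_scope.
Local Open Scope classical_set_scope.

Local Notation Re := complex.Re.
Local Notation Im := complex.Im.

(** The obstacle is that [p] may be less than 1: the norm is not convex and coefficients are not
    integrals, so the estimates have to come from Parseval's formula. An exponent with
    [q * 2 ^ l = 2] turns the q-th moment of a 2^l-th power into a square mean. Powers of 2 occur
    because roots are iterated square roots; such exponents are also closed under halving, along
    which (x^q - 1)/q decreases. Roots are approximated by polynomials, so boundary values never
    have to be defined.

    The smoothing constant of a prime is 1 once p^(-sigma/l) <= 1/2. Hence finitely many primes
    contribute, and the constant does not depend on the number of variables.

    The constant alpha is a coefficient at n = 1, where n^(-sigma) = 1, so F_sigma - alpha is the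
    dilation of F - alpha and the moment inequalities apply to it. They give u_sigma <= u for every
    alpha; a strict limit can only come from the singularity of the logarithm. Averaged over alpha,
    this loss is a truncated potential evaluated at F_sigma(chi), which may be any point of the
    plane; hence the maximum principle. *)

Section ComplexModulus.
Variable R : realType.
Implicit Types x y z : R[i].

Lemma normc_ge0 z : 0 <= normc z.
Proof. by case: z => a b; exact: sqrtr_ge0. Qed.

Lemma normcD x y : normc (x + y) <= normc x + normc y.
Proof. exact: (@le_normcD R). Qed.

Lemma normc_opp z : normc (- z) = normc z.
Proof. exact: (@normcN R). Qed.

Lemma normcC x y : normc (x - y) = normc (y - x).
Proof. by rewrite -normc_opp opprB. Qed.

Lemma normcM x y : normc (x * y) = normc x * normc y.
Proof. exact: ComplexField.Normc.normcM. Qed.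

Lemma normcX z n : normc (z ^+ n) = normc z ^+ n.
Proof.
elim: n => [|n ih]; first exact: ComplexField.Normc.normc1.
by rewrite !exprS normcM ih.
Qed.

Lemma normc1 : normc (1 : R[i]) = 1.
Proof. exact: ComplexField.Normc.normc1. Qed.

Lemma normc0 : normc (0 : R[i]) = 0.
Proof. exact: ComplexField.Normc.normc0. Qed.

Lemma normc_dist x y z : normc (x - z) <= normc (x - y) + normc (y - z).
Proof. by rewrite (le_trans _ (normcD _ _))// addrA subrK. Qed.

Lemma normc_leD x y : normc x <= normc y + normc (x - y).
Proof. by rewrite (le_trans _ (normcD _ _))// addrC subrK. Qed.

Lemma normc_real (r : R) : normc r%:C = `|r|.
Proof. by rewrite /normc /= expr0n addr0 sqrtr_sqr. Qed.

Lemma sqr_normc z : normc z ^+ 2 = Re z ^+ 2 + Im z ^+ 2.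
Proof. by case: z => a b; rewrite /normc sqr_sqrtr// addr_ge0// sqr_ge0. Qed.

Lemma normcE z : normc z = Num.sqrt (Re z ^+ 2 + Im z ^+ 2).
Proof. by case: z. Qed.

Lemma normc_conj z : normc z^* = normc z.
Proof. by case: z => a b; rewrite /normc /= sqrrN. Qed.

Lemma mulc_conj z : z * z^* = (normc z ^+ 2)%:C.
Proof.
rewrite sqr_normc; case: z => a b /=; apply/eqP; rewrite eq_complex /=.
by rewrite mulrN opprK -!expr2 mulrN mulrC addNr !eqxx.
Qed.

Lemma normc_Re z : `|Re z| <= normc z.
Proof.
rewrite -(@ler_pXn2r _ 2) ?nnegrE ?normc_ge0// sqr_normc real_normK ?num_real//.
by rewrite lerDl sqr_ge0.
Qed.

Lemma normc_Im z : `|Im z| <= normc z.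
Proof.
rewrite -(@ler_pXn2r _ 2) ?nnegrE ?normc_ge0// sqr_normc real_normK ?num_real//.
by rewrite lerDr sqr_ge0.
Qed.

Lemma normc_ReIm z : normc z <= `|Re z| + `|Im z|.
Proof.
rewrite -(@ler_pXn2r _ 2) ?nnegrE ?normc_ge0 ?addr_ge0// sqr_normc.
rewrite sqrrD !real_normK ?num_real// lerD2r lerDl mulrn_wge0// mulr_ge0//.
Qed.

Lemma normc_sum I (r : seq I) (P : pred I) (F : I -> R[i]) :
  normc (\sum_(i <- r | P i) F i) <= \sum_(i <- r | P i) normc (F i).
Proof.
elim/big_ind2 : _ => [|x a y b xa yb|//]; first by rewrite normc0.
by rewrite (le_trans (normcD _ _))// lerD.
Qed.

End ComplexModulus.

(** * Polynomial roots of the outer part of a polynomial *)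

Section OuterApproximation.
Variable R : realType.
Implicit Types (z : R[i]) (Q g : {poly R[i]}).

(* Newton-like iteration for the square root: [1 - sqrt_iter n] tends to
   [sqrt (1 - 'X)] on the open unit disc, because
   (1 - v_n)^2 - (1 - 'X) = 2 (v_(n+1) - v_n). *)
Fixpoint sqrt_iter (n : nat) : {poly R[i]} :=
  if n is n'.+1 then 2^-1 *: ('X + sqrt_iter n' ^+ 2) else 0.

Lemma sqrt_iterS n z :
  (sqrt_iter n.+1).[z] = 2^-1 * (z + (sqrt_iter n).[z] ^+ 2).
Proof. by rewrite /= hornerZ hornerD hornerX horner_exp. Qed.

(** The map v -> (z + v^2)/2 preserves the disc of radius [rho] because (rho + rho^2)/2 <= rho. A
    difference of consecutive iterates is half the preceding difference times the sum of two
    iterates, hence contracts by [rho], and the residual is twice such a difference. *)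
Lemma sqrt_iter_bound (rho : R) n z : 0 <= rho < 1 -> normc z <= rho ->
  normc (sqrt_iter n).[z] <= rho /\
  normc ((1 - (sqrt_iter n).[z]) ^+ 2 - (1 - z)) <= 2 * rho ^+ n.
Proof.
move=> /andP[rho0 rho1] zr.
have n2 : normc (2^-1 : R[i]) = 2^-1.
  have -> : (2^-1 : R[i]) = (2^-1 : R)%:C by rewrite rmorphV ?unitfE//= rmorph_nat.
  by rewrite normc_real ger0_norm// invr_ge0.
have vr k : normc (sqrt_iter k).[z] <= rho.
  elim: k => [|k ih]; first by rewrite /= horner0 normc0.
  rewrite sqrt_iterS normcM n2.
  have := normcD z ((sqrt_iter k).[z] ^+ 2).
  rewrite normcX => h.
  have h2 : normc (sqrt_iter k).[z] ^+ 2 <= rho ^+ 2.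
    by rewrite lerXn2r ?nnegrE ?normc_ge0.
  by nra.
split=> //.
have dv k : normc ((sqrt_iter k.+1).[z] - (sqrt_iter k).[z]) <= rho ^+ k.
  elim: k => [|k ih].
    by rewrite expr0 (le_trans (normcD _ _))// normc_opp /= horner0 normc0 addr0
      (le_trans (vr 1%N))// ltW.
  have -> : (sqrt_iter k.+2).[z] - (sqrt_iter k.+1).[z] =
      2^-1 * ((sqrt_iter k.+1).[z] - (sqrt_iter k).[z]) *
             ((sqrt_iter k.+1).[z] + (sqrt_iter k).[z]).
    by rewrite -mulrA -subr_sqr sqrt_iterS [in X in _ - X = _]sqrt_iterS; ring.
  rewrite !normcM n2 exprSr.
  have h1 := normcD (sqrt_iter k.+1).[z] (sqrt_iter k).[z].
  have h2 := vr k; have h3 := vr k.+1.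
  have h4 := normc_ge0 ((sqrt_iter k.+1).[z] - (sqrt_iter k).[z]).
  have h5 : normc ((sqrt_iter k.+1).[z] + (sqrt_iter k).[z]) <= 2 * rho by lra.
  rewrite -mulrA mulrCA ler_pM//; last by lra.
  by rewrite mulr_ge0// ?invr_ge0// normc_ge0.
have -> : (1 - (sqrt_iter n).[z]) ^+ 2 - (1 - z) =
    2%:R * ((sqrt_iter n.+1).[z] - (sqrt_iter n).[z]).
  by rewrite sqrt_iterS; field.
rewrite normcM (_ : normc 2%:R = 2) ?ler_pM2l//.
by rewrite -(rmorph_nat (real_complex R)) normc_real ger0_norm.
Qed.

(** Each composition with [sqrt_iter n] takes one more square root; it is legitimate because
    [sqrt_iter n] maps the disc of radius [rho] into itself. *)
Lemma root_pow2_approx l (rho : R) (e : R) : 0 <= rho < 1 -> 0 < e ->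
  exists w : {poly R[i]}, forall z, normc z <= rho ->
    normc w.[z] <= rho /\
    normc ((1 - w.[z]) ^+ (2 ^ l) - (1 - z)) <= e.
Proof.
move=> rho01; elim: l e => [|l ih] e e0.
  by exists 'X => z zr; rewrite hornerX expr1 subrr normc0 (ltW e0).
(* In the difference of squares below, the factor [b + (1 - y)] has modulus at most 1 + 2 * 2 = 5,
   so the error [d * 5] takes at most half of [e]. *)
pose d := Num.min 1 (e / 10).
have d0 : 0 < d by rewrite lt_min ltr01 divr_gt0.
have d1 : d <= 1 by rewrite ge_min lexx.
have d2 : d <= e / 10 by rewrite ge_min lexx orbT.
have [w hw] := ih _ d0.
have /andP[rho0 rho1] := rho01.
have [n hn] : exists n, 2 * rho ^+ n <= e / 2.
  have := @cvg_geometric R 2 rho; rewrite ger0_norm// => /(_ rho1).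
  move=> /cvgrPdist_le /(_ (e / 2)) []; first by rewrite divr_gt0.
  move=> n _ /(_ n (leqnn n)); rewrite sub0r normrN => h; exists n.
  exact: le_trans (ler_norm _) h.
exists (w \Po sqrt_iter n) => z zr.
have [vr ve] := sqrt_iter_bound n rho01 zr.
have [wr we] := hw _ vr.
rewrite horner_comp; split=> //.
set y := (sqrt_iter n).[z] in vr ve wr we *; set a := 1 - w.[y] in we *.
rewrite expnS mulnC exprM.
apply: le_trans (normc_dist _ ((1 - y) ^+ 2) _) _.
rewrite subr_sqr normcM.
set b := a ^+ (2 ^ l) in we *.
have b1 : normc (b + (1 - y)) <= 5.
  have -> : b + (1 - y) = (b - (1 - y)) + 2%:R * (1 - y) by ring.
  have h1 := normcD (b - (1 - y)) (2%:R * (1 - y)).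
  have h2 := normcD 1 (- y); rewrite normc_opp normc1 in h2.
  rewrite normcM (_ : normc 2%:R = 2) in h1; last first.
    by rewrite -(rmorph_nat (real_complex R)) normc_real ger0_norm.
  lra.
have h3 := normc_ge0 (b - (1 - y)); have h4 := normc_ge0 (b + (1 - y)).
have h5 : normc (b - (1 - y)) * normc (b + (1 - y)) <= d * 5 by rewrite ler_pM.
by rewrite (le_trans (lerD h5 ve))//; lra.
Qed.

(** The iteration converges uniformly on discs of radius below 1 only. The variable is therefore
    shrunk by [1 - d] first, which moves [1 - b * z] by at most [d]. *)
Lemma linear_root_approx l (b : R[i]) (e : R) : normc b <= 1 -> 0 < e ->
  exists g, forall z, normc z <= 1 ->
    normc (g.[z] ^+ (2 ^ l) - (1 - b * z)) <= e.
Proof.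
move=> b1 e0; pose d := Num.min (1 / 2) (e / 2).
have d0 : 0 < d by rewrite lt_min !divr_gt0.
have d1 : d <= 1 / 2 by rewrite ge_min lexx.
have d2 : d <= e / 2 by rewrite ge_min lexx orbT.
have rho01 : 0 <= 1 - d < 1 by apply/andP; split; lra.
have e2 : 0 < e / 2 by rewrite divr_gt0.
have [w hw] := root_pow2_approx l rho01 e2.
exists (1 - (w \Po ((1 - d)%:C *: (b *: 'X)))) => z z1.
have bz1 : normc (b * z) <= 1.
  by rewrite normcM mulr_ile1 ?normc_ge0.
have xr : normc ((1 - d)%:C * (b * z)) <= 1 - d.
  rewrite normcM normc_real ger0_norm; last by lra.
  by rewrite ler_piMr//; lra.
have [_ h] := hw _ xr.
rewrite hornerD hornerN hornerC horner_comp !hornerZ hornerX.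
apply: le_trans (normc_dist _ (1 - (1 - d)%:C * (b * z)) _) _.
have -> : 1 - (1 - d)%:C * (b * z) - (1 - b * z) = d%:C * (b * z).
  by rewrite rmorphB rmorph1; ring.
rewrite [X in _ + X]normcM normc_real ger0_norm ?(ltW d0)//.
have h6 : d * normc (b * z) <= d by rewrite ler_piMr// ltW.
by apply: (le_trans (lerD h h6)); lra.
Qed.

(* [Q] is approximable, in modulus, by the [K]-th power of a polynomial: from
   below on the unit circle and from above on the closed unit disc.  This
   replaces the [K]-th root of the outer part of [Q]. *)
Definition outer_root K Q := exists M : R, forall e : R, 0 < e -> exists g,
  forall z, normc z <= 1 ->
  [/\ normc Q.[z] <= normc g.[z] ^+ K + e, normc g.[z] ^+ K <= M &
      normc z = 1 -> normc g.[z] ^+ K <= normc Q.[z] + e].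

(** The bound [M] of each factor is fixed before the error, so the cross terms of the two errors
    stay proportional to [d]. *)
Lemma outer_rootM K Q1 Q2 :
  outer_root K Q1 -> outer_root K Q2 -> outer_root K (Q1 * Q2).
Proof.
move=> [M1 h1] [M2 h2]; exists (M1 * M2) => e e0.
have M10 : 0 <= M1.
  have [g /(_ 0)] := h1 1 ltr01; rewrite normc0 => /(_ ler01)[_ + _].
  by apply: le_trans; rewrite exprn_ge0// normc_ge0.
have M20 : 0 <= M2.
  have [g /(_ 0)] := h2 1 ltr01; rewrite normc0 => /(_ ler01)[_ + _].
  by apply: le_trans; rewrite exprn_ge0// normc_ge0.
(* The moduli of [Q1] and [Q2] are at most M1 + d and M2 + d with d <= 1; together with another [d]
   this explains the 3. *)
pose d := Num.min 1 (e / (M1 + M2 + 3)).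
have s0 : 0 < M1 + M2 + 3 by lra.
have d0 : 0 < d by rewrite lt_min ltr01 divr_gt0.
have d1 : d <= 1 by rewrite ge_min lexx.
have d2 : d * (M1 + M2 + 3) <= e.
  by rewrite -ler_pdivlMr// ge_min lexx orbT.
have [g1 {}h1] := h1 d d0; have [g2 {}h2] := h2 d d0.
exists (g1 * g2) => z z1; rewrite !hornerM !normcM exprMn.
have [a1 b1 c1] := h1 z z1; have [a2 b2 c2] := h2 z z1.
have p1 : 0 <= normc g1.[z] ^+ K by rewrite exprn_ge0// normc_ge0.
have p2 : 0 <= normc g2.[z] ^+ K by rewrite exprn_ge0// normc_ge0.
have q1 := normc_ge0 Q1.[z]; have q2 := normc_ge0 Q2.[z].
move: (normc g1.[z] ^+ K) (normc g2.[z] ^+ K) a1 b1 c1 a2 b2 c2 p1 p2 => G1 G2.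
move: (normc Q1.[z]) (normc Q2.[z]) q1 q2 => A1 A2 q1 q2 a1 b1 c1 a2 b2 c2 p1 p2.
split.
- have : A1 * A2 <= (G1 + d) * (G2 + d) by rewrite ler_pM.
  have : d * (G1 + G2 + d) <= d * (M1 + M2 + 3) by rewrite ler_pM2l//; lra.
  by lra.
- by rewrite ler_pM.
- move=> e1; have {}c1 := c1 e1; have {}c2 := c2 e1.
  have : G1 * G2 <= (A1 + d) * (A2 + d) by rewrite ler_pM.
  have : d * (A1 + A2 + d) <= d * (M1 + M2 + 3) by rewrite ler_pM2l//; lra.
  by lra.
Qed.

Lemma outer_rootC K (c : R[i]) : (0 < K)%N -> outer_root K c%:P.
Proof.
move=> K0; exists (normc c) => e e0.
exists ((normc c `^ (K%:R^-1))%:C)%:P => z z1; rewrite !hornerC normc_real.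
rewrite ger0_norm ?powR_ge0// -powR_mulrn ?powR_ge0// -powRrM mulVf ?pnatr_eq0 -?lt0n//.
by rewrite powRr1 ?normc_ge0// lerDl (ltW e0); split.
Qed.

Lemma normc_circle_lin (a z : R[i]) : normc z = 1 ->
  normc (z - a) = normc (1 - a^* * z).
Proof.
move=> z1; have zz : z * z^* = 1 by rewrite mulc_conj z1 expr1n.
rewrite -[LHS]normc_conj -[LHS]mul1r -z1 -normcM rmorphB /= mulrBr zz.
by rewrite [z * _]mulrC.
Qed.

(** The Blaschke factor of [a] is at most 1 in the disc: |1 - a^* z|^2 - |z - a|^2 = (1 - |z|^2)(1 -
    |a|^2). *)
Lemma normc_disc_lin (a z : R[i]) : normc z <= 1 -> normc a <= 1 ->
  normc (z - a) <= normc (1 - a^* * z).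
Proof.
move=> z1 a1; rewrite -(@ler_pXn2r _ 2) ?nnegrE ?normc_ge0//.
have zz : normc z ^+ 2 <= 1 by rewrite expr_le1// normc_ge0.
have aa : normc a ^+ 2 <= 1 by rewrite expr_le1// normc_ge0.
move: zz aa; rewrite !sqr_normc; case: a {a1} => a b; case: z {z1} => x y /=.
by nra.
Qed.

(** A zero of modulus above 1 is handled by z - a = -a (1 - z/a). A zero in the closed disc is
    reflected: [1 - a^* * z] has the same modulus on the circle and at least the same modulus
    inside. The bound 3 is |1 - b z| <= 2 plus an error of at most 1. *)
Lemma outer_root_lin l (a : R[i]) : outer_root (2 ^ l) ('X - a%:P).
Proof.
have tri (x y : R[i]) (e : R) : normc (x - y) <= e ->
    normc x <= normc y + e /\ normc y <= normc x + e.
  move=> h; split; first by rewrite (le_trans (normc_leD x y))// lerD2l.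
  by rewrite (le_trans (normc_leD y x))// lerD2l normcC.
have [a1|a1] := lerP (normc a) 1; last first.
  have a0 : a != 0 by apply/eqP => a0; rewrite a0 normc0 ltr10 in a1.
  have -> : 'X - a%:P = (- a)%:P * (1 - a^-1 *: 'X).
    rewrite -mul_polyC mulrBr mulr1 mulrA -polyCM mulNr mulfV// !polyCN.
    by rewrite mulNr opprK mul1r addrC.
  apply: outer_rootM; first by apply: outer_rootC; rewrite expn_gt0.
  have b1 : normc a^-1 <= 1.
    by rewrite ComplexField.Normc.normcV invf_le1 ?ltW// (lt_trans ltr01).
  exists 3 => e e0.
  pose d := Num.min 1 e.
  have d0 : 0 < d by rewrite lt_min ltr01.
  have d1 : d <= 1 by rewrite ge_min lexx.
  have d2 : d <= e by rewrite ge_min lexx orbT.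
  have [g hg] := linear_root_approx l b1 d0; exists g => z z1.
  have [h1 h2] := tri _ _ _ (hg z z1); rewrite !hornerE normcX in h1 h2 *.
  have h3 : normc (1 - a^-1 * z) <= 2.
    rewrite (le_trans (normcD _ _))// normc1 normc_opp normcM.
    have := mulr_ile1 (normc_ge0 _) (normc_ge0 _) b1 z1; lra.
  by split; lra.
have b1 : normc a^* <= 1 by rewrite normc_conj.
exists 3 => e e0.
pose d := Num.min 1 e.
have d0 : 0 < d by rewrite lt_min ltr01.
have d1 : d <= 1 by rewrite ge_min lexx.
have d2 : d <= e by rewrite ge_min lexx orbT.
have [g hg] := linear_root_approx l b1 d0; exists g => z z1.
have [h1 h2] := tri _ _ _ (hg z z1); rewrite !hornerE normcX in h1 h2 *.
have h3 : normc (1 - a^* * z) <= 2.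
  rewrite (le_trans (normcD _ _))// normc1 normc_opp normcM.
  have := mulr_ile1 (normc_ge0 _) (normc_ge0 _) b1 z1; lra.
have h4 := normc_disc_lin z1 a1.
by split; [lra|lra|move=> /normc_circle_lin->; lra].
Qed.

Lemma outer_root_all l Q : outer_root (2 ^ l) Q.
Proof.
have [r ->] := closed_field_poly_normal Q; rewrite -mul_polyC.
apply: outer_rootM; first by apply: outer_rootC; rewrite expn_gt0.
elim/big_rec : _ => [|a p _ ih]; first by apply: outer_rootC; rewrite expn_gt0.
exact: outer_rootM (outer_root_lin l a) ih.
Qed.

End OuterApproximation.

(** * Square norms of polynomials and their dilations *)

Section PolynomialHilbertNorm.
Variable R : realType.
Implicit Types (z : R[i]) (Q g : {poly R[i]}).

Lemma sqr_sum_le (I : Type) (r : seq I) (P : pred I) (a : I -> R) :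
  (\sum_(i <- r | P i) a i) ^+ 2 <= (count P r)%:R * \sum_(i <- r | P i) a i ^+ 2.
Proof.
elim: r => [|x r ih]; first by rewrite !big_nil expr0n mul0r.
rewrite !big_cons /=; case: (P x) => //=.
have T0 : 0 <= \sum_(i <- r | P i) a i ^+ 2 by apply: sumr_ge0 => i _; exact: sqr_ge0.
move: ih T0; set S := \sum_(i <- r | P i) a i; set T := \sum_(i <- r | P i) _.
rewrite add1n -natr1; have n0 : 0 <= (count P r)%:R :> R by [].
move: (count P r)%:R n0 => n n0 ih T0.
suff : 2 * a x * S <= n * a x ^+ 2 + T by lra.
have [n00|nn0] := eqVneq n 0.
  rewrite n00 mul0r in ih; have : S == 0 by rewrite -sqrf_eq0 eq_le ih sqr_ge0.
  by move=> /eqP ->; rewrite n00; lra.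
have np : 0 < n by rewrite lt_neqAle eq_sym nn0.
rewrite -(ler_pM2l np).
have := sqr_ge0 (n * a x - S); nra.
Qed.

(** The squared norm of [g] in the Hardy space H^2 of the disc. *)
Definition pnorm g : R := \sum_(i < size g) normc g`_i ^+ 2.

Lemma pnorm_wide n g : (size g <= n)%N ->
  pnorm g = \sum_(i < n) normc g`_i ^+ 2.
Proof.
move=> gn; rewrite /pnorm (big_ord_widen n (fun i => normc g`_i ^+ 2) gn) big_mkcond.
apply: eq_bigr => i _; case: ltnP => // gi.
by rewrite nth_default// normc0 expr0n.
Qed.

Lemma pnorm_ge0 g : 0 <= pnorm g.
Proof. by apply: sumr_ge0 => i _; exact: sqr_ge0. Qed.

Definition pscale (c : R[i]) Q := Q \Po (c *: 'X).

Lemma coef_pscale c Q n : (pscale c Q)`_n = Q`_n * c ^+ n.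
Proof.
rewrite /pscale comp_polyE coef_sum.
under eq_bigr do rewrite exprZn !coefZ coefXn.
have [nQ|nQ] := ltnP n (size Q).
  rewrite (bigD1 (Ordinal nQ))//= eqxx mulr1 big1 ?addr0// => i /negbTE.
  by rewrite -val_eqE/= eq_sym => ->; rewrite !mulr0.
rewrite nth_default// mul0r big1// => i _.
by rewrite gtn_eqF ?mulr0// (leq_trans _ nQ).
Qed.

Lemma horner_pscale c Q z : (pscale c Q).[z] = Q.[c * z].
Proof. by rewrite /pscale horner_comp hornerZ hornerX. Qed.

Lemma pscaleX c Q n : pscale c (Q ^+ n) = pscale c Q ^+ n.
Proof. by rewrite /pscale rmorphXn. Qed.

Lemma pscaleA c d Q : pscale c (pscale d Q) = pscale (c * d) Q.
Proof.
apply/polyP => i; rewrite !coef_pscale exprMn -mulrA; congr (_ * _).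
by rewrite mulrC.
Qed.

(** The n-th coefficient of g^2 is a sum of n + 1 products. By Cauchy-Schwarz its square is at most
    n + 1 times the sum of their squares, which is the n-th coefficient of [G ^+ 2]; and [G ^+ 2]
    takes the value [pnorm g ^+ 2] at 1. The dilation supplies s^(2n), which absorbs n + 1. *)
Lemma pnorm_sqr_scale (s C0 : R) g : 0 <= s ->
  (forall n, n.+1%:R * s ^+ (2 * n) <= C0) ->
  pnorm (pscale s%:C (g ^+ 2)) <= C0 * pnorm g ^+ 2.
Proof.
move=> s0 hC.
pose G : {poly R} := \poly_(i < size g) (normc g`_i ^+ 2).
have Gi i : G`_i = normc g`_i ^+ 2.
  by rewrite coef_poly; case: ltnP => // gi; rewrite nth_default// normc0 expr0n.
have G1 : G.[1] = pnorm g.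
  rewrite (horner_coef_wide _ (size_poly _ _)); apply: eq_bigr => i _.
  by rewrite Gi expr1n mulr1.
pose N := maxn (size (pscale s%:C (g ^+ 2))) (size (G ^+ 2)).
rewrite (@pnorm_wide N) ?leq_maxl// -G1 -horner_exp.
rewrite (@horner_coef_wide _ N) ?leq_maxr// mulr_sumr; apply: ler_sum => n _.
rewrite expr1n mulr1 coef_pscale normcM normcX normc_real ger0_norm//.
rewrite exprMn -exprM mulnC.
rewrite [g ^+ 2]expr2 [G ^+ 2]expr2 !coefM.
apply: (@le_trans _ _ ((n.+1%:R * \sum_(j < n.+1) normc (g`_j * g`_(n - j)) ^+ 2)
   * s ^+ (2 * n))).
  apply: ler_wpM2r; first exact: exprn_ge0.
  have := sqr_sum_le (index_enum 'I_n.+1) predT (fun j : 'I_n.+1 => normc (g`_j * g`_(n - j))).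
  rewrite count_predT -sum1_size big_const_ord iter_addn mul1n addn0; apply: le_trans.
  rewrite lerXn2r ?nnegrE ?normc_ge0//; last exact: normc_sum.
  by apply: sumr_ge0 => *; exact: normc_ge0.
rewrite mulrAC ler_pM//.
- by rewrite mulr_ge0// exprn_ge0.
- by apply: sumr_ge0 => *; exact: sqr_ge0.
by apply: ler_sum => j _; rewrite normcM exprMn !Gi.
Qed.

(** Repeated squaring with one dilation by [s] at each stage; the exponent of [C0] follows e -> 2 e
    + 1, hence 2^l - 1. *)
Lemma pnorm_pow2_scale (s C0 : R) g l : 0 <= s ->
  (forall n, n.+1%:R * s ^+ (2 * n) <= C0) ->
  pnorm (pscale (s ^+ l)%:C (g ^+ (2 ^ l))) <=
  C0 ^+ (2 ^ l).-1 * pnorm g ^+ (2 ^ l).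
Proof.
move=> s0 hC; have C0ge : 0 <= C0.
  by apply: le_trans (hC 0%N); rewrite mul1r expr0.
elim: l => [|l ih].
  rewrite expn0 !expr0 !expr1 mul1r /pscale scale1r comp_polyXr//.
rewrite exprS rmorphM -pscaleA expnS mulnC exprM pscaleX.
apply: le_trans (pnorm_sqr_scale _ s0 hC) _.
have := lerXn2r 2 (pnorm_ge0 _) _ ih.
rewrite nnegrE mulr_ge0 ?exprn_ge0 ?pnorm_ge0// => /(_ isT) h.
apply: (le_trans (ler_wpM2l C0ge h)).
rewrite exprMn mulrA -!exprM -exprS.
have -> : ((2 ^ l).-1 * 2).+1 = (2 ^ l * 2).-1.
  by have := expn_gt0 2 l; case: (2 ^ l)%N => // n _; lia.
by [].
Qed.

End PolynomialHilbertNorm.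

(** * Convergence and measurability of complex-valued functions *)

Section ComplexTopology.
Variable R : realType.
Implicit Types z l : R[i].

Lemma normr_normc z : `|z| = (normc z)%:C.
Proof. by []. Qed.

Lemma cvgc_normP T (F : set_system T) {FF : Filter F} (f : T -> R[i]) l :
  f @ F --> l <-> normc (f x - l) @[x --> F] --> 0.
Proof.
split=> [fl|fl].
  apply/cvgrPdist_lt => e e0.
  have e0' : (0 : R[i]) < e%:C by rewrite ltcR.
  move/cvgrPdist_lt : fl => /(_ _ e0'); apply: filterS => x.
  by rewrite normr_normc ltcR sub0r normrN ger0_norm ?normc_ge0// normcC.
apply/cvgrPdist_lt => e e0.
have eE : e = (Re e)%:C.
  by move: e0; rewrite ltcE; case: (e) => a b /= /andP[/eqP -> _].
rewrite eE in e0 *; rewrite ltcR in e0.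
move/cvgrPdist_lt : fl => /(_ _ e0); apply: filterS => x.
by rewrite normr_normc ltcR sub0r normrN ger0_norm ?normc_ge0// normcC.
Qed.

Lemma cvgc_ReIm T (F : set_system T) {FF : Filter F} (f : T -> R[i]) l :
  f @ F --> l <-> (Re (f x) @[x --> F] --> Re l /\ Im (f x) @[x --> F] --> Im l).
Proof.
rewrite cvgc_normP; split=> [fl|[fr fi]].
  split; apply/cvgrPdist_lt => e e0.
    move/cvgrPdist_lt : fl => /(_ _ e0); apply: filterS => x.
    rewrite sub0r normrN ger0_norm ?normc_ge0// normcC; apply: le_lt_trans.
    by rewrite (le_trans _ (normc_Re _))//; case: l => ? ?; case: (f x).
  move/cvgrPdist_lt : fl => /(_ _ e0); apply: filterS => x.
  rewrite sub0r normrN ger0_norm ?normc_ge0// normcC; apply: le_lt_trans.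
  by rewrite (le_trans _ (normc_Im _))//; case: l => ? ?; case: (f x).
apply/cvgrPdist_lt => e e0.
have e2 : 0 < e / 2 by rewrite divr_gt0.
move/cvgrPdist_lt : fr => /(_ _ e2); move/cvgrPdist_lt : fi => /(_ _ e2).
apply: filterS2 => x h1 h2.
rewrite sub0r normrN ger0_norm ?normc_ge0// normcC.
apply: le_lt_trans (normc_ReIm _) _.
by move: h1 h2; case: l => a b; case: (f x) => c d /=; lra.
Qed.

Lemma continuous_Re : continuous (@Re R : R[i] -> R).
Proof. by move=> z; case: (proj1 (@cvgc_ReIm _ (nbhs z) _ id z) cvg_id). Qed.

Lemma continuous_Im : continuous (@Im R : R[i] -> R).
Proof. by move=> z; case: (proj1 (@cvgc_ReIm _ (nbhs z) _ id z) cvg_id). Qed.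

Lemma continuous_borel_measurable (T : ptopologicalType) (f : T -> R) :
  continuous f -> measurable_fun setT (f : borel T -> R).
Proof.
move=> /continuousP cf; apply: (measurability _ (RGenOpens.measurableE R)).
move=> _ [_ [a [b ->] <-]]; rewrite setTI; apply: sub_sigma_algebra.
exact/cf/interval_open.
Qed.

Lemma continuous_borel (T1 T2 : ptopologicalType) (f : T1 -> T2) :
  continuous f -> measurable_fun setT (f : borel T1 -> borel T2).
Proof.
move=> /continuousP cf; apply: (@measurability _ _ (borel T1) (borel T2) _ _ (@open T2)) => //.
move=> _ [A oA <-]; rewrite setTI; apply: sub_sigma_algebra.
exact: cf.
Qed.

End ComplexTopology.

Section ComplexMeasurable.
Context (R : realType) (d : measure_display) (T : measurableType d).
Implicit Types f g : T -> R[i].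

(** Phrased through real and imaginary parts so that stability under sums, products and limits is
    inherited from real-valued functions. *)
Definition cmeasurable f :=
  measurable_fun setT (fun x => Re (f x)) /\ measurable_fun setT (fun x => Im (f x)).

Lemma borel_cmeasurable f :
  measurable_fun setT (f : T -> borel R[i]) -> cmeasurable f.
Proof.
move=> mf; split.
  apply: (@measurableT_comp _ _ _ _ _ _ (@Re R : borel R[i] -> R)) => //.
  exact: (continuous_borel_measurable (@continuous_Re R)).
apply: (@measurableT_comp _ _ _ _ _ _ (@Im R : borel R[i] -> R)) => //.
exact: (continuous_borel_measurable (@continuous_Im R)).
Qed.

Lemma cmeasurable_cst (c : R[i]) : cmeasurable (fun=> c).
Proof. by split; exact: measurable_cst. Qed.

Lemma cmeasurableD f g : cmeasurable f -> cmeasurable g ->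
  cmeasurable (fun x => f x + g x).
Proof.
move=> [a b] [c d']; split.
  rewrite [X in measurable_fun _ X](_ : _ = fun x => Re (f x) + Re (g x)).
    exact: measurable_funD.
  by apply/funext => x; case: (f x) => ? ?; case: (g x).
rewrite [X in measurable_fun _ X](_ : _ = fun x => Im (f x) + Im (g x)).
  exact: measurable_funD.
by apply/funext => x; case: (f x) => ? ?; case: (g x).
Qed.

Lemma cmeasurableM f g : cmeasurable f -> cmeasurable g ->
  cmeasurable (fun x => f x * g x).
Proof.
move=> [a b] [c d']; split.
  rewrite [X in measurable_fun _ X](_ : _ =
    fun x => Re (f x) * Re (g x) - Im (f x) * Im (g x)).
    by apply: measurable_funB; exact: measurable_funM.
  by apply/funext => x; case: (f x) => ? ?; case: (g x).
rewrite [X in measurable_fun _ X](_ : _ =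
  fun x => Re (f x) * Im (g x) + Im (f x) * Re (g x)).
  by apply: measurable_funD; exact: measurable_funM.
by apply/funext => x; case: (f x) => ? ?; case: (g x).
Qed.

Lemma cmeasurableB f g : cmeasurable f -> cmeasurable g ->
  cmeasurable (fun x => f x - g x).
Proof.
move=> mf mg; rewrite (_ : (fun _ => _) = fun x => f x + (-1) * g x).
  by apply: cmeasurableD => //; apply: cmeasurableM => //; exact: cmeasurable_cst.
by apply/funext => x; rewrite mulN1r.
Qed.

Lemma cmeasurable_conj f : cmeasurable f -> cmeasurable (fun x => (f x)^*).
Proof.
move=> [a b]; split.
  by apply: eq_measurable_fun a => x _; case: (f x).
rewrite (_ : (fun _ => _) = (fun x => - Im (f x))); first exact: measurable_funN.
by apply/funext => x; case: (f x).
Qed.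

Lemma cmeasurableX f n : cmeasurable f -> cmeasurable (fun x => f x ^+ n).
Proof.
move=> mf; elim: n => [|n ih]; first exact: cmeasurable_cst.
by under eq_fun do rewrite exprS; exact: cmeasurableM.
Qed.

Lemma cmeasurable_sum (I : Type) (r : seq I) (P : pred I) (F : I -> T -> R[i]) :
  (forall i, cmeasurable (F i)) -> cmeasurable (fun x => \sum_(i <- r | P i) F i x).
Proof.
move=> mF; elim: r => [|i r ih].
  by under eq_fun do rewrite big_nil; exact: cmeasurable_cst.
under eq_fun do rewrite big_cons; case: (P i) => //.
exact: cmeasurableD.
Qed.

Lemma cmeasurable_prod (I : Type) (r : seq I) (P : pred I) (F : I -> T -> R[i]) :
  (forall i, cmeasurable (F i)) -> cmeasurable (fun x => \prod_(i <- r | P i) F i x).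
Proof.
move=> mF; elim: r => [|i r ih].
  by under eq_fun do rewrite big_nil; exact: cmeasurable_cst.
under eq_fun do rewrite big_cons; case: (P i) => //.
exact: cmeasurableM.
Qed.

Lemma measurable_normc f : cmeasurable f ->
  measurable_fun setT (fun x => normc (f x)).
Proof.
move=> [a b]; under eq_fun do rewrite normcE.
apply: (@measurableT_comp _ _ _ _ _ _ (@Num.sqrt R)).
  exact: (continuous_measurable_fun (@sqrt_continuous R)).
by apply: measurable_funD; exact: measurable_funX.
Qed.

End ComplexMeasurable.

Lemma cmeasurable_comp (R : realType) d d' (T : measurableType d)
    (T' : measurableType d') (f : T' -> R[i]) (h : T -> T') :
  measurable_fun setT h -> cmeasurable f -> cmeasurable (f \o h).
Proof. by move=> mh [a b]; split; [exact: (measurableT_comp a)|exact: (measurableT_comp b)]. Qed.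

(** * Rotations, characters and Haar measure of the torus *)

Section TorusRotation.
Variable R : realType.
Implicit Types (chi w : torus R) (u : @unit_circle R).

Definition crd (j : nat) chi : R[i] := set_val (chi j).

Lemma normc_crd j chi : normc (crd j chi) = 1.
Proof. exact: (set_mem (valP (chi j))). Qed.

Lemma continuous_crd j : continuous (crd j).
Proof.
move=> chi.
have cp : continuous (fun c : torus R => c j : @unit_circle R).
  by move=> c; exact: proj_continuous.
have cv : continuous (set_val : @unit_circle R -> R[i]) by exact: initial_continuous.
exact: (continuous_comp (cp chi) (cv _)).
Qed.

Lemma cmeasurable_crd j : @cmeasurable R _ (borel (torus R)) (crd j).
Proof.
have h : measurable_fun setT (crd j : borel (torus R) -> borel R[i]).
  exact (@continuous_borel (torus R) R[i] (crd j) (@continuous_crd j)).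
exact: (borel_cmeasurable h).
Qed.

(** In each coordinate a rotation multiplies differences by a number of modulus 1. *)
Lemma continuous_torus_mul w : continuous (torus_mul w).
Proof.
move=> chi; have FF : Filter (torus_mul w x @[x --> chi]).
  exact: (fmap_filter _ (nbhs_filter chi)).
apply/cvg_sup => j.
apply: (@continuous_comp_initial _ _ _ (fun f => f j) (torus_mul w)).
apply: (@continuous_comp_initial _ _ _ set_val (fun chi => torus_mul w chi j)).
move=> chi'; have FF' : Filter (nbhs chi') by exact: nbhs_filter.
apply/(@cvgc_normP _ _ _ FF').
have h := proj1 (@cvgc_normP _ _ _ FF' _ _) (@continuous_crd j chi').
have E c : normc ((set_val \o (torus_mul w)^~ j) c -
    (set_val \o (torus_mul w)^~ j) chi') = normc (crd j c - crd j chi').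
  rewrite (_ : _ - _ = crd j w * (crd j c - crd j chi')); last by rewrite mulrBr.
  by rewrite normcM normc_crd mul1r.
apply: cvg_trans h; apply: near_eq_cvg; apply: nearW => c.
by rewrite -E.
Qed.

Lemma measurable_torus_mul w :
  measurable_fun setT (torus_mul w : borel (torus R) -> borel (torus R)).
Proof. exact (@continuous_borel (torus R) (torus R) _ (@continuous_torus_mul w)). Qed.

End TorusRotation.

Lemma Re_sum (R : realType) (I : Type) (r : seq I) (F : I -> R[i]) :
  Re (\sum_(i <- r) F i) = \sum_(i <- r) Re (F i).
Proof. by apply: (big_morph (@Re R)) => // -[a b] [c d]. Qed.

Section TorusCharacters.
Variable R : realType.
Implicit Types (chi w : torus R).

Lemma prime_index_inj p q : prime p -> prime q ->
  prime_index p = prime_index q -> p = q.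
Proof.
have lt a b : prime a -> (a < b)%N -> (prime_index a < prime_index b)%N.
  move=> pa ab; rewrite /prime_index.
  have -> : b = (a + (b - a).-1.+1)%N by rewrite prednK ?subn_gt0// subnKC// ltnW.
  by rewrite iotaD count_cat /= add0n pa add1n addnS ltnS leq_addr.
move=> pp pq e; case: (ltngtP p q) => // [/(lt _ _ pp)|/(lt _ _ pq)];
  by rewrite e ltnn.
Qed.

Lemma torus_evalMl w chi n :
  torus_eval (torus_mul w chi) n = torus_eval w n * torus_eval chi n.
Proof. by rewrite /torus_eval -big_split; apply: eq_bigr => p _; exact: exprMn. Qed.

(** Rotation by such a point moves the variable of a single prime; this is how one-variable
    inequalities act on functions on the torus. *)
Definition put (j : nat) w : torus R := fun i => if i == j then w j else @circle1 R.

Lemma torus_eval_put p w n : prime p -> (0 < n)%N ->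
  torus_eval (put (prime_index p) w) n = crd (prime_index p) w ^+ logn p n.
Proof.
move=> pp n0; rewrite /torus_eval /put.
have E q : q \in primes n -> q != p ->
   set_val (if prime_index q == prime_index p then w (prime_index p) else @circle1 R)
     ^+ logn q n = 1.
  rewrite mem_primes => /and3P[pq _ _] qp; case: eqP => [/(prime_index_inj pq pp)|_].
    by move/eqP : qp.
  by rewrite expr1n.
have [pn|pn] := boolP (p \in primes n).
  rewrite (bigD1_seq p)//= ?primes_uniq// eqxx big_seq_cond big1 ?mulr1//.
  by move=> q /andP[]; exact: E.
have -> : logn p n = 0%N.
  by rewrite lognE pp n0; case: ifPn => // dn; rewrite mem_primes pp n0 dn in pn.
rewrite expr0 big_seq big1// => q qn; apply: E => //.
by apply: contraNneq pn => <-.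
Qed.

Lemma normc_torus_eval chi n : normc (torus_eval chi n) = 1.
Proof.
rewrite /torus_eval; elim/big_ind : _ => [|x y x1 y1|p _]; first exact: normc1.
  by rewrite normcM x1 y1 mulr1.
by rewrite normcX (_ : normc _ = 1) ?expr1n//; exact: normc_crd.
Qed.

Lemma cmeasurable_torus_eval n :
  @cmeasurable R _ (borel (torus R)) (fun chi => torus_eval chi n).
Proof.
by apply: cmeasurable_prod => p; apply: cmeasurableX; exact: cmeasurable_crd.
Qed.

Lemma exists_root_N1 k : (0 < k)%N ->
  exists w, forall j, crd j w ^+ k = -1.
Proof.
move=> k0; pose z : R[i] := k.-root (-1).
have zk : z ^+ k = -1 by rewrite rootCK.
have z1 : unit_circle z.
  apply/eqP; rewrite /unit_circle/= -(@pexpr_eq1 _ _ k)// ?normc_ge0//.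
  by rewrite -normcX zk normc_opp normc1.
by exists (fun=> SigSub (mem_set z1)) => j.
Qed.

End TorusCharacters.

Lemma bounded_integrable d (T : measurableType d) (R : realType)
    (P : probability T R) (f : T -> R) (M : R) :
  measurable_fun setT f -> (forall x, `|f x| <= M) ->
  P.-integrable setT (fun x => (f x)%:E).
Proof.
move=> mf fM; apply: measurable_bounded_integrable => //.
  exact: le_lt_trans (probability_le1 P measurableT) (ltry 1).
exists M; split; first exact: num_real.
by move=> N MN x _ /=; rewrite (le_trans (fM x))// ltW.
Qed.

Lemma integral_prob_cst d (T : measurableType d) (R : realType)
    (P : probability T R) (c : R) : (\int[P]__ c%:E = c%:E)%E.
Proof. by rewrite integral_cst// [X in (_ * X)%E]probability_setT mule1. Qed.

Section Haar.
Variables (R : realType) (m : probability (borel (torus R)) R).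
Hypothesis m_haar : normalized_haar m.
Implicit Types (chi w : torus R).

Lemma haar_integral w (f : borel (torus R) -> \bar R) : measurable_fun setT f ->
  (\int[m]_chi f (torus_mul w chi) = \int[m]_chi f chi)%E.
Proof.
have ge0 (g : borel (torus R) -> \bar R) : measurable_fun setT g ->
    (forall x, 0 <= g x)%E ->
    (\int[m]_chi g (torus_mul w chi) = \int[m]_chi g chi)%E.
  move=> mg g0.
  have := @ge0_integral_pushforward _ _ _ _ R _ (measurable_torus_mul w) m
    setT g measurableT mg (fun x _ => g0 x).
  rewrite preimage_setT => <-.
  apply: eq_measure_integral; first exact: measurable_torus_mul.
  by move=> mw A mA _; exact (m_haar w mA).
move=> mf; rewrite integralE [RHS]integralE.
have mp := measurable_funepos mf; have mn := measurable_funeneg mf.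
have hp := ge0 _ mp (@funepos_ge0 _ _ f).
have hn := ge0 _ mn (@funeneg_ge0 _ _ f).
congr (_ - _)%E.
  by rewrite -[RHS]hp; congr integral; apply/funext => x; rewrite !funeposE.
by rewrite -[RHS]hn; congr integral; apply/funext => x; rewrite !funenegE.
Qed.

(** Some prime occurs in [a] and [b] with exponents that differ by k > 0. Rotating its variable by a
    k-th root of -1, or by the inverse of its conjugate, changes the sign of the integrand and
    leaves the integral invariant. *)
Lemma haar_orthogonal (c : R[i]) a b : (0 < a)%N -> (0 < b)%N -> a != b ->
  (\int[m]_chi (Re (c * (torus_eval chi a * (torus_eval chi b)^*)))%:E = 0)%E.
Proof.
move=> a0 b0 ab.
have [p] : exists p, logn p a != logn p b.
  apply: contrapT => /forallNP h; move/eqP : ab; apply; apply: eqn_from_log => //.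
  by move=> p; apply/eqP; apply: contrapT => /negP; exact: h.
move=> eab; have pp : prime p.
  apply: contraNT eab => /negbTE np.
  have z n : logn p n = 0%N by rewrite lognE np.
  by rewrite !z.
(* With truncated subtraction this is the absolute difference of the exponents. *)
pose k := ((logn p a - logn p b) + (logn p b - logn p a))%N.
have k0 : (0 < k)%N by rewrite /k; move/eqP : eab; lia.
have [w wk] := @exists_root_N1 R _ k0.
have uu j : crd j w * (crd j w)^* = 1.
  by rewrite mulc_conj normc_crd expr1n.
pose f chi := c * (torus_eval chi a * (torus_eval chi b)^*).
have fN chi : f (torus_mul (put (prime_index p) w) chi) = - f chi.
  rewrite /f !torus_evalMl !torus_eval_put// rmorphM rmorphXn /=.
  set u := crd _ w; have {}uu := uu (prime_index p); have {}wk := wk (prime_index p).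
  rewrite -/u in uu wk.
  suff h : u ^+ logn p a * u^* ^+ logn p b = -1.
    by rewrite mulrACA h mulN1r mulrN.
  have [lab|lab] := ltnP (logn p a) (logn p b).
    have -> : logn p b = (logn p a + k)%N by rewrite /k; lia.
    by rewrite exprD mulrA -exprMn uu expr1n mul1r -rmorphXn wk rmorphN rmorph1.
  have -> : logn p a = (k + logn p b)%N by rewrite /k; lia.
  by rewrite exprD -mulrA -exprMn uu expr1n mulr1.
have mf : measurable_fun setT (fun chi : borel (torus R) => (Re (f chi))%:E).
  apply/measurable_EFinP.
  suff : @cmeasurable R _ (borel (torus R)) f by case.
  apply: cmeasurableM; first exact: cmeasurable_cst.
  apply: cmeasurableM; first exact: cmeasurable_torus_eval.
  by apply: cmeasurable_conj; exact: cmeasurable_torus_eval.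
have intf : m.-integrable setT (fun chi => (Re (f chi))%:E).
  apply: (@bounded_integrable _ _ _ _ _ (normc c)); first exact/measurable_EFinP.
  move=> x; rewrite (le_trans (normc_Re _))//.
  by rewrite /f !normcM normc_conj !normc_torus_eval !mulr1.
have E : (\int[m]_chi (Re (f chi))%:E = - \int[m]_chi (Re (f chi))%:E)%E.
  rewrite -[LHS](haar_integral (put (prime_index p) w))//.
  transitivity (\int[m]_chi (- (Re (f chi))%:E))%E.
    by apply: eq_integral => x _; rewrite fN; case: (f x).
  rewrite integralN//; exact: integrable_add_def.
have fn : (\int[m]_chi (Re (f chi))%:E)%E \is a fin_num by exact: integrable_fin_num.
move: E; rewrite -/f; rewrite -(fineK fn) -EFinN => -[]; set x := fine _ => xx.
congr EFin; lra.
Qed.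

(** An arbitrary index list covers both the powers of one prime and a range of integers; the
    off-diagonal terms vanish by [haar_orthogonal]. *)
Lemma parseval (I : eqType) (r : seq I) (idx : I -> nat) (c : I -> R[i]) :
  uniq r -> {in r &, injective idx} -> {in r, forall i, 0 < idx i}%N ->
  (\int[m]_chi (normc (\sum_(i <- r) c i * torus_eval chi (idx i)) ^+ 2)%:E =
   (\sum_(i <- r) normc (c i) ^+ 2)%:E)%E.
Proof.
move=> ur inj pos.
pose x i j chi := Re (c i * (c j)^* *
  (torus_eval chi (idx i) * (torus_eval chi (idx j))^*)).
have sqE chi : normc (\sum_(i <- r) c i * torus_eval chi (idx i)) ^+ 2 =
    \sum_(i <- r) \sum_(j <- r) x i j chi.
  set S := \sum_(i <- r) (c i * torus_eval chi (idx i)).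
  have -> : normc S ^+ 2 = Re (S * S^*) by rewrite mulc_conj.
  rewrite {2}/S rmorph_sum mulr_sumr.
  transitivity (\sum_(j <- r) Re (S * (c j * torus_eval chi (idx j))^*)).
    exact: Re_sum.
  rewrite exchange_big; apply: eq_bigr => j _.
  rewrite /S mulr_suml.
  transitivity (\sum_(i <- r) Re (c i * torus_eval chi (idx i) * (c j * torus_eval chi (idx j))^*)).
    exact: Re_sum.
  by apply: eq_bigr => i _; rewrite rmorphM mulrACA.
have ix i j : m.-integrable setT (fun chi => (x i j chi)%:E).
  apply: (@bounded_integrable _ _ _ _ _ (normc (c i * (c j)^*))).
    suff : @cmeasurable R _ (borel (torus R)) (fun chi => c i * (c j)^* *
      (torus_eval chi (idx i) * (torus_eval chi (idx j))^*)) by case.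
    apply: cmeasurableM; first exact: cmeasurable_cst.
    apply: cmeasurableM; first exact: cmeasurable_torus_eval.
    by apply: cmeasurable_conj; exact: cmeasurable_torus_eval.
  move=> y; rewrite (le_trans (normc_Re _))//.
  rewrite [X in X <= _]normcM.
  have -> : normc (torus_eval y (idx i) * (torus_eval y (idx j))^*) = 1.
    by rewrite normcM normc_conj !normc_torus_eval mulr1.
  by rewrite mulr1.
under eq_integral => chi _.
  rewrite sqE -sumEFin; under eq_bigr do rewrite -sumEFin.
  over.
rewrite integral_sum//; last by move=> i; apply: integrable_sum => // j _.
rewrite -sumEFin big_seq [RHS]big_seq; apply: eq_bigr => i ir.
rewrite integral_sum// (bigD1_seq i)//= big_seq_cond big1 => [|j /andP[jr ji]].
  rewrite adde0 -[RHS](@integral_prob_cst _ _ _ m).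
  apply: eq_integral => chi _ /=; congr EFin.
  by rewrite /x !mulc_conj normc_torus_eval expr1n mulr1.
apply: haar_orthogonal; [exact: pos|exact: pos|].
by apply: contraNneq ji => e; apply/eqP/inj.
Qed.

End Haar.

Section ProbabilityIntegral.
Context d (T : measurableType d) (R : realType) (P : probability T R).
Implicit Types f g : T -> R.

Lemma le_integral_EFin f g : measurable_fun setT f -> measurable_fun setT g ->
  (forall x, 0 <= f x <= g x) ->
  (\int[P]_x (f x)%:E <= \int[P]_x (g x)%:E)%E.
Proof.
move=> mf mg fg.
have := @ge0_le_integral _ T R P setT measurableT (EFin \o f) (EFin \o g).
apply=> [x _|||x _]; rewrite ?lee_fin//=; try exact/measurable_EFinP.
all: by have /andP[f0 fgx] := fg x; rewrite // (le_trans f0).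
Qed.

Lemma integral_EFinD f g : measurable_fun setT f -> measurable_fun setT g ->
  (forall x, 0 <= f x) -> (forall x, 0 <= g x) ->
  (\int[P]_x (f x + g x)%:E = \int[P]_x (f x)%:E + \int[P]_x (g x)%:E)%E.
Proof.
move=> mf mg f0 g0.
have := @ge0_integralD _ T R P setT measurableT (EFin \o f) (EFin \o g).
by apply => [x _||x _|]; rewrite ?lee_fin//; exact/measurable_EFinP.
Qed.

Lemma integral_EFinZ (k : R) f : measurable_fun setT f ->
  0 <= k -> (forall x, 0 <= f x) ->
  (\int[P]_x (k * f x)%:E = k%:E * \int[P]_x (f x)%:E)%E.
Proof.
move=> mf k0 f0.
have := @ge0_integralZl_EFin _ T R P setT measurableT (EFin \o f).
by apply => [x _||]; rewrite ?lee_fin//; exact/measurable_EFinP.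
Qed.

Lemma integral_EFinD_cst f (c : R) : measurable_fun setT f ->
  (forall x, 0 <= f x) -> 0 <= c ->
  (\int[P]_x (f x + c)%:E = \int[P]_x (f x)%:E + c%:E)%E.
Proof.
move=> mf f0 c0; rewrite integral_EFinD//.
by rewrite integral_prob_cst.
Qed.

Lemma integral_bounded_lty f (M : R) : measurable_fun setT f ->
  (forall x, 0 <= f x <= M) -> (\int[P]_x (f x)%:E < +oo)%E.
Proof.
move=> mf fM; apply: (@le_lt_trans _ _ (\int[P]_x M%:E)%E).
  exact: le_integral_EFin.
by rewrite integral_prob_cst ltry.
Qed.

End ProbabilityIntegral.

Section PowerFacts.
Variable R : realType.
Implicit Types x y q : R.

(** On [0, 1] one has t <= t^q; this is applied to x / (x + y) and y / (x + y), which add up to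
    1. *)
Lemma powRD_le x y q : 0 <= x -> 0 <= y -> 0 < q -> q <= 1 ->
  (x + y) `^ q <= x `^ q + y `^ q.
Proof.
move=> x0 y0 q0 q1; have [s0|s0] := ltP 0 (x + y); last first.
  have [-> ->] : x = 0 /\ y = 0 by split; lra.
  by rewrite addr0 powR0 ?gt_eqF// addr0.
have s1 : 0 <= (x + y)^-1 by rewrite invr_ge0 ltW.
have key z : 0 <= z -> z <= x + y -> z / (x + y) * (x + y) `^ q <= z `^ q.
  move=> z0 zs; have [->|zn0] := eqVneq z 0.
    by rewrite !mul0r powR_ge0.
  have zs1 : 0 < z / (x + y) <= 1.
    rewrite ler_pdivrMr// mul1r zs andbT; apply: divr_gt0 => //.
    by rewrite lt0r zn0.
  have zE : z `^ q = (z / (x + y)) `^ q * (x + y) `^ q.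
    by rewrite -powRM ?divr_ge0 ?(ltW s0)// mulfVK// gt_eqF.
  by rewrite zE ler_wpM2r ?powR_ge0//; exact: ger1_powR.
rewrite -[leLHS]mul1r -[X in X * _](mulfV (lt0r_neq0 s0)) mulrDl mulrDl.
by apply: lerD; apply: key => //; rewrite (lerDl, lerDr).
Qed.

Lemma ler_powR_base x y q : 0 <= q -> 0 <= x -> x <= y -> x `^ q <= y `^ q.
Proof. by move=> q0 x0 xy; apply: ge0_ler_powR; rewrite ?nnegrE// (le_trans x0). Qed.

Lemma powR_exprn x q K : q * K%:R = 2 -> 0 <= x -> (x ^+ K) `^ q = x ^+ 2.
Proof.
by move=> qK x0; rewrite -powR_mulrn// -powRrM mulrC qK powR_mulrn.
Qed.

End PowerFacts.

Lemma cmeasurable_horner (R : realType) d (T : measurableType d)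
  (Q : {poly R[i]}) (f : T -> R[i]) : cmeasurable f ->
  cmeasurable (fun x => Q.[f x]).
Proof.
move=> mf; under eq_fun do rewrite horner_coef.
apply: cmeasurable_sum => i; apply: cmeasurableM; first exact: cmeasurable_cst.
exact: cmeasurableX.
Qed.

(** * Contraction and smoothing by dilation on the circle *)

Section OneVariable.
Variables (R : realType) (m : probability (borel (torus R)) R).
Hypothesis m_haar : normalized_haar m.
Variables (l : nat) (q : R).
Hypotheses (q0 : 0 < q) (q1 : q <= 1) (qK : q * (2 ^ l)%:R = 2).
Variable p : nat.
Hypothesis p_prime : prime p.
Implicit Types (Q g : {poly R[i]}) (w : torus R).

Local Notation u w := (crd (prime_index p) w).

Let cu : @cmeasurable R _ (borel (torus R)) (fun w => u w).
Proof. exact: cmeasurable_crd. Qed.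

Let mQ Q (r : R[i]) : measurable_fun setT (fun w : borel (torus R) => normc Q.[r * u w]).
Proof.
apply: measurable_normc; apply: cmeasurable_horner.
by apply: cmeasurableM => //; exact: cmeasurable_cst.
Qed.

Let mQ1 Q : measurable_fun setT (fun w : borel (torus R) => normc Q.[u w]).
Proof. by apply: measurable_normc; exact: cmeasurable_horner. Qed.

Let mpow (f : borel (torus R) -> R) : measurable_fun setT f ->
  measurable_fun setT (fun w : borel (torus R) => f w `^ q).
Proof. by move=> mf; apply: (measurableT_comp (measurable_powR _)). Qed.

Let mexp n (f : borel (torus R) -> R) : measurable_fun setT f ->
  measurable_fun setT (fun w : borel (torus R) => f w ^+ n).
Proof. by move=> mf; exact: measurable_funX. Qed.

Lemma torus_eval_primeX w k : torus_eval w (p ^ k) = u w ^+ k.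
Proof.
elim: k => [|k ih]; first by rewrite /torus_eval /= big_nil.
rewrite expnS torus_evalM ?expn_gt0 ?prime_gt0//.
by rewrite ih torus_eval_prime// exprS.
Qed.

Lemma parseval_poly Q (r : R[i]) :
  (\int[m]_w (normc Q.[r * u w] ^+ 2)%:E = (pnorm (pscale r Q))%:E)%E.
Proof.
transitivity (\int[m]_w (normc (\sum_(i < size (pscale r Q)) (pscale r Q)`_i *
    torus_eval w (p ^ i)) ^+ 2)%:E)%E.
  apply: eq_integral => w _; congr (normc _ ^+ 2)%:E.
  rewrite -horner_pscale horner_coef.
  by apply: eq_bigr => i _; rewrite torus_eval_primeX.
rewrite parseval//.
- exact: index_enum_uniq.
- move=> i j _ _ /eqP; rewrite eqn_exp2l ?prime_gt1// => /eqP e.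
  exact: val_inj.
- by move=> i _; rewrite expn_gt0 prime_gt0.
Qed.

Lemma parseval_poly1 Q : (\int[m]_w (normc Q.[u w] ^+ 2)%:E = (pnorm Q)%:E)%E.
Proof.
have := parseval_poly Q 1; rewrite /pscale scale1r comp_polyXr => <-.
by apply: eq_integral => w _; rewrite mul1r.
Qed.

(** On the circle |g|^2 = (|g|^(2^l))^q <= (|Q| + e)^q <= |Q|^q + e^q, the equality being [qK]. *)
Let pnorm_outer Q g (e : R) : 0 < e ->
  (forall z, normc z = 1 -> normc g.[z] ^+ (2 ^ l) <= normc Q.[z] + e) ->
  ((pnorm g)%:E <= \int[m]_w (normc Q.[u w] `^ q)%:E + (e `^ q)%:E)%E.
Proof.
move=> e0 gQ; rewrite -parseval_poly1 -integral_EFinD_cst ?powR_ge0//; last 2 first.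
- exact: mpow.
- by move=> w; exact: powR_ge0.
apply: le_integral_EFin.
- exact: mexp.
- by apply: measurable_funD => //; exact: mpow.
move=> w; rewrite sqr_ge0/= -(powR_exprn qK) ?normc_ge0//.
apply: le_trans (powRD_le _ _ q0 q1); rewrite ?normc_ge0 ?(ltW e0)//.
apply: ler_powR_base; rewrite ?(ltW q0) ?exprn_ge0 ?normc_ge0//.
by apply: gQ; exact: normc_crd.
Qed.

(** For an approximate root [g], |Q(r z)|^q <= |g(r z)|^2 + e^q; the dilation lowers every
    coefficient of [g] in modulus, and [pnorm_outer] leads back to [Q]. The two errors e^q = d / 2
    make up [d]. *)
Lemma circle_contraction Q (r : R) : 0 <= r -> r <= 1 ->
  (\int[m]_w (normc Q.[r%:C * u w] `^ q)%:E <=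
   \int[m]_w (normc Q.[u w] `^ q)%:E)%E.
Proof.
move=> r0 r1; apply/lee_addgt0Pr => d d0.
pose e := (d / 2) `^ q^-1.
have d2 : 0 < d / 2 by rewrite divr_gt0.
have e0 : 0 < e by exact: powR_gt0.
have eq : e `^ q = d / 2.
  by rewrite -powRrM mulVf ?gt_eqF// powRr1// ltW.
have [M /(_ e e0)[g hg]] := outer_root_all l Q.
have := @pnorm_outer Q g e e0; rewrite eq => /(_ _)/wrap[].
  by move=> z z1; have [|_ _] := hg z; [rewrite z1|exact].
move=> h; have -> : d = d / 2 + d / 2 by lra.
rewrite EFinD addeA; apply: (@le_trans _ _ ((pnorm g)%:E + (d / 2)%:E)%E); last first.
  exact: leeD2r.
apply: (@le_trans _ _ ((pnorm (pscale r%:C g))%:E + (d / 2)%:E)%E); last first.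
  apply: leeD2r; rewrite lee_fin (@pnorm_wide _ (size g)).
    apply: ler_sum => i _; rewrite coef_pscale normcM normcX normc_real ger0_norm//.
    rewrite lerXn2r ?nnegrE ?mulr_ge0 ?exprn_ge0 ?normc_ge0//.
    by rewrite ler_piMr ?normc_ge0// exprn_ile1.
  apply/leq_sizeP => j gj; rewrite coef_pscale.
  by move/leq_sizeP : (leqnn (size g)) => /(_ j gj) ->; rewrite mul0r.
rewrite -parseval_poly -integral_EFinD_cst ?(ltW d2)//; last 2 first.
- exact: mexp.
- by move=> w; exact: sqr_ge0.
apply: le_integral_EFin.
- exact: mpow.
- by apply: measurable_funD => //; exact: mexp.
move=> w; rewrite powR_ge0/= -(powR_exprn qK) ?normc_ge0// -eq.
apply: le_trans (powRD_le _ _ q0 q1); rewrite ?exprn_ge0 ?normc_ge0 ?(ltW e0)//.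
apply: ler_powR_base; rewrite ?(ltW q0) ?normc_ge0//.
have [|//] := hg (r%:C * u w).
by rewrite normcM normc_real ger0_norm// normc_crd mulr1.
Qed.

Lemma circle_mom_lty Q : (\int[m]_w (normc Q.[u w] `^ q)%:E < +oo)%E.
Proof.
apply: (@integral_bounded_lty _ _ _ _ _ ((\sum_(i < size Q) normc Q`_i) `^ q)).
  exact: mpow.
move=> w; rewrite powR_ge0/=; apply: ler_powR_base; rewrite ?(ltW q0) ?normc_ge0//.
rewrite horner_coef (le_trans (normc_sum _ _ _))//; apply: ler_sum => i _.
by rewrite normcM normcX normc_crd expr1n mulr1.
Qed.

(** In the disc |Q| is dominated by |g|^(2^l) up to [e], the dilation of this power is controlled by
    [pnorm_pow2_scale], and [pnorm g] exceeds the q-th moment of [Q] by at most e^q. The errors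
    disappear as [e] tends to 0. *)
Lemma circle_hypercontraction Q (s C0 : R) : 0 <= s -> s <= 1 ->
  (forall n, n.+1%:R * s ^+ (2 * n) <= C0) ->
  pnorm (pscale (s ^+ l)%:C Q) <=
  C0 ^+ (2 ^ l).-1 * fine (\int[m]_w (normc Q.[u w] `^ q)%:E)%E ^+ (2 ^ l).
Proof.
move=> s0 s1 hC; set J := fine _; set C := C0 ^+ _.
have JE : (\int[m]_w (normc Q.[u w] `^ q)%:E)%E = J%:E.
  rewrite fineK// ge0_fin_numE ?circle_mom_lty//.
  by apply: integral_ge0 => w _; rewrite lee_fin powR_ge0.
have C00 : 0 <= C0 by apply: le_trans (hC 0%N); rewrite mul1r expr0.
have C_ge0 : 0 <= C by rewrite exprn_ge0.
have J0 : 0 <= J.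
  by rewrite -lee_fin -JE; apply: integral_ge0 => w _; rewrite lee_fin powR_ge0.
have sl1 : 0 <= s ^+ l <= 1 by rewrite exprn_ge0// exprn_ile1.
(* The form of the bound comes from (G + e)^2 <= (1 + e) G^2 + e (1 + e), which is e (G - 1)^2 >=
   0. *)
pose F e := (1 + e) * (C * (J + e `^ q) ^+ (2 ^ l)) + e * (1 + e).
have cF : F e @[e --> 0^'+] --> F 0.
  have ce : e @[e --> (0 : R)^'+] --> (0 : R) by exact: cvg_at_right_filter cvg_id.
  apply: cvgD; apply: cvgM => //.
  - by apply: cvgD => //; exact: cvg_cst.
  - apply: cvgM; first exact: cvg_cst.
    have cp : (J + e `^ q) @[e --> 0^'+] --> J + 0 `^ q.
      by apply: cvgD; [exact: cvg_cst|rewrite powR0 ?gt_eqF//; exact: powR_cvg0].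
    exact: (@cvg_comp _ _ _ (fun e => J + e `^ q) (fun x => x ^+ (2 ^ l)) _ _ _ cp
      (@exprn_continuous _ _ _)).
  - by apply: cvgD => //; exact: cvg_cst.
have F0 : F 0 = C * J ^+ (2 ^ l).
  by rewrite /F addr0 mul1r mul0r addr0 powR0 ?gt_eqF// addr0.
rewrite -F0 -(cvg_lim _ cF)//; apply: limr_ge; first by apply/cvg_ex; exists (F 0).
near=> e.
have e0 : 0 < e by near: e; exact: nbhs_right_gt.
have [M /(_ e e0)[g hg]] := outer_root_all l Q.
have : pnorm g <= J + e `^ q.
  rewrite -lee_fin EFinD -JE; apply: pnorm_outer => // z z1.
  by have [|_ _] := hg z; [rewrite z1|exact].
move=> pg.
have pg2 : pnorm (pscale (s ^+ l)%:C (g ^+ (2 ^ l))) <= C * (J + e `^ q) ^+ (2 ^ l).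
  apply: (le_trans (pnorm_pow2_scale _ _ s0 hC)).
  rewrite ler_wpM2l// lerXn2r ?nnegrE ?pnorm_ge0//.
  by rewrite addr_ge0// powR_ge0.
apply: (@le_trans _ _ ((1 + e) * pnorm (pscale (s ^+ l)%:C (g ^+ (2 ^ l))) + e * (1 + e))).
  rewrite -lee_fin EFinD -parseval_poly EFinM -parseval_poly.
  rewrite -integral_EFinZ; last 3 first.
  - exact: mexp.
  - by rewrite addr_ge0// ltW.
  - by move=> w; exact: sqr_ge0.
  rewrite -integral_EFinD_cst; last 3 first.
  - by apply: measurable_funM => //; exact: mexp.
  - by move=> w; rewrite mulr_ge0 ?sqr_ge0// addr_ge0// ltW.
  - by rewrite mulr_ge0 ?(ltW e0)// addr_ge0// ltW.
  apply: le_integral_EFin.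
  - exact: mexp.
  - by apply: measurable_funD => //; apply: measurable_funM => //; exact: mexp.
  move=> w; rewrite sqr_ge0/= horner_exp normcX.
  have [|h _ _] := hg ((s ^+ l)%:C * u w).
    by rewrite normcM normc_real ger0_norm ?normc_crd ?mulr1; case/andP : sl1.
  move: h; set G := normc g.[_] ^+ _ => h.
  have := normc_ge0 Q.[(s ^+ l)%:C * u w]; set A := normc _ in h *.
  have G0 : 0 <= G by rewrite exprn_ge0// normc_ge0.
  move=> A0; have : A ^+ 2 <= (G + e) ^+ 2 by rewrite lerXn2r ?nnegrE// addr_ge0// ltW.
  have : 0 <= e * (G - 1) ^+ 2 by rewrite mulr_ge0 ?sqr_ge0// ltW.
  move: (A ^+ 2) => A2; lra.
by rewrite lerD2r ler_wpM2l// addr_ge0// ltW.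
Unshelve. all: by end_near. Qed.

End OneVariable.

(** * Hoelder and Minkowski inequalities; sums grouped into classes *)

Section FiniteSums.
Variable R : realType.

(** The inductive step multiplies the inequality by [b] and adds (n + 1) a^n (b - a)^2 >= 0. *)
Lemma young_exp (n : nat) (a b : R) : 0 <= a -> 0 <= b ->
  n.+1%:R * (a ^+ n * b) <= n%:R * a ^+ n.+1 + b ^+ n.+1.
Proof.
move=> a0 b0; elim: n => [|n ih]; first by rewrite !expr0 mul0r add0r !mul1r expr1.
have h1 := ler_wpM2r b0 ih.
have h2 : 0 <= n.+1%:R * (a ^+ n * (b - a) ^+ 2).
  by apply: mulr_ge0 => //; apply: mulr_ge0; [exact: exprn_ge0|exact: sqr_ge0].
have e1 : b ^+ n.+2 = b ^+ n.+1 * b by rewrite exprSr.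
have e2 : a ^+ n.+2 = a ^+ n * a ^+ 2 by rewrite -exprD addn2.
have e3 : a ^+ n.+1 = a ^+ n * a by rewrite exprSr.
rewrite e1 e2 e3; rewrite e3 in h1.
rewrite -!natr1 in h1 h2 *.
move: (a ^+ n) (b ^+ n.+1) (n%:R : R) h1 h2 => A B k h1 h2.
lra.
Qed.

(** Hoelder's inequality for the exponents (n + 1)/n and n + 1, with the norms given as [A] and [G].
    Young's inequality is applied to x_i G and g_i A, a scaling that makes the two sums of powers
    equal. *)
Lemma hoelder_exp (I : Type) (r : seq I) (n : nat) (x g : I -> R) (A G : R) :
  0 < A -> 0 <= G -> (forall i, 0 <= x i) -> (forall i, 0 <= g i) ->
  \sum_(i <- r) x i ^+ n.+1 = A ^+ n.+1 ->
  \sum_(i <- r) g i ^+ n.+1 = G ^+ n.+1 ->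
  \sum_(i <- r) x i ^+ n * g i <= A ^+ n * G.
Proof.
move=> A0 G0 x0 g0 xA gG; have [G00|Gn0] := eqVneq G 0.
  have s0 : \sum_(i <- r) g i ^+ n.+1 = 0 by rewrite gG G00 expr0n.
  have {s0} h : all (fun i => g i == 0) r.
    have p0 i : 0 <= g i ^+ n.+1 by rewrite exprn_ge0.
    elim: r {xA gG} s0 => //= i r ih; rewrite big_cons => /eqP.
    rewrite paddr_eq0//; last exact: sumr_ge0.
    by rewrite expf_eq0 => /andP[/andP[_ ->] /eqP /ih].
  rewrite G00 mulr0; elim: r h {xA gG} => [|i r ih] /=; first by rewrite big_nil.
  by move=> /andP[/eqP gi /ih]; rewrite big_cons gi mulr0 add0r.
have Gp : 0 < G by rewrite lt_neqAle eq_sym Gn0.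
have c0 : 0 < n.+1%:R * (G ^+ n * A) by rewrite !mulr_gt0// exprn_gt0.
rewrite -(ler_pM2l c0) mulr_sumr.
apply: (@le_trans _ _ (\sum_(i <- r) (n%:R * (x i * G) ^+ n.+1 + (g i * A) ^+ n.+1))).
  apply: ler_sum => i _; have := @young_exp n (x i * G) (g i * A).
  rewrite !mulr_ge0 ?(ltW A0)// => /(_ isT isT); apply: le_trans.
  by rewrite exprMn le_eqVlt; apply/orP; left; apply/eqP; ring.
rewrite big_split/= -mulr_sumr.
have -> : \sum_(i <- r) (x i * G) ^+ n.+1 = A ^+ n.+1 * G ^+ n.+1.
  by rewrite -xA mulr_suml; apply: eq_bigr => i _; rewrite exprMn.
have -> : \sum_(i <- r) (g i * A) ^+ n.+1 = G ^+ n.+1 * A ^+ n.+1.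
  by rewrite -gG mulr_suml; apply: eq_bigr => i _; rewrite exprMn.
rewrite !exprS -natr1 le_eqVlt; apply/orP; left; apply/eqP.
ring.
Qed.

Lemma sum_classes (I T : eqType) (r : seq I) (ks : seq T) (P : pred I)
    (key : I -> T) (F : I -> T -> R) :
  uniq ks -> {in r, forall n, P n -> key n \in ks} ->
  \sum_(k <- ks) \sum_(n <- r | P n && (key n == k)) F n k =
  \sum_(n <- r | P n) F n (key n).
Proof.
move=> uk kk; rewrite (exchange_big_dep P)/=; last by move=> k n _ /andP[].
rewrite big_seq_cond [RHS]big_seq_cond; apply: eq_bigr => n /andP[nr Pn].
under eq_bigl do rewrite Pn /=.
rewrite (big_rem (key n)) ?kk//= eqxx.
rewrite [X in _ + X]big_seq_cond [X in _ + X]big1 ?addr0// => k /andP[+ /eqP kn].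
by rewrite mem_rem_uniq// inE -kn eqxx.
Qed.

(** A sum over pairs with equal keys no longer refers to the list of classes, so energies for
    different keys can be compared term by term. *)
Lemma sqr_normc_classes (I T : eqType) (r : seq I) (ks : seq T) (P : pred I)
    (key : I -> T) (x : I -> R[i]) :
  uniq ks -> {in r, forall n, P n -> key n \in ks} ->
  \sum_(k <- ks) normc (\sum_(n <- r | P n && (key n == k)) x n) ^+ 2 =
  \sum_(n <- r | P n) \sum_(n' <- r | P n' && (key n' == key n)) Re (x n * (x n')^*).
Proof.
move=> uk kk.
have E k : normc (\sum_(n <- r | P n && (key n == k)) x n) ^+ 2 =
    \sum_(n <- r | P n && (key n == k))
      \sum_(n' <- r | P n' && (key n' == k)) Re (x n * (x n')^*).
  set S := \sum_(n <- r | P n && (key n == k)) x n.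
  have -> : normc S ^+ 2 = Re (S * S^*) by rewrite mulc_conj.
  rewrite {1}/S mulr_suml -big_filter Re_sum big_filter; apply: eq_bigr => n _.
  by rewrite /S rmorph_sum mulr_sumr -big_filter Re_sum big_filter.
under eq_bigr do rewrite E.
exact: (sum_classes (fun n k => \sum_(n' <- r | P n' && (key n' == k)) Re (x n * (x n')^*))).
Qed.

Lemma pnorm_monomials (I : eqType) (r : seq I) (P : pred I) (e : I -> nat)
    (x : I -> R[i]) :
  pnorm (\sum_(n <- r | P n) x n *: 'X^(e n)) =
  \sum_(n <- r | P n) \sum_(n' <- r | P n' && (e n' == e n)) Re (x n * (x n')^*).
Proof.
set Q : {poly R[i]} := \sum_(n <- r | P n) x n *: 'X^(e n).
pose N := maxn (size Q) (\max_(n <- r) (e n).+1).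
rewrite (@pnorm_wide _ N) ?leq_maxl//.
rewrite -(@sqr_normc_classes _ _ r (iota 0 N)) ?iota_uniq//; last first.
  move=> n nr _; rewrite mem_iota add0n /= (leq_trans _ (leq_maxr _ _))//.
  by rewrite (big_rem n nr)/= leq_maxl.
rewrite -(big_mkord xpredT (fun i => normc Q`_i ^+ 2)) /index_iota subn0.
apply: eq_bigr => i _; congr (normc _ ^+ 2).
rewrite /Q coef_sum big_mkcondr; apply: eq_bigr => n _.
by rewrite coefZ coefXn eq_sym; case: eqP; rewrite ?mulr1 ?mulr0.
Qed.

End FiniteSums.

(** Minkowski's integral inequality in l^(n+1). Let X = A^(n+1) be the left side. Writing one factor
    of each x_i^(n+1) as an integral and using Hoelder's inequality under it gives X <= A^n Y,
    whence A <= Y. *)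
Lemma minkowski_exp d (T : measurableType d) (R : realType) (P : probability T R)
    (I : eqType) (r : seq I) (n : nat) (g : I -> T -> R) (x : I -> R) (Y : R) :
  (forall i, measurable_fun setT (g i)) -> (forall i t, 0 <= g i t) ->
  (forall i, \int[P]_t (g i t)%:E = (x i)%:E)%E ->
  (\int[P]_t ((\sum_(i <- r) g i t ^+ n.+1) `^ (n.+1%:R^-1))%:E = Y%:E)%E ->
  \sum_(i <- r) x i ^+ n.+1 <= Y ^+ n.+1.
Proof.
move=> mg g0 gx GY.
have x0 i : 0 <= x i.
  by rewrite -lee_fin -gx; apply: integral_ge0 => t _; rewrite lee_fin.
pose G t := (\sum_(i <- r) g i t ^+ n.+1) `^ (n.+1%:R^-1).
have G0 t : 0 <= G t by exact: powR_ge0.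
have rootK z : 0 <= z -> (z `^ (n.+1%:R^-1)) ^+ n.+1 = z :> R.
  by move=> z0; rewrite -powR_mulrn ?powR_ge0// -powRrM mulVf ?pnatr_eq0// powRr1.
have GK t : \sum_(i <- r) g i t ^+ n.+1 = G t ^+ n.+1.
  by rewrite rootK// sumr_ge0// => i _; exact: exprn_ge0.
have Y0 : 0 <= Y.
  by rewrite -lee_fin -GY; apply: integral_ge0 => t _; rewrite lee_fin G0.
pose X := \sum_(i <- r) x i ^+ n.+1.
have X0 : 0 <= X by apply: sumr_ge0 => i _; exact: exprn_ge0.
rewrite -/X; have [->|Xn0] := eqVneq X 0; first exact: exprn_ge0.
have Xp : 0 < X by rewrite lt_neqAle eq_sym Xn0.
pose A := X `^ (n.+1%:R^-1); have A0 : 0 < A by exact: powR_gt0.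
have AX : A ^+ n.+1 = X by exact: rootK.
have mG : measurable_fun setT G.
  apply: (measurableT_comp (measurable_powR _)).
  by apply: measurable_sum => i; exact: measurable_funX.
suff : X <= A ^+ n * Y.
  rewrite -{1}AX exprSr ler_pM2l ?exprn_gt0// => AY.
  by rewrite -AX lerXn2r ?nnegrE// ltW.
have -> : X = \sum_(i <- r) x i ^+ n * x i by apply: eq_bigr => i _; rewrite exprSr.
rewrite -lee_fin EFinM -GY -sumEFin.
have -> : (\sum_(i <- r) (x i ^+ n * x i)%:E =
    \int[P]_t (\sum_(i <- r) x i ^+ n * g i t)%:E)%E.
  transitivity (\int[P]_t (\sum_(i <- r) (x i ^+ n * g i t)%:E))%E; last first.
    by apply: eq_integral => t _; rewrite sumEFin.
  rewrite ge0_integral_sum//; last 2 first.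
  - by move=> i; apply/measurable_EFinP; exact: measurable_funM.
  - by move=> i t _; rewrite lee_fin mulr_ge0// exprn_ge0.
  apply: eq_bigr => i _; rewrite integral_EFinZ ?exprn_ge0//.
  by rewrite gx EFinM.
rewrite -integral_EFinZ ?exprn_ge0 ?(ltW A0)//.
apply: le_integral_EFin.
- by apply: measurable_sum => i; exact: measurable_funM.
- exact: measurable_funM.
move=> t; apply/andP; split.
  by apply: sumr_ge0 => i _; rewrite mulr_ge0// exprn_ge0.
by apply: (hoelder_exp A0 (G0 t) x0 (fun i => g0 i t) (esym AX) (GK t)).
Qed.

(** * Contraction on the torus, one prime at a time *)

Section Tensorization.
Variables (R : realType) (m : probability (borel (torus R)) R).
Hypothesis m_haar : normalized_haar m.
Implicit Types (chi w : torus R) (a b : nat -> R[i]).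

Definition tpoly (N : nat) a chi : R[i] :=
  \sum_(1 <= n < N) a n * torus_eval chi n.

Definition rot (p : nat) (z : borel (torus R) * borel (torus R)) : torus R :=
  torus_mul (put (prime_index p) (z.2 : torus R)) (z.1 : torus R).

Lemma torus_eval_rot p z n : prime p -> (0 < n)%N ->
  torus_eval (rot p z) n =
  crd (prime_index p) (z.2 : torus R) ^+ logn p n * torus_eval (z.1 : torus R) n.
Proof. by move=> pp n0; rewrite /rot torus_evalMl torus_eval_put. Qed.

Lemma cmeasurable_rot p n : prime p ->
  cmeasurable (fun z => torus_eval (rot p z) n).
Proof.
move=> pp; have [->|n0] := posnP n.
  rewrite (_ : (fun _ => _) = fun=> 1); first exact: cmeasurable_cst.
  by apply/funext => z; rewrite /torus_eval /= big_nil.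
under eq_fun do rewrite torus_eval_rot//.
apply: cmeasurableM.
  apply: cmeasurableX.
  exact: (cmeasurable_comp measurable_snd (@cmeasurable_crd R (prime_index p))).
exact: (cmeasurable_comp measurable_fst (@cmeasurable_torus_eval R n)).
Qed.

Section MeasurableComp.
Context d (T : measurableType d) (h : T -> torus R).
Hypothesis mh : forall n, cmeasurable (fun t => torus_eval (h t) n).

Lemma cmeasurable_tpoly N a : cmeasurable (fun t => tpoly N a (h t)).
Proof.
apply: cmeasurable_sum => n; apply: cmeasurableM; first exact: cmeasurable_cst.
exact: mh.
Qed.

End MeasurableComp.

(** After Tonelli's theorem each fixed [w] contributes a rotation of [chi], which Haar measure
    ignores. The inner integral thus isolates one variable without splitting the torus into a
    product. *)
Lemma haar_average p (f : borel (torus R) -> \bar R) : prime p ->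
  measurable_fun setT f -> measurable_fun setT (fun z => f (rot p z)) ->
  (forall x, 0 <= f x)%E ->
  (\int[m]_chi \int[m]_w f (rot p (chi, w)) = \int[m]_chi f chi)%E.
Proof.
move=> pp mf mjf f0.
have := @fubini_tonelli _ _ _ _ R m m _ mjf (fun z => f0 _).
rewrite /fubini_F /fubini_G => ->.
transitivity (\int[m]_y (\int[m]_chi f chi))%E.
  apply: eq_integral => w _.
  exact: (haar_integral m_haar (put (prime_index p) (w : torus R)) mf).
by rewrite integral_cst// [X in (_ * X)%E]probability_setT mule1.
Qed.

Section Fixed.
Variables (l : nat) (q : R).
Hypotheses (q0 : 0 < q) (q1 : q <= 1) (qK : q * (2 ^ l)%:R = 2).

Definition tmom N a : \bar R := (\int[m]_chi (normc (tpoly N a chi) `^ q)%:E)%E.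

Lemma tpoly_rot p N a z : prime p ->
  tpoly N a (rot p z) =
  (\sum_(1 <= n < N) (a n * torus_eval (z.1 : torus R) n) *: 'X^(logn p n)).[
    crd (prime_index p) (z.2 : torus R)].
Proof.
move=> pp; rewrite horner_sum /tpoly !big_nat; apply: eq_bigr => n /andP[n0 _].
by rewrite torus_eval_rot// hornerZ hornerXn mulrA mulrAC -mulrA [X in _ * X]mulrC mulrA.
Qed.

(** For fixed [chi] the inner average is the moment of a polynomial in the variable of [p], to which
    [circle_contraction] applies. *)
Lemma tmom_prime_contraction p N a (r : R) : prime p -> 0 <= r -> r <= 1 ->
  (tmom N (fun n => a n * r%:C ^+ logn p n)%R <= tmom N a)%E.
Proof.
move=> pp r0 r1.
have mm d (T : measurableType d) (h : T -> torus R) b :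
    (forall n, cmeasurable (fun t => torus_eval (h t) n)) ->
    measurable_fun setT (fun t => (normc (tpoly N b (h t)) `^ q)%:E).
  move=> mh; apply/measurable_EFinP; apply: (measurableT_comp (measurable_powR _)).
  by apply: measurable_normc; exact: cmeasurable_tpoly.
have mid n : @cmeasurable R _ (borel (torus R)) (fun t => torus_eval t n).
  exact: cmeasurable_torus_eval.
pose f b (chi : borel (torus R)) := (normc (tpoly N b chi) `^ q)%:E.
have mf b : measurable_fun setT (f b) by exact (mm _ (borel (torus R)) id b mid).
have mjf b : measurable_fun setT (fun z => f b (rot p z)).
  exact (mm _ _ (rot p) b (fun n => cmeasurable_rot n pp)).
have f0 b x : (0 <= f b x)%E by rewrite lee_fin powR_ge0.
rewrite /tmom -(haar_average pp (mf _) (mjf _) (f0 _)).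
rewrite -[leRHS](haar_average pp (mf _) (mjf _) (f0 _)).
pose ar n := a n * r%:C ^+ logn p n.
pose G b (chi : borel (torus R)) := (\int[m]_w f b (rot p (chi, w)))%E.
have mG b : measurable_fun setT (G b).
  exact (@measurable_fun_fubini_tonelli_F _ _ _ _ _ m _ (mjf b) (fun _ => f0 _ _)).
have G0 b chi : (0 <= G b chi)%E by apply: integral_ge0 => w _.
have := @ge0_le_integral _ _ R m setT measurableT
  (G ar) (G a).
apply => [x _|||chi _]; [exact: G0|exact: mG|exact: mG|].
pose Q : {poly R[i]} :=
  \sum_(1 <= n < N) (a n * torus_eval (chi : torus R) n) *: 'X^(logn p n).
have := circle_contraction m_haar q0 q1 qK pp Q r0 r1.
have -> : (\int[m]_w (normc Q.[crd (prime_index p) w] `^ q)%:E = G a chi)%E.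
  by apply: eq_integral => w _; rewrite /f tpoly_rot.
suff -> : (\int[m]_w (normc Q.[r%:C * crd (prime_index p) w] `^ q)%:E =
  G ar chi)%E by [].
apply: eq_integral => w _; rewrite /f tpoly_rot//.
congr (normc _ `^ q)%:E; rewrite /Q !horner_sum; apply: eq_bigr => n _.
by rewrite !hornerZ !hornerXn exprMn mulrACA mulrA.
Qed.

End Fixed.
End Tensorization.

(** * Smoothing on the torus, one prime at a time *)

Section VectorTensorization.
Variables (R : realType) (m : probability (borel (torus R)) R).
Hypothesis m_haar : normalized_haar m.
Variables (l : nat) (q : R).
Hypotheses (q0 : 0 < q) (q1 : q <= 1) (qK : q * (2 ^ l)%:R = 2).
Implicit Types (chi w : torus R) (a b : nat -> R[i]) (key : nat -> seq nat).

Local Notation theta := (((2 ^ l)%:R : R)^-1).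

(** If [key n] lists the exponents in [n] of the primes already treated, this is the square mean
    over the variables of these primes, the other variables being frozen at [chi]: the factor common
    to a class has modulus 1. A constant key gives |f|^2, a separating key the sum of the squared
    coefficients. *)
Definition kenergy N key b chi : R :=
  \sum_(k <- undup (map key (index_iota 1 N)))
    normc (\sum_(1 <= n < N | key n == k) b n * torus_eval chi n) ^+ 2.

Lemma kenergy_ge0 N key b chi : 0 <= kenergy N key b chi.
Proof. by apply: sumr_ge0 => k _; exact: sqr_ge0. Qed.

Let inks N key : {in index_iota 1 N, forall n, predT n ->
  key n \in undup (map key (index_iota 1 N))}.
Proof. by move=> n nr _; rewrite mem_undup map_f. Qed.

Lemma kenergyE N key b chi : kenergy N key b chi =
  \sum_(1 <= n < N) \sum_(1 <= n' < N | key n' == key n)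
    Re (b n * torus_eval chi n * (b n' * torus_eval chi n')^*).
Proof. exact: (sqr_normc_classes _ (undup_uniq _) (@inks N key)). Qed.

Lemma kenergy_cst N b chi :
  kenergy N (fun=> [::]) b chi = normc (tpoly N b chi) ^+ 2.
Proof.
have h := @sqr_normc_classes R nat (seq nat) (index_iota 1 N) [:: [::]] predT
  (fun=> [::]) (fun n => b n * torus_eval chi n) isT (fun _ _ _ => mem_head _ _).
by rewrite kenergyE; apply: etrans (esym h) _; rewrite big_seq1.
Qed.

Lemma kenergy_inj N key b chi : {in index_iota 1 N &, injective key} ->
  kenergy N key b chi = \sum_(1 <= n < N) normc (b n) ^+ 2.
Proof.
move=> inj; rewrite kenergyE big_seq [RHS]big_seq; apply: eq_bigr => n nr.
rewrite (big_rem n)//= eqxx big_seq_cond big1 ?addr0.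
  by rewrite mulc_conj normcM normc_torus_eval mulr1.
move=> k /andP[]; rewrite mem_rem_uniq ?iota_uniq// inE => /andP[kn kr] /eqP e.
by move/eqP : kn; rewrite (inj _ _ kr nr e).
Qed.

Lemma measurable_kenergy d (T : measurableType d) (h : T -> torus R) N key b :
  (forall n, cmeasurable (fun t => torus_eval (h t) n)) ->
  measurable_fun setT (fun t => kenergy N key b (h t)).
Proof.
move=> mh; apply: measurable_sum => k; apply: measurable_funX.
apply: measurable_normc; apply: cmeasurable_sum => n.
by apply: cmeasurableM; [exact: cmeasurable_cst|exact: mh].
Qed.

Definition kmom N key b : \bar R :=
  (\int[m]_chi (kenergy N key b chi `^ theta)%:E)%E.

Let K0 : (0 < 2 ^ l)%N. Proof. by rewrite expn_gt0. Qed.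

Let theta_gt0 : 0 < theta. Proof. by rewrite invr_gt0 ltr0n. Qed.

(** Each class is a polynomial in the variable of [p], and refining the classes by the exponent of
    [p] gives its [pnorm]. [circle_hypercontraction] bounds the dilated norm by J_k^(2^l), and
    Minkowski's inequality moves the sum over the classes inside the integral. *)
Lemma kenergy_prime_step N key b p (s C0 : R) chi : prime p ->
  0 <= s -> s <= 1 -> (forall n, n.+1%:R * s ^+ (2 * n) <= C0) ->
  ((kenergy N (fun n => logn p n :: key n)
      (fun n => b n * ((s ^+ l)%:C ^+ logn p n))%R chi `^ theta)%:E <=
   ((C0 ^+ (2 ^ l).-1) `^ theta)%:E *
     \int[m]_w (kenergy N key b (rot p (chi, w)) `^ theta)%:E)%E.
Proof.
move=> pp s0 s1 hC; set C := C0 ^+ _; set r := index_iota 1 N.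
have C00 : 0 <= C0 by apply: le_trans (hC 0%N); rewrite mul1r expr0.
have C_ge0 : 0 <= C by rewrite exprn_ge0.
pose e n := logn p n.
pose Q k : {poly R[i]} :=
  \sum_(n <- r | key n == k) (b n * torus_eval chi n) *: 'X^(e n).
pose ks := undup (map key r).
pose u w := crd (prime_index p) w.
have QE w : kenergy N key b (rot p (chi, w)) = \sum_(k <- ks) normc (Q k).[u w] ^+ 2.
  apply: eq_bigr => k _; congr (normc _ ^+ 2).
  rewrite /Q horner_sum big_seq_cond [RHS]big_seq_cond; apply: eq_bigr => n.
  rewrite mem_index_iota => /andP[/andP[n0 _] _].
  by rewrite torus_eval_rot// hornerZ hornerXn mulrCA mulrC.
pose b' n := b n * ((s ^+ l)%:C ^+ logn p n).
pose key' n := logn p n :: key n.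
have E : kenergy N key' b' chi = \sum_(k <- ks) pnorm (pscale (s ^+ l)%:C (Q k)).
  pose x n := b' n * torus_eval chi n.
  have scQ k : pscale (s ^+ l)%:C (Q k) = \sum_(n <- r | key n == k) x n *: 'X^(e n).
    apply/polyP => i; rewrite coef_pscale !coef_sum mulr_suml.
    apply: eq_bigr => n _; rewrite !coefZ !coefXn /x /b'.
    case: eqP => [->|_]; rewrite ?mulr0 ?mul0r// !mulr1.
    by rewrite mulrAC.
  under [RHS]eq_bigr do rewrite scQ pnorm_monomials.
  rewrite kenergyE.
  have := @sum_classes _ _ _ r ks predT key (fun n k =>
    \sum_(n' <- r | (key n' == k) && (e n' == e n)) Re (x n * (x n')^*)).
  move=> /(_ (undup_uniq _) (@inks N key)) ->.
  apply: eq_bigr => n _; apply: eq_bigl => n'.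
  by rewrite /key' eqseq_cons andbC.
pose J k := fine (\int[m]_w (normc (Q k).[u w] `^ q)%:E)%E.
pose Y := fine (\int[m]_w (kenergy N key b (rot p (chi, w)) `^ theta)%:E)%E.
have mu : @cmeasurable R _ (borel (torus R)) u by exact: cmeasurable_crd.
have mQ k : measurable_fun setT (fun w : borel (torus R) => normc (Q k).[u w]).
  by apply: measurable_normc; exact: cmeasurable_horner.
have mQq k : measurable_fun setT (fun w : borel (torus R) => normc (Q k).[u w] `^ q).
  by apply: (measurableT_comp (measurable_powR _)).
have JE k : (\int[m]_w (normc (Q k).[u w] `^ q)%:E)%E = (J k)%:E.
  rewrite fineK// ge0_fin_numE; first exact: circle_mom_lty.
  by apply: integral_ge0 => w _; rewrite lee_fin powR_ge0.
have Qb k w : normc (Q k).[u w] <= \sum_(i < size (Q k)) normc (Q k)`_i.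
  rewrite horner_coef (le_trans (normc_sum _ _ _))//; apply: ler_sum => i _.
  by rewrite normcM normcX normc_crd expr1n mulr1.
have mY : measurable_fun setT (fun w : borel (torus R) =>
    (kenergy N key b (rot p (chi, w)) `^ theta)).
  apply: (measurableT_comp (measurable_powR _)).
  under eq_fun do rewrite QE.
  by apply: measurable_sum => k; exact: measurable_funX.
have YE : (\int[m]_w (kenergy N key b (rot p (chi, w)) `^ theta)%:E)%E = Y%:E.
  rewrite fineK// ge0_fin_numE; last first.
    by apply: integral_ge0 => w _; rewrite lee_fin powR_ge0.
  apply: (@integral_bounded_lty _ _ _ _ _
    ((\sum_(k <- ks) (\sum_(i < size (Q k)) normc (Q k)`_i) ^+ 2) `^ theta)) => //.
  move=> w; rewrite powR_ge0/= QE; apply: ler_powR_base; rewrite ?(ltW theta_gt0)//.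
    by apply: sumr_ge0 => k _; exact: sqr_ge0.
  by apply: ler_sum => k _; rewrite lerXn2r ?nnegrE ?normc_ge0// sumr_ge0// => i _;
    exact: normc_ge0.
have Y0 : 0 <= Y.
  by rewrite -lee_fin -YE; apply: integral_ge0 => w _; rewrite lee_fin powR_ge0.
have KE : (2 ^ l = (2 ^ l).-1.+1)%N by rewrite prednK.
have qKx x : 0 <= x -> (x `^ q) ^+ (2 ^ l) = x ^+ 2.
  by move=> x0; rewrite -powR_mulrn ?powR_ge0// -powRrM qK powR_mulrn.
(* Since (|Q|^q)^(2^l) = |Q|^2, the l^(2^l) norm under the integral is the energy to the power
   [theta]. *)
have main : \sum_(k <- ks) J k ^+ (2 ^ l) <= Y ^+ (2 ^ l).
  rewrite KE; have h := @minkowski_exp _ (borel (torus R)) R m _ ks (2 ^ l).-1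
    (fun k w => normc (Q k).[u w] `^ q) J Y mQq (fun _ _ => powR_ge0 _ _) JE.
  apply: h; rewrite -YE; apply: eq_integral => w _; congr EFin.
  rewrite -KE QE; congr powR.
  by apply: eq_bigr => k _; rewrite qKx// normc_ge0.
have bound : kenergy N key' b' chi <= C * Y ^+ (2 ^ l).
  rewrite E; apply: (@le_trans _ _ (C * \sum_(k <- ks) J k ^+ (2 ^ l))).
    rewrite mulr_sumr; apply: ler_sum => k _.
    exact: (circle_hypercontraction m_haar q0 q1 qK pp (Q k) s0 s1 hC).
  exact: ler_wpM2l.
rewrite YE -EFinM lee_fin.
apply: le_trans (ler_powR_base (ltW theta_gt0) (kenergy_ge0 _ _ _ _) bound) _.
rewrite powRM ?exprn_ge0//.
suff -> : (Y ^+ (2 ^ l)) `^ theta = Y by [].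
by rewrite -powR_mulrn// -powRrM mulfV ?powRr1// pnatr_eq0 -lt0n.
Qed.

Lemma kmom_prime_step N key b p (s C0 : R) : prime p ->
  0 <= s -> s <= 1 -> (forall n, n.+1%:R * s ^+ (2 * n) <= C0) ->
  (kmom N (fun n => logn p n :: key n)
      (fun n => b n * ((s ^+ l)%:C ^+ logn p n))%R <=
   ((C0 ^+ (2 ^ l).-1) `^ theta)%:E * kmom N key b)%E.
Proof.
move=> pp s0 s1 hC; set C := (_ `^ theta)%R.
pose f (chi : borel (torus R)) := (kenergy N key b chi `^ theta)%:E.
have mk d (T : measurableType d) (h : T -> torus R) key1 b1 :
    (forall n, cmeasurable (fun t => torus_eval (h t) n)) ->
    measurable_fun setT (fun t => (kenergy N key1 b1 (h t) `^ theta)%:E).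
  move=> mh; apply/measurable_EFinP; apply: (measurableT_comp (measurable_powR _)).
  exact: measurable_kenergy.
have mid n : @cmeasurable R _ (borel (torus R)) (fun t => torus_eval t n).
  exact: cmeasurable_torus_eval.
have mf : measurable_fun setT f by exact (mk _ (borel (torus R)) id key b mid).
have mjf : measurable_fun setT (fun z => f (rot p z)).
  exact (mk _ _ (rot p) key b (fun n => @cmeasurable_rot R p n pp)).
have f0 x : (0 <= f x)%E by rewrite lee_fin powR_ge0.
rewrite /kmom -[X in (_ * X)%E](haar_average m_haar pp mf mjf f0).
pose G (chi : borel (torus R)) := (\int[m]_w f (rot p (chi, w)))%E.
have mG : measurable_fun setT G.
  exact (@measurable_fun_fubini_tonelli_F _ _ _ _ _ m _ mjf (fun _ => f0 _)).
have G0 chi : (0 <= G chi)%E by apply: integral_ge0 => w _.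
have C0' : 0 <= C by exact: powR_ge0.
have <- := @ge0_integralZl_EFin _ _ R m setT measurableT G (fun x _ => G0 x) mG C C0'.
pose g (chi : borel (torus R)) := (kenergy N (fun n => logn p n :: key n)
  (fun n => b n * ((s ^+ l)%:C ^+ logn p n)) chi `^ theta)%:E.
have := @ge0_le_integral _ _ R m setT measurableT g (fun x => C%:E * G x)%E.
apply => [x _|||chi _].
- by rewrite lee_fin powR_ge0.
- exact (mk _ (borel (torus R)) id _ _ mid).
- exact: measurable_funeM.
- exact: (kenergy_prime_step _ _ _ _ pp s0 s1 hC).
Qed.

Lemma kmom_primes (s C0 : nat -> R) N (ps : seq nat) b :
  all prime ps -> (forall p, prime p -> 0 <= s p <= 1) ->
  (forall p n, prime p -> n.+1%:R * s p ^+ (2 * n) <= C0 p) ->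
  (kmom N (fun n => [seq logn p n | p <- ps])
      (fun n => b n * \prod_(p <- ps) ((s p ^+ l)%:C ^+ logn p n))%R <=
   (\prod_(p <- ps) ((C0 p ^+ (2 ^ l).-1) `^ theta))%:E * kmom N (fun=> [::]) b)%E.
Proof.
move=> + s01 hC; elim: ps => [_|p ps ih /= /andP[pp /ih {}ih]].
  rewrite big_nil mul1e (_ : (fun n => _) = b)//.
  by apply/funext => n; rewrite big_nil mulr1.
have /andP[s0 s1] := s01 p pp.
have := kmom_prime_step N (fun n => [seq logn p n | p <- ps])
  (fun n => b n * \prod_(p <- ps) ((s p ^+ l)%:C ^+ logn p n)) pp s0 s1 (fun n => hC p n pp).
move=> h; rewrite (_ : (fun n => b n * _) = (fun n => b n *
  \prod_(p <- ps) ((s p ^+ l)%:C ^+ logn p n) * (s p ^+ l)%:C ^+ logn p n)); last first.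
  by apply/funext => n; rewrite big_cons -mulrA; congr (_ * _); rewrite mulrC.
apply: (le_trans h); rewrite big_cons EFinM -muleA.
apply: lee_wpmul2l; first by rewrite lee_fin powR_ge0.
exact: ih.
Qed.

End VectorTensorization.

(** * The weights n^(-sigma) *)

Section DirichletWeights.
Variable R : realType.

Lemma powR_prod (I : Type) (r : seq I) (x : I -> R) (e : R) :
  (forall i, 0 <= x i) ->
  (\prod_(i <- r) x i) `^ e = \prod_(i <- r) x i `^ e.
Proof.
move=> x0; elim: r => [|i r ih]; first by rewrite !big_nil powR1.
by rewrite !big_cons powRM ?ih// prodr_ge0.
Qed.

Lemma powR_expr (x e : R) k : 0 <= x -> (x ^+ k) `^ e = (x `^ e) ^+ k.
Proof. by move=> x0; rewrite -(powR_mulrn _ x0) powRAC powR_mulrn// powR_ge0. Qed.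

Definition primes_below N := [seq p <- iota 0 N | prime p].

Lemma prod_primes_below N n : (0 < n < N)%N ->
  n = (\prod_(p <- primes_below N) p ^ logn p n)%N.
Proof.
move=> /andP[n0 nN]; rewrite -[LHS](partnT n0) (@widen_partn N.-1); last by lia.
rewrite /primes_below big_filter prednK; last by lia.
rewrite /index_iota subn0 big_mkcond [RHS]big_mkcond.
apply: eq_bigr => p _ /=; case: ifPn => // np.
by rewrite lognE (negbTE np) expn0.
Qed.

Lemma prod_weights N n (sigma : R) : (0 < n < N)%N ->
  \prod_(p <- primes_below N) (p%:R `^ (- sigma)) ^+ logn p n =
  n%:R `^ (- sigma).
Proof.
move=> nN; rewrite [X in _ = X%:R `^ _](prod_primes_below nN) natr_prod powR_prod//.
by apply: eq_bigr => p _; rewrite natrX powR_expr.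
Qed.

(** The quotient (1 - x^(n+1))/(1 - x) is a sum of n + 1 powers of x, each at least x^n. *)
Lemma succ_mul_exp_le (x : R) n : 0 <= x -> x < 1 ->
  n.+1%:R * x ^+ n <= (1 - x)^-1.
Proof.
move=> x0 x1; have s0 : 0 < 1 - x by rewrite subr_gt0.
rewrite -[leRHS]mul1r ler_pdivlMr// mulrC mulrA [_ * n.+1%:R]mulrC -mulrA.
suff : n.+1%:R * ((1 - x) * x ^+ n) <= 1 - x ^+ n.+1.
  by move/le_trans; apply; rewrite gerBl exprn_ge0.
elim: n => [|n ih]; first by rewrite expr0 expr1; lra.
have xn0 : 0 <= x ^+ n by rewrite exprn_ge0.
have xn1 : x ^+ n.+1 = x * x ^+ n by rewrite exprS.
have xn2 : x ^+ n.+2 = x ^+ 2 * x ^+ n by rewrite -exprD.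
rewrite xn1 in ih *; rewrite xn2.
rewrite -!natr1 in ih *; have k0 : 0 <= n%:R :> R by [].
move: (x ^+ n) (n%:R : R) ih xn0 k0 => y k ih y0 k0.
have h1 := ler_wpM2l x0 ih.
have h2 : 0 <= (k + 1) * ((1 - x) * y).
  by apply: mulr_ge0; [lra|apply: mulr_ge0 => //; exact: ltW].
have h3 : 0 <= (1 - x) * (1 - x * y) by apply: mulr_ge0; lra.
lra.
Qed.

End DirichletWeights.

Section Weighted.
Variables (R : realType) (m : probability (borel (torus R)) R).
Hypothesis m_haar : normalized_haar m.
Variables (l : nat) (q : R).
Hypotheses (q0 : 0 < q) (q1 : q <= 1) (qK : q * (2 ^ l)%:R = 2).
Implicit Types (a b : nat -> R[i]).

Definition wt (sigma : R) a n : R[i] := a n * (n%:R `^ (- sigma))%:C.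

Lemma tmom_ext N a b : (forall n, (0 < n < N)%N -> a n = b n) ->
  tmom m q N a = tmom m q N b.
Proof.
move=> ab; apply: eq_integral => chi _; congr (normc _ `^ q)%:E.
by rewrite /tpoly !big_nat; apply: eq_bigr => n nN; rewrite ab.
Qed.

Lemma all_primes_below N : all prime (primes_below N).
Proof. exact: filter_all. Qed.

Lemma tmom_contraction N a (sigma : R) : 0 <= sigma ->
  (tmom m q N (wt sigma a) <= tmom m q N a)%E.
Proof.
move=> s0.
have -> : tmom m q N (wt sigma a) = tmom m q N (fun n => a n *
    \prod_(p <- primes_below N) ((p%:R `^ (- sigma))%:C ^+ logn p n))%R.
  apply: tmom_ext => n nN; rewrite /wt -(prod_weights sigma nN) rmorph_prod.
  by congr (_ * _); apply: eq_bigr => p _; rewrite rmorphXn.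
elim: primes_below (all_primes_below N) => [_|p ps ih /= /andP[pp /ih {}ih]].
  by rewrite (@tmom_ext _ _ a)// => n _; rewrite big_nil mulr1.
apply: le_trans ih; rewrite (@tmom_ext _ _ (fun n => a n *
  \prod_(p <- ps) ((p%:R `^ (- sigma))%:C ^+ logn p n) * (p%:R `^ (- sigma))%:C ^+ logn p n)%R).
  apply: (tmom_prime_contraction m_haar q0 q1 qK _ _ pp); first exact: powR_ge0.
  rewrite powRN invf_le1 ?powR_gt0 ?ltr0n ?prime_gt0//.
  by rewrite -[leLHS](powRr0 p%:R) ler_powR// ler1n prime_gt0.
by move=> n _; rewrite big_cons mulrCA [LHS]mulrC.
Qed.

(** The point is that [C] precedes [N]. As s_p^l = p^(-sigma), the prime p costs a power of a bound
    for (n + 1) s_p^(2n). This bound is 1 when s_p <= 1/2, because (n + 1) 4^(-n) <= 1, so only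
    primes below [B] contribute a factor [D]. Once all primes below [N] are treated, the keys
    separate the integers and the energy is the sum on the left. *)
Lemma hypercontraction (sigma : R) : 0 < sigma -> exists2 C : R, 0 <= C &
  forall N a,
  ((((\sum_(1 <= n < N) normc (wt sigma a n) ^+ 2) `^ ((2 ^ l)%:R^-1))%:E) <=
   C%:E * tmom m q N a)%E.
Proof.
move=> s0.
have l0 : (0 < l)%N.
  rewrite lt0n; apply/eqP => l0; have := qK; rewrite l0 expn0 mulr1 => q2.
  by move: q1; rewrite q2; lra.
pose s (p : nat) := (p%:R : R) `^ (- (sigma / l%:R)).
have sl p : s p ^+ l = p%:R `^ (- sigma).
  rewrite /s -powR_mulrn ?powR_ge0// -powRrM mulNr mulfVK// pnatr_eq0.
  by rewrite -lt0n.
have sl0 : 0 < sigma / l%:R by rewrite divr_gt0// ltr0n.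
have spV p : s p = (p%:R `^ (sigma / l%:R))^-1 by rewrite /s powRN.
have smono p : prime p -> s p <= s 2%N.
  move=> pp; rewrite !spV lef_pV2 ?posrE ?powR_gt0 ?ltr0n ?prime_gt0//.
  by apply: ler_powR_base; rewrite ?(ltW sl0)// ler_nat prime_gt1.
have s2 : s 2%N < 1.
  rewrite spV invf_lt1 ?powR_gt0//.
  apply: (@le_lt_trans _ _ (1 `^ (sigma / l%:R))); first by rewrite powR1.
  by apply: gt0_ltr_powR; rewrite ?nnegrE// ltr1n.
have s01 p : prime p -> 0 <= s p <= 1.
  by move=> pp; rewrite powR_ge0/= (le_trans (smono _ pp))// ltW.
(* [s p] is largest at the prime 2, so this constant serves every prime. *)
pose M := (1 - s 2%N ^+ 2)^-1.
have x01 : 0 <= s 2%N ^+ 2 by exact: sqr_ge0.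
have x1 : s 2%N ^+ 2 < 1 by rewrite expr_lt1// powR_ge0.
have M1 : 1 <= M by rewrite invf_ge1 ?subr_gt0// gerBl.
pose C0 p := if s p <= 1 / 2 then 1 else M.
have hC p n : prime p -> n.+1%:R * s p ^+ (2 * n) <= C0 p.
  move=> pp; rewrite /C0; case: ifPn => [sp|_].
    have e : s p ^+ (2 * n) <= (1 / 4) ^+ n.
      rewrite exprM lerXn2r ?nnegrE ?sqr_ge0//.
      have := powR_ge0 (p%:R : R) (- (sigma / l%:R)); rewrite -/(s p) => sp0.
      by rewrite expr2; nra.
    have f : n.+1%:R * (1 / 4) ^+ n <= 1 :> R.
      rewrite expr_div_n expr1n mul1r ler_pdivrMr ?exprn_gt0// mul1r.
      rewrite -natrX ler_nat; elim: (n) => // k ih; rewrite expnS.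
      by rewrite mulSn -addn1 leq_add// muln_gt0 expn_gt0.
    by apply: le_trans f; rewrite ler_wpM2l.
  apply: le_trans (succ_mul_exp_le n x01 x1).
  rewrite ler_wpM2l// exprM lerXn2r ?nnegrE ?sqr_ge0//.
  by rewrite lerXn2r ?nnegrE ?powR_ge0// smono.
pose D := (M ^+ (2 ^ l).-1) `^ ((2 ^ l)%:R^-1).
have D1 : 1 <= D.
  apply: (@le_trans _ _ (1 `^ ((2 ^ l)%:R^-1))); first by rewrite powR1.
  by apply: ler_powR_base; rewrite ?invr_ge0// exprn_ege1.
(* For a prime p, s_p > 1/2 means p^(sigma/l) < 2, that is, p < 2^(l/sigma). *)
pose B := (Num.truncn (2 `^ (sigma / l%:R)^-1 : R)).+1.
have hB p : prime p -> ~~ (s p <= 1 / 2) -> (p < B)%N.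
  move=> pp; rewrite -ltNge => sp.
  have pl : p%:R `^ (sigma / l%:R) < 2.
    have p0 : 0 < p%:R `^ (sigma / l%:R) :> R by rewrite powR_gt0// ltr0n prime_gt0.
    by move: sp; rewrite spV div1r ltf_pV2// posrE.
  have : (p%:R : R) < 2 `^ (sigma / l%:R)^-1.
    have e : (p%:R `^ (sigma / l%:R)) `^ (sigma / l%:R)^-1 = p%:R :> R.
      by rewrite -powRrM mulfV ?gt_eqF// powRr1.
    rewrite -[ltLHS]e; apply: gt0_ltr_powR; rewrite ?invr_gt0// nnegrE ?powR_ge0//.
  move=> h; rewrite /B ltnS truncn_ge_nat ?powR_ge0//; exact: ltW.
exists (D ^+ B); first by rewrite exprn_ge0// (le_trans ler01).
move=> N a.
pose ps := primes_below N.
pose key n := [seq logn p n | p <- ps].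
pose b n := a n * \prod_(p <- ps) ((s p ^+ l)%:C ^+ logn p n).
have bE n : (0 < n < N)%N -> b n = wt sigma a n.
  move=> nN; rewrite /b /wt -(prod_weights sigma nN) rmorph_prod.
  by congr (_ * _); apply: eq_bigr => p _; rewrite [RHS]rmorphXn sl.
have inj : {in index_iota 1 N &, injective key}.
  move=> n n'; rewrite !mem_index_iota => nN n'N e.
  rewrite (prod_primes_below nN) (prod_primes_below n'N).
  rewrite big_seq [RHS]big_seq; apply: eq_bigr => p pps; congr (p ^ _)%N.
  have := congr1 (nth 0%N ^~ (index p ps)) e.
  by rewrite !(nth_map 0%N) ?index_mem// nth_index.
have := kmom_primes m_haar q0 q1 qK N a (all_primes_below N) s01 hC.
have -> : kmom m l N (fun=> [::]) a = tmom m q N a.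
  apply: eq_integral => chi _; congr EFin; rewrite kenergy_cst.
  rewrite -powR_mulrn ?normc_ge0// -powRrM; congr powR.
  by rewrite -qK mulfK// pnatr_eq0 -lt0n expn_gt0.
rewrite /kmom; under eq_integral do rewrite (kenergy_inj _ _ inj).
rewrite integral_prob_cst.
have -> : \sum_(1 <= n < N) normc (b n) ^+ 2 =
    \sum_(1 <= n < N) normc (wt sigma a n) ^+ 2.
  by rewrite !big_nat; apply: eq_bigr => n nN; rewrite bE.
move=> /le_trans; apply; apply: lee_wpmul2r.
  by apply: integral_ge0 => w _; rewrite lee_fin powR_ge0.
rewrite lee_fin.
have D0 : 0 <= D by exact: le_trans ler01 D1.
apply: (@le_trans _ _ (\prod_(p <- ps) (if (p < B)%N then D else 1))).
  rewrite big_seq [leRHS]big_seq; apply: ler_prod => p.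
  rewrite mem_filter => /andP[pp _]; rewrite powR_ge0/= /C0.
  case: ifPn => [_|/(hB p pp) ->//].
  by rewrite expr1n powR1; case: ifP.
rewrite -big_mkcond /= big_const_seq iter_mulr_1 ler_weXn2l//.
rewrite -size_filter -[leqRHS](size_iota 0 B); apply: uniq_leq_size.
  by apply: filter_uniq; apply: filter_uniq; exact: iota_uniq.
move=> p; rewrite mem_filter => /andP[pB _]; by rewrite mem_iota.
Qed.

End Weighted.

(** * The Rademacher-Menshov argument *)

Section DyadicMaximal.
Variable R : realType.
Implicit Types (x : nat -> R[i]).

Definition blk x lo n : R[i] := \sum_(lo <= i < lo + n) x i.

(** The Rademacher-Menshov functional: the squared moduli of the sums over all blocks of the binary
    tree of depth [k] whose root is the block of length 2^k at [lo]. *)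
Fixpoint dyadic x (k lo : nat) : R :=
  if k is k'.+1 then dyadic x k' lo + dyadic x k' (lo + 2 ^ k') +
    normc (blk x lo (2 ^ k)) ^+ 2
  else normc (x lo) ^+ 2.

Lemma dyadic_ge0 x k lo : 0 <= dyadic x k lo.
Proof.
elim: k lo => [|k ih] lo /=; first exact: sqr_ge0.
by rewrite !addr_ge0// sqr_ge0.
Qed.

Lemma dyadic_block x k lo : normc (blk x lo (2 ^ k)) ^+ 2 <= dyadic x k lo.
Proof.
case: k => [|k] /=; first by rewrite /blk addn1 big_nat1.
by rewrite lerDr addr_ge0 ?dyadic_ge0.
Qed.

Lemma blkD x lo i j : blk x lo (i + j) = blk x lo i + blk x (lo + i) j.
Proof. by rewrite /blk (@big_cat_nat _ _ _ (lo + i)) ?addnA ?leq_addr. Qed.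

(** Cauchy-Schwarz with weights 1 and n + 1; thanks to it the constant of the maximal inequality
    grows by only 1 per level. *)
Lemma sqr_add_le (a b n D1 D2 : R) : 0 <= n -> a ^+ 2 <= D1 ->
  b ^+ 2 <= (n + 1) * D2 -> (a + b) ^+ 2 <= (n + 1 + 1) * (D1 + D2).
Proof.
move=> n0 hA hB; have n1 : 0 < n + 1 by lra.
rewrite -(ler_pM2l n1).
have h1 : 0 <= ((n + 1) * a - b) ^+ 2 by exact: sqr_ge0.
have h2 : (n + 1) * (n + 1 + 1) * a ^+ 2 <= (n + 1) * (n + 1 + 1) * D1.
  by apply: ler_wpM2l => //; apply: mulr_ge0; lra.
have h3 : (n + 1 + 1) * b ^+ 2 <= (n + 1 + 1) * ((n + 1) * D2).
  by apply: ler_wpM2l => //; lra.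
nra.
Qed.

(* A prefix of a dyadic block splits into at most one dyadic block per level. *)
Lemma dyadic_max x k lo j : (j <= 2 ^ k)%N ->
  normc (blk x lo j) ^+ 2 <= k.+1%:R * dyadic x k lo.
Proof.
elim: k lo j => [|k ih] lo j jk.
  rewrite mul1r; case: j jk => [|[|//]] _; last by rewrite /blk addn1 big_nat1.
  by rewrite /blk addn0 big_geq// normc0 expr0n sqr_ge0.
have d1 := dyadic_ge0 x k lo; have d2 := dyadic_ge0 x k (lo + 2 ^ k).
have s0 : 0 <= normc (blk x lo (2 ^ k.+1)) ^+ 2 by exact: sqr_ge0.
have k0 : 0 <= k%:R :> R by [].
have [jk'|jk'] := leqP j (2 ^ k).
  apply: (le_trans (ih lo j jk')) => /=; rewrite -!natr1.
  apply: ler_pM; [lra|done|lra|lra].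
have jE : j = (2 ^ k + (j - 2 ^ k))%N by rewrite subnKC// ltnW.
have j2 : (j - 2 ^ k <= 2 ^ k)%N by rewrite leq_subLR addnn -mul2n -expnS.
rewrite jE blkD; set A := blk x lo _; set B := blk _ _ _.
have hA : normc A ^+ 2 <= dyadic x k lo := dyadic_block x k lo.
have hB : normc B ^+ 2 <= k.+1%:R * dyadic x k (lo + 2 ^ k) := ih _ _ j2.
have hAB := normcD A B; have a0 := normc_ge0 A; have b0 := normc_ge0 B.
have hAB2 : normc (A + B) ^+ 2 <= (normc A + normc B) ^+ 2.
  by rewrite lerXn2r ?nnegrE ?normc_ge0// addr_ge0.
apply: (le_trans hAB2); rewrite -natr1 in hB.
apply: (le_trans (sqr_add_le k0 hA hB)); rewrite /= -!natr1.
apply: ler_wpM2l; first by rewrite !addr_ge0.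
by rewrite lerDl.
Qed.

End DyadicMaximal.

Section ComplexCompleteness.
Variable R : realType.

Lemma hausdorffC : hausdorff_space R[i].
Proof. exact: (@norm_hausdorff R[i] R[i]). Qed.

Lemma cauchyC_cvg (u : nat -> R[i]) :
  (forall e : R, 0 < e -> exists z, \forall n \near \oo, normc (u n - z) < e) ->
  exists l : R[i], u n @[n --> \oo] --> l.
Proof.
move=> h.
have hr : cvgn (fun n => Re (u n)).
  apply: cauchy_cvg; apply: cauchy_exP => e e0; have [z hz] := h e e0.
  exists (Re z); apply: filterS hz => n /=; apply: le_lt_trans.
  rewrite distrC (le_trans _ (normc_Re _))//.
  by case: (u n) => ? ?; case: (z).
have hi : cvgn (fun n => Im (u n)).
  apply: cauchy_cvg; apply: cauchy_exP => e e0; have [z hz] := h e e0.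
  exists (Im z); apply: filterS hz => n /=; apply: le_lt_trans.
  rewrite distrC (le_trans _ (normc_Im _))//.
  by case: (u n) => ? ?; case: (z).
exists (limn (fun n => Re (u n)) +i* limn (fun n => Im (u n))).
by apply/cvgc_ReIm.
Qed.

Lemma cvgC_lim (u : nat -> R[i]) (l : R[i]) : u n @[n --> \oo] --> l ->
  lim (u n @[n --> \oo]) = l.
Proof. exact: (cvg_lim hausdorffC). Qed.

Lemma cvgC_cauchy (u : nat -> R[i]) (l : R[i]) : u n @[n --> \oo] --> l ->
  forall e : R, 0 < e -> exists N, forall n, (N <= n)%N -> normc (u n - u N) < e.
Proof.
move=> /cvgc_normP ul e e0; have e2 : 0 < e / 2 by rewrite divr_gt0.
move/cvgrPdist_lt : ul => /(_ _ e2)[N _ hN].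
have hN' n : (N <= n)%N -> normc (u n - l) < e / 2.
  by move=> /hN /=; rewrite sub0r normrN ger0_norm// normc_ge0.
exists N => n Nn; apply: le_lt_trans (normc_dist _ l _) _.
rewrite [X in _ + X]normcC.
by have := hN' n Nn; have := hN' N (leqnn N); lra.
Qed.

(* Off the set of convergence, [lim] takes the constant value [point]. *)
Lemma cmeasurable_lim d (T : measurableType d) (u : nat -> T -> R[i]) :
  (forall n, cmeasurable (u n)) ->
  cmeasurable (fun t => lim (u n t @[n --> \oo])).
Proof.
move=> mu.
pose C := [set t | exists l : R[i], u n t @[n --> \oo] --> l].
have mC : measurable C.
  have -> : C = \bigcap_(e in [set: nat]) \bigcup_(N in [set: nat])
      \bigcap_(n in [set k | (N <= k)%N])
        [set t | normc (u n t - u N t) < e.+1%:R^-1].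
    apply/seteqP; split=> t.
      move=> [l ul] e _; have [|N hN] := cvgC_cauchy ul (e := e.+1%:R^-1).
        by rewrite invr_gt0.
      by exists N => // n; exact: hN.
    move=> h; apply: cauchyC_cvg => e e0.
    have [k ke] : exists k : nat, k.+1%:R^-1 < e.
      have := @near_infty_natSinv_lt R (PosNum e0) => -[k _ /(_ k (leqnn _))].
      by exists k.
    have [N _ hN] := h k I; exists (u N t); exists N => // n Nn.
    by apply: lt_trans ke; exact: hN.
  apply: bigcap_measurable => // e _; apply: bigcup_measurable => N _.
  apply: bigcap_measurable; first by exists N => /=.
  move=> n _.
  have mf : measurable_fun setT (fun t => normc (u n t - u N t) < e.+1%:R^-1).
    apply: measurable_fun_ltr; last exact: measurable_cst.
    by apply: measurable_normc; exact: cmeasurableB.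
  rewrite (_ : [set t | _] = setT `&`
      (fun t => normc (u n t - u N t) < e.+1%:R^-1) @^-1` [set true]).
    exact: mf.
  by apply/seteqP; split=> t //= -[].
have limC t : C t -> Re (u n t) @[n --> \oo] --> Re (lim (u n t @[n --> \oo])) /\
    Im (u n t) @[n --> \oo] --> Im (lim (u n t @[n --> \oo])).
  by move=> [l ul]; rewrite (cvgC_lim ul); exact/cvgc_ReIm.
have limNC t : ~ C t -> lim (u n t @[n --> \oo]) = point.
  move=> nC; rewrite /lim /lim_in; apply: getPN => l ul; apply: nC.
  by exists l.
have mCN : measurable (~` C) by exact: measurableC.
split; rewrite -(setUv C); apply/measurable_funU => //; split.
- apply: (@measurable_fun_cvg _ _ _ C (fun n t => Re (u n t))).
    by move=> n; apply: measurable_funTS; case: (mu n).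
  by move=> t /limC[].
- apply: eq_measurable_fun (measurable_cst (Re (point : R[i]))) => t.
  by rewrite inE => /limNC ->.
- apply: (@measurable_fun_cvg _ _ _ C (fun n t => Im (u n t))).
    by move=> n; apply: measurable_funTS; case: (mu n).
  by move=> t /limC[].
- apply: eq_measurable_fun (measurable_cst (Im (point : R[i]))) => t.
  by rewrite inE => /limNC ->.
Qed.

End ComplexCompleteness.

Section DyadicConvergence.
Variable R : realType.
Implicit Types (x : nat -> R[i]).

(** For N between 2^k and 2^(k+1) the partial sum differs from that at 2^k by at most the square
    root of [T k], hence by (lam^k + lam^(-k) T_k)/2. The first terms form a geometric series and
    the second are summable by hypothesis, so the partial sums are Cauchy. *)
Lemma dyadic_cvg x (lam M : R) : 0 < lam -> lam < 1 ->
  (forall K, \sum_(k < K) (lam ^- k * (k.+1%:R * dyadic x k (2 ^ k))) <= M) ->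
  exists l : R[i], (\sum_(1 <= n < N.+1) x n) @[N --> \oo] --> l.
Proof.
move=> lam0 lam1 hM.
pose S N := \sum_(1 <= n < N) x n.
pose T k := k.+1%:R * dyadic x k (2 ^ k).
pose a k : R := (lam ^+ k + lam ^- k * T k) / 2.
have T0 k : 0 <= T k by rewrite mulr_ge0// dyadic_ge0.
have a0 k : 0 <= a k.
  by rewrite divr_ge0// addr_ge0 ?exprn_ge0 ?(ltW lam0)// mulr_ge0// invr_ge0 exprn_ge0// ltW.
pose A K := \sum_(k < K) a k.
have AS K : A K.+1 = A K + a K by rewrite /A big_ord_recr.
have Amono : nondecreasing_seq A by apply/nondecreasing_seqP => n; rewrite AS lerDl.
have Abnd K : A K <= ((1 - lam)^-1 + M) / 2.
  rewrite /A /a -mulr_suml ler_pM2r ?invr_gt0// big_split/=; apply: lerD; last exact: hM.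
  have s0 : 0 < 1 - lam by rewrite subr_gt0.
  rewrite -[leRHS]mul1r ler_pdivlMr// mulrC -opprB mulNr -subrX1 opprB.
  by rewrite gerBl exprn_ge0// ltW.
have cA : cvgn A.
  by apply: nondecreasing_is_cvgn => //; exists (((1 - lam)^-1 + M) / 2) => _ [n _ <-]; exact: Abnd.
have AL K : A K <= limn A by exact: nondecreasing_cvgn_le.
have step k N : (2 ^ k <= N <= 2 ^ k.+1)%N -> normc (S N - S (2 ^ k)%N) <= a k.
  move=> /andP[kN Nk].
  have -> : S N - S (2 ^ k)%N = blk x (2 ^ k)%N (N - 2 ^ k)%N.
    have -> : S N = S (2 ^ k)%N + \sum_(2 ^ k <= n < N) x n.
      by apply: big_cat_nat => //; rewrite expn_gt0.
    by rewrite addrC addKr /blk subnKC.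
  have h : normc (blk x (2 ^ k)%N (N - 2 ^ k)%N) ^+ 2 <= T k.
    by apply: dyadic_max; rewrite leq_subLR addnn -mul2n -expnS.
  move: h; set b := normc _ => h.
  have p0 : 0 < lam ^+ k by rewrite exprn_gt0.
  have h1 : lam ^- k * b ^+ 2 <= lam ^- k * T k by rewrite ler_wpM2l// invr_ge0 ltW.
  have h2 : lam ^- k * (b - lam ^+ k) ^+ 2 = lam ^- k * b ^+ 2 - 2 * b + lam ^+ k.
    by field; rewrite gt_eqF.
  have h3 : 0 <= lam ^- k * (b - lam ^+ k) ^+ 2.
    by rewrite mulr_ge0 ?sqr_ge0// invr_ge0 ltW.
  rewrite /a ler_pdivlMr//; lra.
have steps k0 k : (k0 <= k)%N -> normc (S (2 ^ k)%N - S (2 ^ k0)%N) <= A k - A k0.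
  elim: k => [|k ih]; first by rewrite leqn0 => /eqP ->; rewrite !subrr normc0.
  rewrite leq_eqVlt => /predU1P[<-|]; first by rewrite !subrr normc0.
  rewrite ltnS => /ih h; apply: le_trans (normc_dist _ (S (2 ^ k)%N) _) _.
  have h2 : normc (S (2 ^ k.+1)%N - S (2 ^ k)%N) <= a k.
    by apply: step; rewrite leq_exp2l// leqnSn leqnn.
  by rewrite AS; lra.
apply: cauchyC_cvg => e e0.
have [k0 hk0] : exists k0, limn A - A k0 < e.
  move/cvgrPdist_lt : cA => /(_ e e0)[k0 _ /(_ k0 (leqnn _))] /= h.
  by exists k0; apply: le_lt_trans h; exact: ler_norm.
exists (S (2 ^ k0)%N); exists (2 ^ k0)%N => // N /= kN.
apply: le_lt_trans hk0; rewrite -/(S N.+1).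
pose k := trunc_log 2 N.+1.
have /andP[kN1 kN2] : (2 ^ k <= N.+1 < 2 ^ k.+1)%N by exact: trunc_log_bounds.
have k0k : (k0 <= k)%N.
  by rewrite -ltnS -(@ltn_exp2l 2)// (leq_ltn_trans kN)// (leq_trans _ kN2).
apply: le_trans (normc_dist _ (S (2 ^ k)%N) _) _.
have h1 : normc (S N.+1 - S (2 ^ k)%N) <= a k by apply: step; rewrite kN1 ltnW.
have h2 := steps _ _ k0k; have h3 := AL k.+1; rewrite AS in h3; lra.
Qed.

End DyadicConvergence.

Section AlmostEverywhere.
Variables (R : realType) (m : probability (borel (torus R)) R).
Hypothesis m_haar : normalized_haar m.
Implicit Types (b c : nat -> R[i]).

Local Notation term c chi := (fun n => c n * torus_eval chi n).

Lemma measurable_dyadic c k lo :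
  measurable_fun setT (fun chi : borel (torus R) => dyadic (term c chi) k lo).
Proof.
have mt n : @cmeasurable R _ (borel (torus R)) (fun chi => c n * torus_eval chi n).
  by apply: cmeasurableM; [exact: cmeasurable_cst|exact: cmeasurable_torus_eval].
elim: k lo => [|k ih] lo /=.
  by apply: measurable_funX; exact: measurable_normc.
apply: measurable_funD; first by apply: measurable_funD.
by apply: measurable_funX; apply: measurable_normc; exact: cmeasurable_sum.
Qed.

(** The tree has k + 1 levels, and by Parseval's formula each of them contributes the full sum of
    squares. *)
Lemma integral_dyadic c k lo : (0 < lo)%N ->
  (\int[m]_chi (dyadic (term c chi) k lo)%:E =
   (k.+1%:R * \sum_(lo <= n < lo + 2 ^ k) normc (c n) ^+ 2)%:E)%E.
Proof.
elim: k lo => [|k ih] lo lo0.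
  rewrite addn1 big_nat1 mul1r -[RHS](@integral_prob_cst _ _ _ m).
  by apply: eq_integral => chi _ /=; rewrite normcM normc_torus_eval mulr1.
have mt n : @cmeasurable R _ (borel (torus R)) (fun chi => c n * torus_eval chi n).
  by apply: cmeasurableM; [exact: cmeasurable_cst|exact: cmeasurable_torus_eval].
have md := measurable_dyadic c k.
rewrite [LHS]/= integral_EFinD; last 4 first.
- exact: measurable_funD.
- by apply: measurable_funX; apply: measurable_normc; exact: cmeasurable_sum.
- by move=> chi; rewrite addr_ge0// dyadic_ge0.
- by move=> chi; exact: sqr_ge0.
rewrite integral_EFinD//; last 2 first.
- by move=> chi; exact: dyadic_ge0.
- by move=> chi; exact: dyadic_ge0.
rewrite !ih ?addn_gt0 ?lo0// /blk.
have -> : (\int[m]_chi (normc (\sum_(lo <= i < lo + 2 ^ k.+1)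
    c i * torus_eval chi i) ^+ 2)%:E =
    (\sum_(lo <= i < lo + 2 ^ k.+1) normc (c i) ^+ 2)%:E)%E.
  apply: (@parseval R m m_haar nat (index_iota lo (lo + 2 ^ k.+1)) id c).
  - exact: iota_uniq.
  - by move=> ? ? _ _.
  - by move=> i; rewrite mem_index_iota => /andP[/(leq_trans lo0)].
rewrite -!EFinD; congr EFin.
have -> : (lo + 2 ^ k.+1 = lo + 2 ^ k + 2 ^ k)%N by rewrite expnS mul2n -addnn addnA.
rewrite [in RHS](@big_cat_nat _ _ _ (lo + 2 ^ k)) ?leq_addr//=.
rewrite [X in _ + _ + X = _](@big_cat_nat _ _ _ (lo + 2 ^ k)) ?leq_addr//=.
by rewrite -!natr1; ring.
Qed.

(** Two factors k + 1 arise, one from the maximal inequality and one from [integral_dyadic]. On the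
    k-th range n^(-2s) <= lam^(2k) with lam = 2^(-s), which pays for them and for lam^(-k): there
    remains ((k + 1) mu^k)^2 <= (1 - mu)^(-2). The integrals of [W k] are therefore summable, and
    the sum of the [W k] is finite almost everywhere. *)
Lemma ae_cvg_wt b (s Bd : R) : 0 < s ->
  (forall N, \sum_(1 <= n < N) normc (b n) ^+ 2 <= Bd) ->
  {ae m, forall chi : borel (torus R), exists l : R[i],
    (\sum_(1 <= n < N.+1) wt s b n * torus_eval chi n) @[N --> \oo] --> l}.
Proof.
move=> s0 hB.
pose mu : R := 2 `^ (- (s / 2)).
have mu0 : 0 < mu by exact: powR_gt0.
have mu1 : mu < 1.
  rewrite /mu powRN invf_lt1 ?powR_gt0//.
  apply: (@le_lt_trans _ _ (1 `^ (s / 2))); first by rewrite powR1.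
  by apply: gt0_ltr_powR; rewrite ?nnegrE ?divr_gt0// ltr1n.
pose lam := mu ^+ 2.
have lam0 : 0 < lam by rewrite exprn_gt0.
have lam1 : lam < 1 by rewrite expr_lt1// ltW.
have lamE : lam = 2 `^ (- s).
  by rewrite /lam -powR_mulrn ?(ltW mu0)// -powRrM; congr powR; field.
pose W k (chi : borel (torus R)) :=
  lam ^- k * (k.+1%:R * dyadic (term (wt s b) chi) k (2 ^ k)).
have W0 k chi : 0 <= W k chi.
  apply: mulr_ge0; first by rewrite invr_ge0 exprn_ge0// ltW.
  by apply: mulr_ge0 => //; exact: dyadic_ge0.
have mW k : measurable_fun setT (W k).
  apply: measurable_funM => //; apply: measurable_funM => //.
  exact: measurable_dyadic.
pose M2 := ((1 - mu)^-1) ^+ 2.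
have IW k : (\int[m]_chi (W k chi)%:E <=
    (M2 * \sum_(2 ^ k <= n < 2 ^ k + 2 ^ k) normc (b n) ^+ 2)%:E)%E.
  rewrite integral_EFinZ; last 3 first.
  - by apply: measurable_funM => //; exact: measurable_dyadic.
  - by rewrite invr_ge0 exprn_ge0// ltW.
  - by move=> chi; rewrite mulr_ge0// dyadic_ge0.
  rewrite integral_EFinZ//; last 2 first.
  - exact: measurable_dyadic.
  - by move=> chi; exact: dyadic_ge0.
  rewrite integral_dyadic ?expn_gt0// -!EFinM lee_fin.
  apply: (@le_trans _ _ (lam ^- k * (k.+1%:R * (k.+1%:R *
      (lam ^+ (2 * k) * \sum_(2 ^ k <= n < 2 ^ k + 2 ^ k) normc (b n) ^+ 2))))).
    apply: ler_wpM2l; first by rewrite invr_ge0 exprn_ge0// ltW.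
    apply: ler_wpM2l => //; apply: ler_wpM2l => //.
    rewrite mulr_sumr big_nat [leRHS]big_nat; apply: ler_sum => n /andP[kn _].
    rewrite /wt normcM exprMn mulrC; apply: ler_wpM2r; first exact: sqr_ge0.
    rewrite normc_real ger0_norm ?powR_ge0// exprM lamE -exprM mulnC exprM.
    rewrite lerXn2r ?nnegrE ?exprn_ge0 ?powR_ge0//.
    rewrite -powR_expr// !powRN -natrX lef_pV2 ?posrE ?powR_gt0 ?ltr0n ?expn_gt0//.
      by apply: ler_powR_base; rewrite ?(ltW s0)// ler_nat.
    by rewrite (leq_trans _ kn)// expn_gt0.
  have := succ_mul_exp_le k (ltW mu0) mu1 => h.
  have S0 : 0 <= \sum_(2 ^ k <= n < 2 ^ k + 2 ^ k) normc (b n) ^+ 2.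
    by apply: sumr_ge0 => n _; exact: sqr_ge0.
  move: S0; set Sb := \sum_(_ <= n < _) _ => S0.
  have -> : lam ^- k * (k.+1%:R * (k.+1%:R * (lam ^+ (2 * k) * Sb))) =
      (k.+1%:R * mu ^+ k) ^+ 2 * Sb.
    have l0 : lam ^+ k != 0 by rewrite expf_neq0// gt_eqF.
    have -> : (k.+1%:R * mu ^+ k) ^+ 2 = k.+1%:R ^+ 2 * lam ^+ k.
      by rewrite exprMn /lam -!exprM mulnC.
    by rewrite mul2n -addnn exprD; field.
  rewrite ler_wpM2r// lerXn2r ?nnegrE//; last by rewrite invr_ge0 subr_ge0 ltW.
  by rewrite mulr_ge0// exprn_ge0// ltW.
have M20 : 0 <= M2 by exact: sqr_ge0.
have If : (\int[m]_chi (\sum_(k <oo) (W k chi)%:E) <= (M2 * Bd)%:E)%E.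
  rewrite integral_nneseries//; last 2 first.
  - by move=> k; exact/measurable_EFinP.
  - by move=> k chi _; rewrite lee_fin.
  apply: lime_le; first by apply: is_cvg_nneseries => k _ _;
    apply: integral_ge0 => chi _; rewrite lee_fin.
  apply: nearW => K; apply: (@le_trans _ _ (\sum_(0 <= k < K)
     (M2 * \sum_(2 ^ k <= n < 2 ^ k + 2 ^ k) normc (b n) ^+ 2)%:E)%E).
    by apply: lee_sum => k _; exact: IW.
  rewrite sumEFin lee_fin -mulr_sumr ler_wpM2l//.
  apply: le_trans (hB (2 ^ K)%N); rewrite le_eqVlt; apply/orP; left; apply/eqP.
  elim: K => [|K ih]; first by rewrite big_geq// big_geq.
  rewrite big_nat_recr//= ih [RHS](@big_cat_nat _ _ _ (2 ^ K)) ?expn_gt0 ?leq_exp2l//=.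
  by rewrite addnn -mul2n -expnS.
have mf : measurable_fun setT (fun chi => \sum_(k <oo) (W k chi)%:E)%E.
  apply: ge0_emeasurable_sum => [k chi _ _|k _]; first by rewrite lee_fin.
  exact/measurable_EFinP.
have f0 chi : (0 <= \sum_(k <oo) (W k chi)%:E)%E.
  by apply: nneseries_ge0 => k _ _; rewrite lee_fin.
have intf : m.-integrable setT (fun chi => \sum_(k <oo) (W k chi)%:E)%E.
  apply/integrableP; split => //.
  under eq_integral do rewrite gee0_abs//.
  exact: le_lt_trans If (ltry _).
have := integrable_ae measurableT intf.
apply: filterS => chi /(_ I) ffin.
apply: (@dyadic_cvg _ _ lam (fine (\sum_(k <oo) (W k chi)%:E)%E)) => // K.
rewrite -lee_fin fineK//.
have := @nneseries_lim_ge R (fun k => (W k chi)%:E) xpredT 0 K.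
rewrite sumEFin big_mkord; apply.
by move=> k _ _; rewrite lee_fin.
Qed.

End AlmostEverywhere.

(** * Moments of small exponent as distances *)

Section QuasiNorm.
Context d (T : measurableType d) (R : realType) (P : probability T R).
Implicit Types (f g h : T -> R[i]) (q e : R).

Definition emom q f : \bar R := (\int[P]_t (normc (f t) `^ q)%:E)%E.

(** For [q] at most 1 the moment is subadditive without taking a root, so moments of differences
    serve as distances. [qfin] guards the use of [fine]. *)
Definition qmom q f : R := fine (emom q f).

Definition qfin q f := cmeasurable f /\ (emom q f < +oo)%E.

Lemma emom_ge0 q f : (0 <= emom q f)%E.
Proof. by apply: integral_ge0 => t _; rewrite lee_fin powR_ge0. Qed.

Lemma qmom_ge0 q f : 0 <= qmom q f.
Proof. by apply: fine_ge0; exact: emom_ge0. Qed.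

Lemma emomE q f : qfin q f -> emom q f = (qmom q f)%:E.
Proof. by move=> [_ f1]; rewrite fineK// ge0_fin_numE// emom_ge0. Qed.

Lemma qmom_le q f g : (emom q g < +oo)%E -> (emom q f <= emom q g)%E ->
  qmom q f <= qmom q g.
Proof.
rewrite /qmom; move: (emom_ge0 q f) (emom_ge0 q g).
move: (emom q f) (emom q g) => x y x0 y0 y1 xy; apply: fine_le => //.
  by rewrite ge0_fin_numE// (le_lt_trans xy).
by rewrite ge0_fin_numE.
Qed.

Lemma measurable_qpow q f : cmeasurable f ->
  measurable_fun setT (fun t => normc (f t) `^ q).
Proof.
by move=> mf; apply: (measurableT_comp (measurable_powR _)); exact: measurable_normc.
Qed.

Lemma qmomC q f g : qmom q (fun t => f t - g t) = qmom q (fun t => g t - f t).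
Proof.
rewrite /qmom /emom; congr fine; apply: eq_integral => t _.
by rewrite normcC.
Qed.

Lemma emom_add q f g : 0 < q -> q <= 1 -> cmeasurable f -> cmeasurable g ->
  (emom q (fun t => f t + g t)%R <= emom q f + emom q g)%E.
Proof.
move=> q0 q1 mf mg; rewrite /emom -integral_EFinD; last 4 first.
- exact: measurable_qpow.
- exact: measurable_qpow.
- by move=> t; exact: powR_ge0.
- by move=> t; exact: powR_ge0.
apply: le_integral_EFin.
- by apply: measurable_qpow; exact: cmeasurableD.
- by apply: measurable_funD; exact: measurable_qpow.
move=> t; rewrite powR_ge0/=.
apply: le_trans (powRD_le _ _ q0 q1); rewrite ?normc_ge0//.
by apply: ler_powR_base; [exact: ltW|exact: normc_ge0|exact: normcD].
Qed.

Lemma qfinD q f g : 0 < q -> q <= 1 -> qfin q f -> qfin q g ->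
  qfin q (fun t => f t + g t).
Proof.
move=> q0 q1 [mf f1] [mg g1]; split; first exact: cmeasurableD.
exact (le_lt_trans (emom_add q0 q1 mf mg) (lte_add_pinfty f1 g1)).
Qed.

Lemma qfinN q f : qfin q f -> qfin q (fun t => - f t).
Proof.
move=> [mf f1]; have E : (fun t => - f t) = (fun t => 0 - f t).
  by apply/funext => t; rewrite sub0r.
split; first by rewrite E; apply: cmeasurableB => //; exact: cmeasurable_cst.
suff -> : emom q (fun t => - f t) = emom q f by exact: f1.
by apply: eq_integral => t _; rewrite normc_opp.
Qed.

Lemma qfinB q f g : 0 < q -> q <= 1 -> qfin q f -> qfin q g ->
  qfin q (fun t => f t - g t).
Proof. by move=> q0 q1 ff fg; exact (qfinD q0 q1 ff (qfinN fg)). Qed.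

Lemma qmom_tri q f g h : 0 < q -> q <= 1 -> qfin q f -> qfin q g -> qfin q h ->
  qmom q (fun t => f t - h t) <=
  qmom q (fun t => f t - g t) + qmom q (fun t => g t - h t).
Proof.
move=> q0 q1 ff fg fh; have fg' := qfinB q0 q1 ff fg; have gh' := qfinB q0 q1 fg fh.
have := emom_add q0 q1 fg'.1 gh'.1.
under eq_fun do rewrite addrA subrK.
have [_ a1] := fg'; have [_ b1] := gh'.
have a0 := emom_ge0 q (fun t => f t - g t).
have b0 := emom_ge0 q (fun t => g t - h t).
have c0 := emom_ge0 q (fun t => f t - h t).
rewrite /qmom; move: (emom q (fun t => f t - g t)) (emom q (fun t => g t - h t))
  (emom q (fun t => f t - h t)) a0 a1 b0 b1 c0.
move=> a b c a0 a1 b0 b1 c0 cab.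
have fa : a \is a fin_num by rewrite ge0_fin_numE.
have fb : b \is a fin_num by rewrite ge0_fin_numE.
have fc : c \is a fin_num.
  by rewrite ge0_fin_numE// (le_lt_trans cab)// lte_add_pinfty.
by rewrite -lee_fin EFinD !fineK.
Qed.

Lemma qfin_bounded q f (M : R) : 0 <= q -> cmeasurable f ->
  (forall t, normc (f t) <= M) -> qfin q f.
Proof.
move=> q0 mf fM; split=> //.
apply: (@integral_bounded_lty _ _ _ _ _ (M `^ q)); first exact: measurable_qpow.
by move=> t; rewrite powR_ge0 ler_powR_base ?normc_ge0.
Qed.

Lemma powR_interp (x q p e : R) : 0 <= x -> 0 < q -> q <= p -> 0 < e ->
  x `^ q <= e `^ q + e `^ (q - p) * x `^ p.
Proof.
move=> x0 q0 qp e0; have [xe|ex] := leP x e.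
  by rewrite ler_wpDr ?mulr_ge0 ?powR_ge0// ler_powR_base// ltW.
have x1 : 0 < x by exact: lt_trans ex.
rewrite ler_wpDl ?powR_ge0//.
have -> : x `^ q = x `^ (q - p) * x `^ p.
  by rewrite -powRD ?subrK// (gt_eqF x1)/= implybT.
apply: ler_wpM2r; first exact: powR_ge0.
rewrite -(opprB p q) !powRN lef_pV2 ?posrE ?powR_gt0//.
by apply: ler_powR_base; [rewrite subr_ge0|exact: ltW|exact: ltW].
Qed.

Lemma emom_interp q p e f : 0 < q -> q <= p -> 0 < e -> cmeasurable f ->
  (emom q f <= (e `^ q)%:E + (e `^ (q - p))%:E * emom p f)%E.
Proof.
move=> q0 qp e0 mf; rewrite /emom -integral_EFinZ; last 3 first.
- exact: measurable_qpow.
- exact: powR_ge0.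
- by move=> t; exact: powR_ge0.
rewrite addeC -integral_EFinD_cst; last 3 first.
- by apply: measurable_funM => //; exact: measurable_qpow.
- by move=> t; rewrite mulr_ge0 ?powR_ge0.
- exact: powR_ge0.
apply: le_integral_EFin.
- exact: measurable_qpow.
- by apply: measurable_funD => //; apply: measurable_funM => //; exact: measurable_qpow.
by move=> t; rewrite powR_ge0/= addrC; apply: powR_interp; rewrite ?normc_ge0.
Qed.

Lemma qfin_le q p f : 0 < q -> q <= p -> qfin p f -> qfin q f.
Proof.
move=> q0 qp ff; have [mf f1] := ff; split=> //.
refine (le_lt_trans (emom_interp q0 qp ltr01 mf) _).
rewrite lte_add_pinfty ?ltry// lte_mul_pinfty ?lee_fin ?powR_ge0//.
Qed.

(** Where |f| <= x the contribution is at most x^q = e / 2; elsewhere |f|^q <= x^(q - p) |f|^p. *)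
Lemma qmom_small q p e : 0 < q -> q <= p -> 0 < e -> exists2 dl, 0 < dl &
  forall f, cmeasurable f -> (emom p f <= dl%:E)%E -> (emom q f <= e%:E)%E.
Proof.
move=> q0 qp e0; have e2 : 0 < e / 2 by rewrite divr_gt0.
pose x := (e / 2) `^ q^-1; have x0 : 0 < x by exact: powR_gt0.
have xq : x `^ q = e / 2 by rewrite -powRrM mulVf ?gt_eqF// powRr1// ltW.
have c0 : 0 < x `^ (q - p) by exact: powR_gt0.
exists (e / 2 / x `^ (q - p)); first by rewrite divr_gt0.
move=> f mf fd; apply: le_trans (emom_interp q0 qp x0 mf) _.
rewrite [e in leRHS](_ : _ = e / 2 + e / 2); last by lra.
rewrite EFinD xq; apply: leeD2l.
have -> : (e / 2)%:E = ((x `^ (q - p))%:E * (e / 2 / x `^ (q - p))%:E)%E.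
  by rewrite -EFinM; congr EFin; rewrite [RHS]mulrC divfK// gt_eqF.
by apply: lee_wpmul2l => //; rewrite lee_fin ltW.
Qed.

End QuasiNorm.

Global Opaque emom.

(** * Coefficients of elements of the Hardy space *)

Section HardyCoefficients.
Variables (R : realType) (m : probability (borel (torus R)) R).
Hypothesis m_haar : normalized_haar m.
Implicit Types (a b : nat -> R[i]) (s t : seq R[i]).

Lemma normc_tpoly N a chi : normc (tpoly N a chi) <= \sum_(1 <= n < N) normc (a n).
Proof.
rewrite /tpoly (le_trans (normc_sum _ _ _))//; apply: ler_sum => n _.
by rewrite normcM normc_torus_eval mulr1.
Qed.

Lemma cmeasurable_tpolyT N a : @cmeasurable R _ (borel (torus R)) (tpoly N a).
Proof.
by apply: (@cmeasurable_tpoly R _ (borel (torus R)) id) => n; exact: cmeasurable_torus_eval.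
Qed.

Lemma qfin_tpoly q N a : 0 <= q -> @qfin _ (borel (torus R)) R m q (tpoly N a).
Proof.
move=> q0; apply: (@qfin_bounded _ _ _ _ _ _ (\sum_(1 <= n < N) normc (a n))) => //.
- exact: cmeasurable_tpolyT.
- by move=> chi; exact: normc_tpoly.
Qed.

Lemma tpoly_wide N N' a chi : (N <= N')%N -> (forall n, (N <= n)%N -> a n = 0) ->
  tpoly N a chi = tpoly N' a chi.
Proof.
move=> NN a0; rewrite /tpoly; have [N1|N1] := leqP 1 N.
  rewrite [RHS](@big_cat_nat _ _ _ N)//= [X in _ + X]big_nat [X in _ + X]big1 ?addr0//.
  by move=> n /andP[/a0 -> _]; rewrite mul0r.
rewrite big_geq; last by rewrite ltnW.
rewrite big_nat big1// => n /andP[n1 _]; rewrite a0 ?mul0r//.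
by apply: leq_trans n1; exact: ltnW.
Qed.

Lemma analytic_polyE s N chi : (size s <= N)%N ->
  analytic_poly s chi = tpoly N (nth 0 s) chi.
Proof. by move=> sN; apply: tpoly_wide => // n; exact: nth_default. Qed.

Lemma tpolyB N a b chi :
  tpoly N a chi - tpoly N b chi = tpoly N (fun n => a n - b n) chi.
Proof. by rewrite /tpoly -sumrB; apply: eq_bigr => n _; rewrite mulrBl. Qed.

Section Exponent.
Variables (l : nat) (q : R).
Hypotheses (q0 : 0 < q) (q1 : q <= 1) (qK : q * (2 ^ l)%:R = 2).

Lemma qmom_contraction N a (sigma : R) : 0 <= sigma ->
  qmom m q (tpoly N (wt sigma a)) <= qmom m q (tpoly N a).
Proof.
move=> s0; have [_ h] := qfin_tpoly N a (ltW q0).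
exact (qmom_le h (tmom_contraction m_haar q0 q1 qK N a s0)).
Qed.

Lemma l2_le_qmom (sigma : R) : 0 < sigma -> exists2 C : R, 0 <= C &
  forall N a, \sum_(1 <= n < N) normc (wt sigma a n) ^+ 2 <=
              (C * qmom m q (tpoly N a)) ^+ (2 ^ l).
Proof.
move=> s0; have [C C0 hC] := hypercontraction m_haar q0 q1 qK s0.
exists C => // N a; have := hC N a.
have -> : tmom m q N a = (qmom m q (tpoly N a))%:E.
  by rewrite -emomE//; apply: qfin_tpoly; exact: ltW.
rewrite -EFinM lee_fin; set S := \sum_(_ <= _ < _) _ => h.
have S0 : 0 <= S by apply: sumr_ge0 => n _; exact: sqr_ge0.
have K0 : (2 ^ l)%:R != 0 :> R by rewrite pnatr_eq0 -lt0n expn_gt0.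
have -> : S = (S `^ ((2 ^ l)%:R^-1)) ^+ (2 ^ l).
  by rewrite -powR_mulrn ?powR_ge0// -powRrM mulVf// powRr1.
by rewrite lerXn2r ?nnegrE ?powR_ge0// mulr_ge0// qmom_ge0.
Qed.

End Exponent.

End HardyCoefficients.

Section HardyShift.
Variables (R : realType) (m : probability (borel (torus R)) R).
Hypothesis m_haar : normalized_haar m.
Variables (p : R) (p_gt0 : 0 < p) (F : torus R -> R[i]).
Hypothesis F_Hp : Hardy m p F.
Variables (l : nat) (q : R).
Hypotheses (q0 : 0 < q) (q1 : q <= 1) (qK : q * (2 ^ l)%:R = 2) (qp : q <= p).
Implicit Types (a b : nat -> R[i]) (s t : seq R[i]) (f g : torus R -> R[i]).

Local Notation qmom f := (@qmom _ (borel (torus R)) R m q f).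
Local Notation qfin f := (@qfin _ (borel (torus R)) R m q f).
Local Notation coef := (Hardy_coef m p F).
Local Notation shift := (Hardy_shift m p F).

Lemma emom_Lp_dist f g :
  (emom m p (fun chi : borel (torus R) => f chi - g chi)%R = Lp_dist m p f g `^ p)%E.
Proof.
rewrite /Lp_dist poweR_Lnorm; last by rewrite gt_eqF.
apply: eq_integral => chi _.
by rewrite abse_EFin ger0_norm ?normc_ge0.
Qed.

Lemma Hardy_cmeasurable : @cmeasurable R _ (borel (torus R)) F.
Proof. by case: F_Hp => -[mF _] _; exact: borel_cmeasurable. Qed.

Lemma Hardy_qfin : qfin F.
Proof.
apply: (qfin_le q0 qp); split; first exact: Hardy_cmeasurable.
case: F_Hp => -[_ F1] _.
have := emom_Lp_dist F (fun=> 0); under eq_fun do rewrite subr0.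
by move=> ->; exact: poweR_lty.
Qed.

Lemma qfin_ap s : qfin (analytic_poly s).
Proof. exact (qfin_tpoly m (size s) (nth 0 s) (ltW q0)). Qed.

(** Measured with the exponent [q], for which contraction and smoothing are available;
    [near_F_small] is the link with [Lp_dist]. *)
Definition near_F s : R := qmom (fun chi => F chi - analytic_poly s chi).

Lemma near_F_ge0 s : 0 <= near_F s. Proof. exact: qmom_ge0. Qed.

Lemma qfin_near_F s : qfin (fun chi => F chi - analytic_poly s chi).
Proof. exact (qfinB q0 q1 Hardy_qfin (qfin_ap s)). Qed.

Lemma near_F_small (e : R) : 0 < e -> exists2 dl : R, 0 < dl &
  forall s, (Lp_dist m p F (analytic_poly s) < dl%:E)%E -> near_F s <= e.
Proof.
move=> e0; have [dl dl0 h] := qmom_small m q0 qp e0.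
exists (dl `^ p^-1); first exact: powR_gt0.
move=> s sd; have ff := qfin_near_F s.
rewrite /near_F -lee_fin -(emomE ff); apply: h; first by case: ff.
rewrite emom_Lp_dist.
have -> : dl%:E = ((dl `^ p^-1)%:E `^ p)%E.
  by rewrite poweR_EFin -powRrM mulVf ?gt_eqF// powRr1// ltW.
apply: gt0_ler_poweR; rewrite ?(ltW p_gt0)//.
- by rewrite in_itv /= Lnorm_ge0 leey.
- by rewrite in_itv /= lee_fin powR_ge0 leey.
- exact: ltW.
Qed.

Lemma exists_near_F (e : R) : 0 < e -> exists s, near_F s <= e.
Proof.
move=> e0; have [dl dl0 h] := near_F_small e0.
by case: F_Hp => _ /(_ dl dl0)[s sd]; exists s; exact: h.
Qed.

Lemma near_F_cvg (s : nat -> seq R[i]) :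
  Lp_dist m p F (analytic_poly (s k)) @[k --> \oo] --> 0%E ->
  forall e : R, 0 < e -> \forall k \near \oo, near_F (s k) <= e.
Proof.
move=> sF e e0; have [dl dl0 h] := near_F_small e0.
have d0 : nbhs (0%E : \bar R) [set x | (x < dl%:E)%E].
  by apply: open_ereal_lt'; rewrite lte_fin.
have [N _ hN] := sF _ d0.
by exists N => // k Nk; apply: h; exact: hN.
Qed.

Lemma mul_exp_small (C : R) K (eta : R) : 0 <= C -> (0 < K)%N -> 0 < eta ->
  exists2 dl : R, 0 < dl & forall x, 0 <= x -> x <= dl -> (C * x) ^+ K <= eta.
Proof.
move=> C0 K0 e0; pose e := Num.min 1 eta.
have ep : 0 < e by rewrite lt_min ltr01.
have C1 : 0 < C + 1 by lra.
exists (e / (C + 1)); first by rewrite divr_gt0.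
move=> x x0 xd; have Cx0 : 0 <= C * x by rewrite mulr_ge0.
have Cxe : C * x <= e.
  apply: (@le_trans _ _ ((C + 1) * x)); first by apply: ler_wpM2r => //; lra.
  by rewrite mulrC -ler_pdivlMr.
have e1 : e <= 1 by rewrite ge_min lexx.
have ee : e <= eta by rewrite ge_min lexx orbT.
have Cx1 := le_trans Cxe e1; apply: le_trans ee; apply: le_trans Cxe.
case: K K0 => // K _; rewrite exprS ler_piMr// exprn_ile1//.
Qed.

Let K_gt0 : (0 < 2 ^ l)%N. Proof. by rewrite expn_gt0. Qed.

Lemma ap_dist s t N : (size s <= N)%N -> (size t <= N)%N ->
  qmom (fun chi => analytic_poly s chi - analytic_poly t chi) =
  qmom (tpoly N (fun n => s`_n - t`_n)).
Proof.
move=> sN tN; congr fine; apply: congr1; apply/funext => chi.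
by rewrite (analytic_polyE _ sN) (analytic_polyE _ tN) tpolyB.
Qed.

Lemma ap_dist_le s t :
  qmom (fun chi => analytic_poly s chi - analytic_poly t chi) <= near_F s + near_F t.
Proof.
have h := qmom_tri q0 q1 (qfin_ap s) Hardy_qfin (qfin_ap t).
have e := @qmomC _ (borel (torus R)) R m q (analytic_poly s) F.
by rewrite /near_F -e; exact h.
Qed.

(** Polynomials near [F] are near each other, and [l2_le_qmom] converts this into weighted
    coefficients. The sum is first extended to [N'], beyond both lists, where the difference is a
    single [tpoly]. *)
Lemma l2_ap_dist (sigma : R) : 0 < sigma -> exists2 C : R, 0 <= C &
  forall N s t, \sum_(1 <= n < N) normc (wt sigma (fun n => s`_n - t`_n) n) ^+ 2 <=
    (C * (near_F s + near_F t)) ^+ (2 ^ l).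
Proof.
move=> s0; have [C C0 hC] := l2_le_qmom m_haar q0 q1 qK s0; exists C => // N s t.
pose N' := maxn N (maxn (size s) (size t)).
apply: (@le_trans _ _ (\sum_(1 <= n < N') normc (wt sigma (fun n => s`_n - t`_n) n) ^+ 2)).
  have [N1|N1] := leqP 1 N; last first.
    rewrite big_geq; last exact: ltnW.
    by apply: sumr_ge0 => n _; exact: sqr_ge0.
  rewrite [leRHS](@big_cat_nat _ _ _ N)//= ?leq_maxl// lerDl.
  by apply: sumr_ge0 => n _; exact: sqr_ge0.
apply: (le_trans (hC _ _)).
have h : 0 <= qmom (tpoly N' (fun n => s`_n - t`_n)) by exact: qmom_ge0.
rewrite lerXn2r ?nnegrE ?mulr_ge0 ?addr_ge0 ?near_F_ge0//.
apply: ler_wpM2l => //.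
rewrite -ap_dist; first exact: ap_dist_le.
- by rewrite leq_max leq_max leqnn orbT.
- by rewrite leq_max leq_max leqnn !orbT.
Qed.

(** A single term of the weighted sum of squares at sigma = 1; removing the weight n^(-1) costs a
    constant that depends on [n] only. *)
Lemma coef_close n (e : R) : (0 < n)%N -> 0 < e -> exists2 dl : R, 0 < dl &
  forall s t, near_F s <= dl -> near_F t <= dl -> normc (s`_n - t`_n) < e.
Proof.
move=> n0 e0; have [C C0 hC] := l2_ap_dist ltr01.
pose w : R := n%:R `^ (- 1).
have w0 : 0 < w by rewrite powR_gt0// ltr0n.
have eta0 : 0 < (e * w / 2) ^+ 2 by rewrite exprn_gt0// divr_gt0// mulr_gt0.
have [dl dl0 h] := mul_exp_small C0 K_gt0 eta0.
exists (dl / 2); first by rewrite divr_gt0.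
move=> s t sd td.
have := hC n.+1 s t; rewrite big_nat_recr//= => hn.
have : normc (wt 1 (fun n => s`_n - t`_n) n) ^+ 2 <= (e * w / 2) ^+ 2.
  have x0 : 0 <= near_F s + near_F t by exact (addr_ge0 (near_F_ge0 s) (near_F_ge0 t)).
  have xd : near_F s + near_F t <= dl.
    by have := lerD sd td; rewrite -splitr.
  apply: (le_trans _ (h _ x0 xd)); apply: (le_trans _ hn).
  by rewrite lerDr; apply: sumr_ge0 => i _; exact: sqr_ge0.
rewrite ler_pXn2r ?nnegrE ?normc_ge0//; last by rewrite divr_ge0// mulr_ge0// ltW.
rewrite /wt normcM normc_real ger0_norm ?powR_ge0// -/w.
have -> : e * w / 2 = e / 2 * w by field.
by rewrite ler_pM2r// => hh; apply: le_lt_trans hh _; rewrite ltr_pdivrMr// ltr_pMr// ltr1n.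
Qed.

Lemma exists_approx : exists s : nat -> seq R[i],
  Lp_dist m p F (analytic_poly (s k)) @[k --> \oo] --> 0%E.
Proof.
have /choice[s hs] (k : nat) : exists s,
    (Lp_dist m p F (analytic_poly s) < (k.+1%:R^-1)%:E)%E.
  by case: F_Hp => _; apply; rewrite invr_gt0.
exists s; apply: (@squeeze_cvge _ _ _ _ (fun=> 0%E) _ (fun k => (k.+1%:R^-1)%:E)).
- by apply: nearW => k; rewrite Lnorm_ge0/= ltW.
- exact: cvg_cst.
- by apply: cvg_EFin; [exact: nearW|exact: cvg_harmonic].
Qed.

(** By [coef_close] the coefficients along one approximating sequence are Cauchy, and every other
    such sequence has the same limit. The set in [Hardy_coef] is therefore inhabited, and [get]
    returns this limit, also when p < 1. *)
Lemma Hardy_coefP (s : nat -> seq R[i]) n : (0 < n)%N ->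
  Lp_dist m p F (analytic_poly (s k)) @[k --> \oo] --> 0%E ->
  (s k)`_n @[k --> \oo] --> coef n.
Proof.
move=> n0 sF; have [s0 s0F] := exists_approx.
have [c hc] : exists c : R[i], (s0 k)`_n @[k --> \oo] --> c.
  apply: cauchyC_cvg => e e0; have [dl dl0 h] := coef_close n0 e0.
  have [k0 _ hk] := near_F_cvg s0F dl0.
  exists ((s0 k0)`_n); exists k0 => // k /= kk; exact (h _ _ (hk k kk) (hk k0 (leqnn k0))).
have ex : exists c : R[i], forall s : nat -> seq R[i],
    Lp_dist m p F (analytic_poly (s k)) @[k --> \oo] --> 0%E ->
    (s k)`_n @[k --> \oo] --> c.
  exists c => t tF; apply/cvgc_normP/cvgrPdist_le => e e0.
  have e2 : 0 < e / 2 by rewrite divr_gt0.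
  have [dl dl0 h] := coef_close n0 e2.
  move/cvgc_normP/cvgrPdist_le : hc => /(_ _ e2)[N1 _ hN1].
  have [N2 _ hN2] := near_F_cvg tF dl0; have [N3 _ hN3] := near_F_cvg s0F dl0.
  exists (maxn N1 (maxn N2 N3)) => // k /=; rewrite !geq_max => /and3P[k1 k2 k3].
  rewrite sub0r normrN ger0_norm ?normc_ge0//.
  apply: le_trans (normc_dist _ ((s0 k)`_n) _) _.
  have h1 := hN1 k k1; rewrite /= sub0r normrN ger0_norm ?normc_ge0// in h1.
  have h2 := h _ _ (hN2 k k2) (hN3 k k3).
  by rewrite [leRHS]splitr lerD// ltW.
exact (getPex ex s sF).
Qed.

End HardyShift.

Global Opaque qmom near_F.

Lemma fatou_ae d (T : measurableType d) (R : realType) (P : probability T R)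
    (g : nat -> T -> R) (f : T -> R) (B : R) :
  (forall n, measurable_fun setT (g n)) -> (forall n t, 0 <= g n t) ->
  measurable_fun setT f -> (forall t, 0 <= f t) ->
  {ae P, forall t, g n t @[n --> \oo] --> f t} ->
  (forall n, \int[P]_t (g n t)%:E <= B%:E)%E ->
  (\int[P]_t (f t)%:E <= B%:E)%E.
Proof.
move=> mg g0 mf f0 gf gB.
pose G n t := (g n t)%:E.
have mG n : measurable_fun setT (G n) by exact/measurable_EFinP.
have mL : measurable_fun setT (fun t => limn_einf (G ^~ t)).
  rewrite /limn_einf; apply: measurableT_comp => //.
  by apply: measurable_fun_limn_esup => n; exact: measurableT_comp.
have L0 t : (0 <= limn_einf (G ^~ t))%E.
  rewrite limn_einf_lim; apply: lime_ge; first exact: is_cvg_einfs.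
  apply: nearW => n; apply: le_ereal_inf_tmp => _ [k _ <-].
  by rewrite lee_fin.
have -> : (\int[P]_t (f t)%:E = \int[P]_t limn_einf (G ^~ t))%E.
  apply: ge0_ae_eq_integral => //.
  - exact/measurable_EFinP.
  - by move=> t _; rewrite lee_fin.
  - apply: filterS gf => t gt _.
    have Gt : (G ^~ t) @ \oo --> (f t)%:E by apply: cvg_EFin => //; exact: nearW.
    exact: (esym (cvg_limn_einf_sup Gt).1).
have Gf := @fatou _ T R P setT measurableT G mG (fun n t _ => g0 n t).
apply: (le_trans Gf); rewrite limn_einf_lim; apply: lime_le; first exact: is_cvg_einfs.
apply: nearW => n; apply: le_trans (gB n); apply: ereal_inf_lbound.
by exists n => /=.
Qed.

Lemma cvg_sum_nat (R : realType) (G : nat -> nat -> R) (L : nat -> R) N :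
  (forall n, (0 < n)%N -> G n k @[k --> \oo] --> L n) ->
  (\sum_(1 <= n < N) G n k) @[k --> \oo] --> \sum_(1 <= n < N) L n.
Proof.
move=> h; elim: N => [|[|N] ih].
- by under eq_fun do rewrite big_geq//; rewrite big_geq//; exact: cvg_cst.
- by under eq_fun do rewrite big_geq//; rewrite big_geq//; exact: cvg_cst.
under eq_fun do rewrite big_nat_recr//=.
by rewrite big_nat_recr//=; apply: cvgD; [exact: ih|exact: h].
Qed.

(** * The functions F_sigma: existence, monotone moments and convergence to F *)

Section HardyLimit.
Variables (R : realType) (m : probability (borel (torus R)) R).
Hypothesis m_haar : normalized_haar m.
Variables (p : R) (p_gt0 : 0 < p) (F : torus R -> R[i]).
Hypothesis F_Hp : Hardy m p F.
Variables (l : nat) (q : R).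
Hypotheses (q0 : 0 < q) (q1 : q <= 1) (qK : q * (2 ^ l)%:R = 2) (qp : q <= p).
Implicit Types (a b : nat -> R[i]) (s t : seq R[i]) (f g : torus R -> R[i]).

Local Notation qmom f := (@qmom _ (borel (torus R)) R m q f).
Local Notation qfin f := (@qfin _ (borel (torus R)) R m q f).
Local Notation coef := (Hardy_coef m p F).
Local Notation shift := (Hardy_shift m p F).
Local Notation near_F := (near_F m F q).

(** The limit of [l2_ap_dist] along an approximating sequence; the sum is finite, so convergence of
    each coefficient is enough. *)
Lemma l2_coef (sigma : R) : 0 < sigma -> exists2 C : R, 0 <= C &
  forall N s, \sum_(1 <= n < N) normc (wt sigma (fun n => s`_n - coef n) n) ^+ 2 <=
    (C * near_F s) ^+ (2 ^ l).
Proof.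
move=> s0; have [C C0 hC] := l2_ap_dist m_haar p_gt0 F_Hp q0 q1 qK qp s0.
exists C => // N s; have [s0' s0F] := exists_approx F_Hp.
have cR : (C * (near_F s + near_F (s0' k))) ^+ (2 ^ l) @[k --> \oo] -->
    (C * near_F s) ^+ (2 ^ l).
  have c0 : near_F (s0' k) @[k --> \oo] --> 0.
    apply/cvgrPdist_le => e e0.
    have [N0 _ hN] := near_F_cvg p_gt0 F_Hp q0 q1 qp s0F e0.
    exists N0 => // k Nk; rewrite /= sub0r normrN ger0_norm; first exact: hN.
    exact: near_F_ge0.
  have c1 : (C * (near_F s + near_F (s0' k))) @[k --> \oo] --> C * (near_F s + 0).
    by apply: cvgM; [exact: cvg_cst|apply: cvgD; [exact: cvg_cst|exact: c0]].
  rewrite -[in X in _ --> X](addr0 (near_F s)).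
  exact: (@cvg_comp _ _ _ _ (fun x => x ^+ (2 ^ l)) _ _ _ c1 (@exprn_continuous _ _ _)).
have cL : \sum_(1 <= n < N) normc (wt sigma (fun n => s`_n - (s0' k)`_n) n) ^+ 2
    @[k --> \oo] -->
    \sum_(1 <= n < N) normc (wt sigma (fun n => s`_n - coef n) n) ^+ 2.
  apply: cvg_sum_nat => n n0.
  have h := Hardy_coefP m_haar p_gt0 F_Hp q0 q1 qK qp n0 s0F.
  have h2 : normc (wt sigma (fun n => s`_n - (s0' k)`_n) n) @[k --> \oo] -->
      normc (wt sigma (fun n => s`_n - coef n) n).
    rewrite /wt normcM; under eq_fun do rewrite normcM.
    apply: cvgM; last exact: cvg_cst.
    apply/cvgrPdist_le => e e0; move/cvgc_normP/cvgrPdist_le : h => /(_ _ e0)[N0 _ hN].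
    exists N0 => // k Nk; have := hN k Nk.
    rewrite /= sub0r normrN ger0_norm ?normc_ge0//; apply: le_trans.
    set x := s`_n - coef n; set y := s`_n - _.
    have yx : y - x = coef n - (s0' k)`_n by rewrite /x /y opprB addrC addrA subrK.
    have h1 := normc_leD x y; have h2 := normc_leD y x.
    rewrite normcC -yx; rewrite normcC in h1.
    by rewrite ler_norml; apply/andP; split; lra.
  exact: (@cvg_comp _ _ _ _ (fun x => x ^+ 2) _ _ _ h2 (@exprn_continuous _ _ _)).
rewrite -(cvg_lim _ cL)// -(cvg_lim _ cR)//; apply: ler_lim; [exact: cvgP cL|exact: cvgP cR|].
by exists 0%N => // k _; exact (hC N s (s0' k)).
Qed.

Lemma shiftE sigma chi : shift sigma chi =
  lim (tpoly N.+1 (wt sigma coef) chi @[N --> \oo]).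
Proof.
rewrite /Hardy_shift; suff -> : (fun N => \sum_(1 <= n < N.+1)
  coef n * torus_eval chi n * (n%:R `^ (- sigma))%:C) =
  (fun N => tpoly N.+1 (wt sigma coef) chi) by [].
by apply/funext => N; apply: eq_bigr => n _; rewrite /wt mulrAC.
Qed.

Lemma cmeasurable_shift sigma : @cmeasurable R _ (borel (torus R)) (shift sigma).
Proof.
rewrite (_ : shift sigma = fun chi => lim (tpoly N.+1 (wt sigma coef) chi @[N --> \oo])).
  by apply: (@cmeasurable_lim R _ (borel (torus R))) => N; exact: cmeasurable_tpolyT.
by apply/funext => chi; exact: shiftE.
Qed.

(** Half of [sigma] makes the coefficients square summable, by [l2_coef] at the zero polynomial
    [[::]]; the other half is spent in [ae_cvg_wt]. *)
Lemma shift_ae_cvg (sigma : R) : 0 < sigma ->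
  {ae m, forall chi : borel (torus R),
    tpoly N.+1 (wt sigma coef) chi @[N --> \oo] --> shift sigma chi}.
Proof.
move=> s0; have s2 : 0 < sigma / 2 by rewrite divr_gt0.
have [C C0 hC] := l2_coef s2.
pose b := wt (sigma / 2) coef.
have hb N : \sum_(1 <= n < N) normc (b n) ^+ 2 <= (C * near_F [::]) ^+ (2 ^ l).
  apply: le_trans (hC N [::]); rewrite le_eqVlt; apply/orP; left; apply/eqP.
  by apply: eq_bigr => n _; rewrite /b /wt nth_nil sub0r mulNr normc_opp.
have := ae_cvg_wt m_haar s2 hb; apply: filterS => chi [L hL].
suff h : tpoly N.+1 (wt sigma coef) chi @[N --> \oo] --> L.
  by rewrite shiftE (cvgC_lim h).
apply: cvg_trans hL; apply: near_eq_cvg; apply: nearW => N.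
rewrite /tpoly !big_nat; apply: eq_bigr => n /andP[n0 _].
congr (_ * _); rewrite /b /wt -mulrA -rmorphM; congr (_ * _%:C).
rewrite -[LHS]powRD ?pnatr_eq0 -?lt0n ?n0 ?implybT//.
by rewrite -opprD -splitr.
Qed.

(** Fatou's lemma along partial sums, whose square means are given by Parseval's formula and bounded
    by [l2_coef]. *)
Lemma l2_shift (sigma : R) : 0 < sigma -> exists2 C : R, 0 <= C & forall s,
  (emom m 2 (fun chi : borel (torus R) =>
     shift sigma chi - tpoly (size s) (wt sigma (nth 0 s)) chi)%R <=
   ((C * near_F s) ^+ (2 ^ l))%:E)%E.
Proof.
move=> s0; have [C C0 hC] := l2_coef s0; exists C => // s.
(* Starting beyond the length of [s] includes all of [s] in every [D N], so [D N] tends to minus the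
   difference in question. *)
pose D N := tpoly (size s + N).+1 (wt sigma (fun n => s`_n - coef n)).
have mD N : @cmeasurable R _ (borel (torus R)) (D N) by exact: cmeasurable_tpolyT.
pose E chi := shift sigma chi - tpoly (size s) (wt sigma (nth 0 s)) chi.
have mE : @cmeasurable R _ (borel (torus R)) E.
  by apply: cmeasurableB; [exact: cmeasurable_shift|exact: cmeasurable_tpolyT].
have E2 : emom m 2 (E : borel (torus R) -> R[i]) =
    (\int[m]_chi (normc (E chi) ^+ 2)%:E)%E.
  by apply: eq_integral => chi _; rewrite powR_mulrn// normc_ge0.
rewrite E2; apply: (@fatou_ae _ (borel (torus R)) R m
  (fun N chi => normc (D N chi) ^+ 2)).
- by move=> N; apply: measurable_funX; exact: measurable_normc.
- by move=> N chi; exact: sqr_ge0.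
- by apply: measurable_funX; exact: measurable_normc.
- by move=> chi; exact: sqr_ge0.
- apply: filterS (shift_ae_cvg s0) => chi hchi.
  have h : normc (D N chi) @[N --> \oo] --> normc (E chi).
    apply/cvgrPdist_le => e e0.
    move/cvgc_normP/cvgrPdist_le : hchi => /(_ _ e0)[N0 _ hN].
    exists N0 => // N NN; have := hN (size s + N)%N (leq_trans NN (leq_addl _ _)).
    rewrite /= sub0r normrN ger0_norm ?normc_ge0//; apply: le_trans.
    have -> : D N chi = tpoly (size s) (wt sigma (nth 0 s)) chi -
        tpoly (size s + N).+1 (wt sigma coef) chi.
      rewrite (@tpoly_wide _ (size s) (size s + N).+1); last first.
      - by move=> n sn; rewrite /wt nth_default// mul0r.
      - by rewrite -addnS leq_addr.
      rewrite tpolyB; apply: eq_bigr => n _; congr (_ * _).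
      by rewrite /wt mulrBl.
    set x := tpoly (size s) _ _; set y := tpoly (size s + N).+1 _ _.
    rewrite (normcC x y) (_ : E chi = shift sigma chi - x)//.
    have h1 := normc_leD (shift sigma chi - x) (y - x).
    have h2 := normc_leD (y - x) (shift sigma chi - x).
    have e1 : shift sigma chi - x - (y - x) = shift sigma chi - y.
      by rewrite opprB addrA subrK.
    have e2 : y - x - (shift sigma chi - x) = y - shift sigma chi.
      by rewrite opprB addrA subrK.
    rewrite e1 (normcC _ y) in h1; rewrite e2 in h2.
    move: h1 h2; move: (normc _) (normc _) (normc _) => u v w h1 h2.
    by rewrite ler_norml; apply/andP; split; lra.
  exact: (@cvg_comp _ _ _ _ (fun x => x ^+ 2) _ _ _ h (@exprn_continuous _ _ _)).
- move=> N.
  have := @parseval R m m_haar nat (index_iota 1 (size s + N).+1) id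
    (wt sigma (fun n => s`_n - coef n)) (iota_uniq _ _) (fun _ _ _ _ => id).
  move=> ->; last by move=> n; rewrite mem_index_iota => /andP[].
  by rewrite lee_fin; exact: hC.
Qed.

Lemma shift_approx (sigma e : R) : 0 < sigma -> 0 < e ->
  exists2 dl : R, 0 < dl & forall s, near_F s <= dl ->
    qmom (fun chi => shift sigma chi - tpoly (size s) (wt sigma (nth 0 s)) chi) <= e /\
    qfin (fun chi => shift sigma chi - tpoly (size s) (wt sigma (nth 0 s)) chi).
Proof.
move=> s0 e0; have [C C0 hC] := l2_shift s0.
have q2 : q <= 2 by rewrite (le_trans q1)// ler1n.
have [d d0 hd] := qmom_small m q0 q2 e0.
have K0 : (0 < 2 ^ l)%N by rewrite expn_gt0.
have [dl dl0 hdl] := mul_exp_small C0 K0 d0.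
exists dl => // s sd.
pose E chi := shift sigma chi - tpoly (size s) (wt sigma (nth 0 s)) chi.
have mE : @cmeasurable R _ (borel (torus R)) E.
  by apply: cmeasurableB; [exact: cmeasurable_shift|exact: cmeasurable_tpolyT].
have h : (emom m q (E : borel (torus R) -> R[i]) <= e%:E)%E.
  apply: hd => //; apply: le_trans (hC s) _; rewrite lee_fin.
  exact (hdl _ (near_F_ge0 _ _ _ _) sd).
have fE : qfin E by split => //; exact (le_lt_trans h (ltry e)).
split; last exact: fE.
by rewrite -lee_fin -(emomE fE).
Qed.

Lemma qfin_shift (sigma : R) : 0 < sigma -> qfin (shift sigma).
Proof.
move=> s0; have [dl dl0 h] := shift_approx s0 ltr01.
have [s sd] := exists_near_F p_gt0 F_Hp q0 q1 qp dl0.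
have [_ f1] := h s sd.
have f2 := qfin_tpoly m (size s) (wt sigma (nth 0 s)) (ltW q0).
have := qfinD q0 q1 f1 f2; under eq_fun do rewrite subrK.
exact.
Qed.

Lemma wt0 a n : (0 < n)%N -> wt 0 a n = a n.
Proof. by move=> n0; rewrite /wt oppr0 powRr0 mulr1. Qed.

Lemma wtD (sigma tau : R) a n : (0 < n)%N -> wt sigma (wt tau a) n = wt (tau + sigma) a n.
Proof.
move=> n0; rewrite /wt -mulrA -rmorphM opprD powRD//.
by rewrite pnatr_eq0 -lt0n n0 implybT.
Qed.

Lemma tpoly_ext N a b : (forall n, (0 < n)%N -> a n = b n) ->
  tpoly N a = tpoly N b :> (torus R -> R[i]).
Proof.
move=> ab; apply/funext => chi; rewrite /tpoly !big_nat.
by apply: eq_bigr => n /andP[n0 _]; rewrite ab.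
Qed.

Lemma wtB (sigma : R) a b N : tpoly N (fun n => wt sigma a n - wt sigma b n) =
  tpoly N (wt sigma (fun n => a n - b n)) :> (torus R -> R[i]).
Proof. by apply: tpoly_ext => n _; rewrite /wt mulrBl. Qed.

Lemma qmom_tpoly_contraction (sigma tau : R) N a s : tau <= sigma ->
  qmom (fun chi => tpoly (size s) (wt sigma (nth 0 s)) chi - tpoly N (wt sigma a) chi) <=
  qmom (fun chi => tpoly (size s) (wt tau (nth 0 s)) chi - tpoly N (wt tau a) chi).
Proof.
move=> ts; pose N' := maxn (size s) N.
(* [a] may be nonzero from [N] on, so it is cut off before both sums are extended to the common
   length [N']. *)
pose a' n := if (n < N)%N then a n else 0.
have E (sg : R) : (fun chi => tpoly (size s) (wt sg (nth 0 s)) chi - tpoly N (wt sg a) chi) =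
    tpoly N' (wt sg (fun n => s`_n - a' n)).
  rewrite -wtB; apply/funext => chi; rewrite -tpolyB; congr (_ - _).
    by apply: tpoly_wide; [exact: leq_maxl|move=> n sn; rewrite /wt nth_default// mul0r].
  rewrite -(@tpoly_wide _ N N')//; first last.
  - by move=> n Nn; rewrite /wt /a' ltnNge Nn /= mul0r.
  - exact: leq_maxr.
  rewrite /tpoly !big_nat; apply: eq_bigr => n /andP[_ nN].
  by rewrite /wt /a' nN.
rewrite !E; have st0 : 0 <= sigma - tau by rewrite subr_ge0.
have := qmom_contraction m_haar q0 q1 qK N' (wt tau (fun n => s`_n - a' n)) st0.
suff -> : tpoly N' (wt (sigma - tau) (wt tau (fun n => s`_n - a' n))) =
  tpoly N' (wt sigma (fun n => s`_n - a' n)) :> (torus R -> R[i]) by [].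
by apply: tpoly_ext => n n0; rewrite wtD// addrC subrK.
Qed.

Lemma le_addeps (x y : R) : (forall e : R, 0 < e -> x <= e + e + y) -> x <= y.
Proof.
move=> h; apply/ler_addgt0Pr => e e0; have e2 : 0 < e / 2 by rewrite divr_gt0.
by have := h _ e2; rewrite -splitr addrC.
Qed.

(** The contraction for polynomials, carried over by the triangle inequality with one error near
    F_sigma and one near [F]. The subtracted polynomial will be the constant alpha for the
    logarithms and an approximant of [F] in [shift_cvg]. *)
Lemma qmom_shift_le_F (sigma : R) N a : 0 < sigma ->
  qmom (fun chi => shift sigma chi - tpoly N (wt sigma a) chi) <=
  qmom (fun chi => F chi - tpoly N a chi).
Proof.
move=> s0; apply: le_addeps => e e0; have [dl dl0 h] := shift_approx s0 e0.
have de0 : 0 < Num.min dl e by rewrite lt_min dl0.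
have [s sd] := exists_near_F p_gt0 F_Hp q0 q1 qp de0.
have [sd1 sd2] : near_F s <= dl /\ near_F s <= e.
  by move: sd; rewrite le_min => /andP[].
have [h1 _] := h s sd1.
have fs := qfin_shift s0; have fF := Hardy_qfin p_gt0 F_Hp q0 qp.
have f2 := qfin_tpoly m (size s) (wt sigma (nth 0 s)) (ltW q0).
have f3 := qfin_tpoly m N (wt sigma a) (ltW q0).
have f4 := qfin_tpoly m N a (ltW q0).
have f5 := qfin_ap m q0 s.
have t1 := qmom_tri q0 q1 fs f2 f3.
have t2 := qmom_tri q0 q1 f5 fF f4.
have t3 := qmom_tpoly_contraction N a s (ltW s0).
rewrite (@tpoly_ext (size s) (wt 0 (nth 0 s)) (nth 0 s)) in t3; last by move=> n; exact: wt0.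
rewrite (@tpoly_ext N (wt 0 a) a) in t3; last by move=> n; exact: wt0.
have t4 : qmom (fun chi => analytic_poly s chi - F chi) <= e.
  have e1 := @qmomC _ (borel (torus R)) R m q (analytic_poly s) F.
  by rewrite e1; exact sd2.
apply: (le_trans t1); rewrite -addrA; apply: lerD; first exact: h1.
apply: (le_trans t3); apply: (le_trans t2); exact: lerD t4 (lexx _).
Qed.

Lemma qmom_shift_mono (sigma tau : R) N a : 0 < tau -> tau <= sigma ->
  qmom (fun chi => shift sigma chi - tpoly N (wt sigma a) chi) <=
  qmom (fun chi => shift tau chi - tpoly N (wt tau a) chi).
Proof.
move=> t0 ts; have s0 := lt_le_trans t0 ts.
apply: le_addeps => e e0; have [d1 d10 h1] := shift_approx s0 e0.
have [d2 d20 h2] := shift_approx t0 e0.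
have de0 : 0 < Num.min d1 d2 by rewrite lt_min d10.
have [s sd] := exists_near_F p_gt0 F_Hp q0 q1 qp de0.
have [sd1 sd2] : near_F s <= d1 /\ near_F s <= d2.
  by move: sd; rewrite le_min => /andP[].
have [{}h1 _] := h1 s sd1; have [{}h2 _] := h2 s sd2.
have fs := qfin_shift s0; have ft := qfin_shift t0.
have f2 := qfin_tpoly m (size s) (wt sigma (nth 0 s)) (ltW q0).
have f2' := qfin_tpoly m (size s) (wt tau (nth 0 s)) (ltW q0).
have f3 := qfin_tpoly m N (wt sigma a) (ltW q0).
have f4 := qfin_tpoly m N (wt tau a) (ltW q0).
have g1 := qmom_tri q0 q1 fs f2 f3.
have g2 := qmom_tri q0 q1 f2' ft f4.
have g3 := qmom_tpoly_contraction N a s ts.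
rewrite (@qmomC _ (borel (torus R)) R m q _ (shift tau)) in g2.
apply: (le_trans g1); rewrite -addrA; apply: lerD; first exact: h1.
apply: (le_trans g3); apply: (le_trans g2); exact: lerD h2 (lexx _).
Qed.

(** The path is F_sigma, s_sigma, s, F. The first distance is at most that from [F] to [s] by
    [qmom_shift_le_F], and s_sigma tends to s uniformly on the torus because finitely many weights
    occur. *)
Lemma shift_cvg (sigma : nat -> R) : (forall j, 0 < sigma j) ->
  sigma j @[j --> \oo] --> 0 ->
  forall e : R, 0 < e -> exists j0, forall j, (j0 <= j)%N ->
    qmom (fun chi => shift (sigma j) chi - F chi) <= e.
Proof.
move=> sp sc e e0; have e3 : 0 < e / 3 by rewrite divr_gt0.
have [s sd] := exists_near_F p_gt0 F_Hp q0 q1 qp e3.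
have [x x0 xq] : exists2 x : R, 0 < x & x `^ q = e / 3.
  by exists ((e / 3) `^ q^-1); [exact: powR_gt0|rewrite -powRrM mulVf ?gt_eqF// powRr1// ltW].
have cw : (\sum_(1 <= n < size s) normc (s`_n - wt (sigma j) (nth 0 s) n)) @[j --> \oo]
    --> \sum_(1 <= n < size s) (0 : R).
  apply: cvg_sum_nat => n n0.
  have cl : n%:R `^ (- sigma j) @[j --> \oo] --> (1 : R).
    have pE (y : R) : n%:R `^ y = expR (y * ln n%:R) by rewrite /powR pnatr_eq0 gtn_eqF.
    under eq_fun do rewrite pE.
    have c1 : (- sigma j * ln n%:R) @[j --> \oo] --> - 0 * ln (n%:R : R).
      by apply: cvgM; [exact: cvgN|exact: cvg_cst].
    have := @cvg_comp _ _ _ (fun j => - sigma j * ln n%:R) expR _ _ _ c1 (@continuous_expR _ _).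
    by rewrite oppr0 mul0r expR0.
  apply/cvgrPdist_le => d d0.
  have k0 : 0 < d / (normc s`_n + 1) by rewrite divr_gt0// ltr_wpDl// normc_ge0.
  move/cvgrPdist_le : cl => /(_ _ k0)[j0 _ hj]; exists j0 => // j jj.
  have := hj j jj; rewrite /= => h; rewrite sub0r normrN ger0_norm ?normc_ge0//.
  have -> : s`_n - wt (sigma j) (nth 0 s) n = s`_n * (1 - n%:R `^ (- sigma j))%:C.
    by rewrite /wt rmorphB rmorph1 mulrBr mulr1.
  rewrite normcM normc_real; rewrite ler_pdivlMr in h; last by rewrite ltr_wpDl// normc_ge0.
  by apply: le_trans h; rewrite mulrC; apply: ler_wpM2l => //; rewrite lerDl.
rewrite big1 in cw; last by [].
move/cvgrPdist_le : cw => /(_ _ x0)[j0 _ hj]; exists j0 => j jj.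
have s0 := sp j; have fs := qfin_shift s0; have fF := Hardy_qfin p_gt0 F_Hp q0 qp.
have f2 := qfin_tpoly m (size s) (wt (sigma j) (nth 0 s)) (ltW q0).
have f5 := qfin_ap m q0 s.
have t1 := qmom_tri q0 q1 fs f2 fF.
have t2 := qmom_tri q0 q1 f2 f5 fF.
have t3 := qmom_shift_le_F (size s) (nth 0 s) s0.
have t4 : qmom (fun chi => analytic_poly s chi - F chi) <= e / 3.
  have e1 := @qmomC _ (borel (torus R)) R m q (analytic_poly s) F.
  by rewrite e1; exact sd.
have t5 : qmom (fun chi => tpoly (size s) (wt (sigma j) (nth 0 s)) chi - analytic_poly s chi)
    <= e / 3.
  have ff := qfinB q0 q1 f2 f5.
  rewrite -lee_fin -(emomE ff) -xq -(@integral_prob_cst _ (borel (torus R)) R m).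
  apply: le_integral_EFin.
  - by apply: measurable_qpow; case: ff.
  - exact: measurable_cst.
  move=> chi; rewrite powR_ge0/=; apply: ler_powR_base; rewrite ?(ltW q0) ?normc_ge0//.
  rewrite normcC (analytic_polyE _ (leqnn _)) tpolyB.
  apply: (le_trans (normc_tpoly _ _ _)); have := hj j jj.
  rewrite /= sub0r normrN ger0_norm// sumr_ge0// => n _; exact: normc_ge0.
have -> : e = e / 3 + (e / 3 + e / 3) by field.
apply: (le_trans t1); apply: lerD; first by apply: (le_trans t3); exact: sd.
by apply: (le_trans t2); exact: lerD t5 t4.
Qed.

End HardyLimit.

Lemma emom_integral d (T : measurableType d) (R : realType)
    (P : probability T R) (q : R) (f : T -> R[i]) :
  emom P q f = (\int[P]_t (normc (f t) `^ q)%:E)%E.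
Proof. by with_strategy transparent [emom] rewrite /emom. Qed.

Lemma EFin_sub_le (R : realType) (x : R) (k : \bar R) :
  (0 <= k)%E -> (x%:E - k <= x%:E)%E.
Proof.
by case: k => [k| |] //=; rewrite ?leNye// lee_fin => k0; rewrite lee_fin gerBl.
Qed.

(** * Logarithmic integrals as limits of moments *)

Section LogIntegral.
Context d (T : measurableType d) (R : realType) (P : probability T R).
Implicit Types (f g : T -> R[i]).

(** If [k] has infinite integral, both sides are -oo: the positive part of u - k is dominated by
    |u|, and its negative part plus |u| dominates k. *)
Lemma integral_sub_ge0 (u : T -> R) (k : T -> \bar R) :
  P.-integrable setT (fun t => (u t)%:E) -> measurable_fun setT k ->
  (forall t, 0 <= k t)%E ->
  (\int[P]_t ((u t)%:E - k t) = \int[P]_t (u t)%:E - \int[P]_t k t)%E.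
Proof.
move=> iu mk k0; have mu : measurable_fun setT (fun t => (u t)%:E) := measurable_int _ iu.
have [koo|koo] := eqVneq (\int[P]_t k t)%E +oo%E; last first.
  have ik : P.-integrable setT k.
    apply/integrableP; split=> //; under eq_integral do rewrite gee0_abs//.
    by rewrite ltey.
  exact: (integralB measurableT iu ik).
have /integrableP[_ abu] := iu.
have uf : (\int[P]_t (u t)%:E)%E \is a fin_num by exact: integrable_fin_num.
pose v t := ((u t)%:E - k t)%E.
have mv : measurable_fun setT v by exact: emeasurable_funB.
have mau : measurable_fun setT (fun t => `|(u t)%:E|)%E by exact: measurableT_comp.
have mvp := measurable_funepos mv; have mvn := measurable_funeneg mv.
have vp : (\int[P]_t v^\+ t < +oo)%E.
  apply: le_lt_trans abu.
  have := @ge0_le_integral _ T R P setT measurableT v^\+%E (fun t => `|(u t)%:E|)%E.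
  apply=> [t _||//|t _]; [exact: funepos_ge0|exact: mvp|].
  rewrite funeposE ge_max abse_ge0 andbT /v.
  apply: (@le_trans _ _ (u t)%:E); last exact: lee_abs.
  exact: EFin_sub_le.
have vn : (\int[P]_t v^\- t = +oo)%E.
  have : (\int[P]_t k t <= \int[P]_t (v^\- t + `|(u t)%:E|))%E.
    have := @ge0_le_integral _ T R P setT measurableT k (fun t => v^\- t + `|(u t)%:E|)%E.
    apply=> [t _|//||t _]; [exact: k0|exact: emeasurable_funD|].
    rewrite funenegE /v; have := k0 t; case: (k t) => [r|_|//].
      rewrite lee_fin => r0; rewrite -EFinB -EFinN -EFin_max abse_EFin -EFinD lee_fin.
      have := ler_norm (u t); have : - (u t - r) <= Num.max (- (u t - r)) 0.
        by rewrite le_max lexx.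
      lra.
    by rewrite /= maxye.
  have := @ge0_integralD _ T R P setT measurableT v^\-%E (fun t => `|(u t)%:E|)%E.
  move=> -> //.
  rewrite koo leye_eq => /eqP.
  move: abu; move: (\int[P]_t v^\- t)%E (\int[P]_t `|(u t)%:E|)%E.
  by move=> [x| |] [y| |].
rewrite integralE vn koo; move: vp uf.
have : (0 <= \int[P]_t v^\+ t)%E by apply: integral_ge0 => t _; exact: funepos_ge0.
by move: (\int[P]_t v^\+ t)%E (\int[P]_t (u t)%:E)%E => [x| |] [y| |].
Qed.

Lemma measurable_lne_EFin (h : T -> R) : measurable_fun setT h ->
  (forall t, 0 <= h t) -> measurable_fun setT (fun t => lne (h t)%:E).
Proof.
move=> mh h0.
rewrite (_ : (fun t => _) = fun t => if 0 < h t then (ln (h t))%:E else -oo%E).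
  apply: measurable_fun_ifT; last exact: measurable_cst.
    by apply: measurable_fun_ltr => //; exact: measurable_cst.
  by apply/measurable_EFinP; apply: (measurableT_comp (@measurable_ln R)).
apply/funext => t; case: ifPn => [/lne_EFin//|].
by rewrite -leNgt => h1; rewrite le0_lneNy.
Qed.

Lemma measurable_logmod f : cmeasurable f ->
  measurable_fun setT (fun t => logmod (f t)).
Proof.
move=> mf; apply: measurable_lne_EFin; first exact: measurable_normc.
by move=> t; exact: normc_ge0.
Qed.

Definition plog (q x : R) : R := (x `^ q - 1) / q.

Lemma ln_le_plog (q x : R) : 0 < q -> 0 < x -> ln x <= plog q x.
Proof.
move=> q0 x0; rewrite /plog ler_pdivlMr// mulrC -ln_powR.
have xq : 0 < x `^ q by exact: powR_gt0.
have h := @le_ln1Dx R (x `^ q - 1); rewrite [1 + _]addrC subrK in h.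
by apply: h; rewrite ltrBrDr addNr.
Qed.

Lemma lne_le_plog (q x : R) : 0 < q -> 0 <= x -> (lne x%:E <= (plog q x)%:E)%E.
Proof.
move=> q0; rewrite le_eqVlt => /predU1P[<-|x0]; first by rewrite le0_lneNy// leNye.
by rewrite lne_EFin// lee_fin ln_le_plog.
Qed.

(** With y = x^(q/2) this is (y - 1)^2 >= 0. *)
Lemma plog_half (q x : R) : 0 < q -> 0 <= x -> plog (q / 2) x <= plog q x.
Proof.
move=> q0 x0; have E : x `^ q = (x `^ (q / 2)) ^+ 2.
  by rewrite -powR_mulrn ?powR_ge0// -powRrM divfK.
rewrite /plog E; set y := x `^ _; rewrite ler_pdivrMr; last by rewrite divr_gt0.
have -> : (y ^+ 2 - 1) / q * (q / 2) = (y ^+ 2 - 1) / 2 by field; rewrite gt_eqF.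
by have := sqr_ge0 (y - 1); lra.
Qed.

Lemma plog_le_ln (q x : R) : 0 < q -> 0 < x -> plog q x <= ln x * x `^ q.
Proof.
move=> q0 x0; have xq : 0 < x `^ q by exact: powR_gt0.
rewrite /plog ler_pdivrMr//.
have h := @le_ln1Dx R ((x `^ q)^-1 - 1).
rewrite [1 + _]addrC subrK lnV// in h.
have {}h : - ln (x `^ q) <= (x `^ q)^-1 - 1 by apply: h; rewrite ltrBrDr addNr invr_gt0.
rewrite ln_powR in h.
have := ler_wpM2r (ltW xq) h; rewrite mulrBl mulVf ?gt_eqF//; lra.
Qed.

Section Sequence.
Variables (q : nat -> R).
Hypotheses (q_gt0 : forall j, 0 < q j) (qS : forall j, q j.+1 = q j / 2).

Let qE j : q j = q 0%N * (2^-1) ^+ j.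
Proof. by elim: j => [|j ih]; rewrite ?expr0 ?mulr1// qS ih exprSr mulrA. Qed.

Let q_cvg : q j @[j --> \oo] --> 0.
Proof.
rewrite (_ : q = fun j => q 0%N * (2^-1) ^+ j); last by apply/funext.
by apply: cvg_geometric; rewrite ger0_norm ?invr_ge0// invf_lt1// ltr1n.
Qed.

Lemma plog_cvg (x : R) : 0 < x -> plog (q j) x @[j --> \oo] --> ln x.
Proof.
move=> x0; apply: (@squeeze_cvgr _ _ _ _ (fun=> ln x) (fun j => ln x * x `^ q j)).
- by apply: nearW => j; rewrite ln_le_plog//= plog_le_ln.
- exact: cvg_cst.
- have pE (y : R) : x `^ y = expR (y * ln x) by rewrite /powR gt_eqF.
  have c1 : (q j * ln x) @[j --> \oo] --> 0 * ln x.
    by apply: cvgM; [exact: q_cvg|exact: cvg_cst].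
  have c2 := @cvg_comp _ _ _ (fun j => q j * ln x) expR _ _ _ c1 (@continuous_expR _ _).
  have c3 : (x `^ q j) @[j --> \oo] --> (1 : R).
    by under eq_fun do rewrite pE; move: c2; rewrite mul0r expR0.
  by rewrite -[X in _ --> X]mulr1; apply: cvgM; [exact: cvg_cst|exact: c3].
Qed.

(** The nonnegative gap between (x^q - 1)/q and log x. A logarithmic integral becomes a finite
    number minus the integral of this gap, which may be +oo. *)
Let kq (x : R) : \bar R := ((plog (q 0%N) x)%:E - lne x%:E)%E.

Let plog_mono (x : R) i j : 0 <= x -> (i <= j)%N -> plog (q j) x <= plog (q i) x.
Proof.
move=> x0; elim: j => [|j ih]; first by rewrite leqn0 => /eqP ->.
rewrite leq_eqVlt => /predU1P[->//|/ih h]; apply: le_trans h.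
by rewrite qS plog_half.
Qed.

Let kq_cvg (x : R) : 0 <= x ->
  (plog (q 0%N) x - plog (q j) x)%:E @[j --> \oo] --> kq x.
Proof.
rewrite le_eqVlt => /predU1P[<-|x0].
  rewrite /kq le0_lneNy//= addey//.
  have E j : plog (q 0%N) 0 - plog (q j) 0 = (q j)^-1 - (q 0%N)^-1.
    have q0 k : q k != 0 by rewrite gt_eqF.
    by rewrite /plog !powR0//; field; rewrite !q0.
  under eq_fun do rewrite E.
  apply/cvgeryP/cvgryPge => A.
  have c : (q j)^-1 @[j --> \oo] --> +oo.
    apply/gtr0_cvgV0; first by apply: nearW => j; rewrite invr_gt0.
    apply: (@cvg_trans _ (q @ \oo)); last exact: q_cvg.
    by apply: near_eq_cvg; apply: nearW => j; exact: (esym (invrK (q j))).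
  move/cvgryPge : c => /(_ (A + (q 0%N)^-1)); apply: filterS => j.
  by rewrite lerBrDr.
rewrite /kq lne_EFin// -EFinB; apply: cvg_EFin; first exact: nearW.
by apply: cvgB; [exact: cvg_cst|exact: plog_cvg].
Qed.

Let mplog f j : cmeasurable f -> measurable_fun setT (fun t => plog (q j) (normc (f t))).
Proof.
move=> mf; apply: measurable_funM => //; apply: measurable_funB => //.
exact: measurable_qpow.
Qed.

Let iplog f j : qfin P (q j) f ->
  P.-integrable setT (fun t => (plog (q j) (normc (f t)))%:E) /\
  (\int[P]_t (plog (q j) (normc (f t)))%:E = (((qmom P (q j) f) - 1) / q j)%:E)%E.
Proof.
move=> [mf ff].
have i1 : P.-integrable setT (fun t => (normc (f t) `^ q j)%:E).
  apply/integrableP; split; first by apply/measurable_EFinP; exact: measurable_qpow.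
  under eq_integral do rewrite gee0_abs ?lee_fin ?powR_ge0//.
  by move: ff; rewrite emom_integral.
have i2 : P.-integrable setT (fun t => (1 : R)%:E).
  by apply: (@bounded_integrable _ _ _ _ _ 1) => // t; rewrite normr1.
have i3 := integrableB measurableT i1 i2.
have E : (fun t => (plog (q j) (normc (f t)))%:E) =
    (fun t => ((q j)^-1)%:E * ((normc (f t) `^ q j)%:E - 1%:E))%E.
  by apply/funext => t; rewrite -EFinB -EFinM mulrC.
rewrite E; split; first exact: (integrableZl measurableT _ i3).
rewrite (integralZl measurableT i3) (integralB measurableT i1 i2).
rewrite integral_prob_cst.
have := emomE (conj mf ff); rewrite emom_integral => ->.
by rewrite -EFinB -EFinM mulrC.
Qed.

Let mk f : cmeasurable f -> measurable_fun setT (fun t => kq (normc (f t))).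
Proof.
move=> mf; apply: emeasurable_funB; last exact: measurable_logmod.
by apply/measurable_EFinP; exact: mplog.
Qed.

Let k0 (x : R) : 0 <= x -> (0 <= kq x)%E.
Proof.
move=> x0; rewrite /kq; have := lne_le_plog (q_gt0 0%N) x0.
case: (lne _) => [r||]//=; rewrite -?EFinB ?leey// => h.
by move: h; rewrite [in X in X -> _]lee_fin lee_fin subr_ge0.
Qed.

Lemma logmod_integralE f : qfin P (q 0%N) f ->
  (\int[P]_t logmod (f t) =
   (((qmom P (q 0%N) f) - 1) / q 0%N)%:E - \int[P]_t kq (normc (f t)))%E.
Proof.
move=> ff; have [ip <-] := iplog ff; have mf := ff.1.
rewrite -(integral_sub_ge0 ip (mk mf)); last by move=> t; exact: k0 (normc_ge0 _).
apply: eq_integral => t _; rewrite /kq /logmod.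
by case: (lne _) => [r||]//=; rewrite -?EFinB ?opprB ?(addrC (plog _ _)) ?subrK.
Qed.

(** Monotone convergence for the differences of [plog] at q_0 and q_j, which increase to [kq]. *)
Lemma logmod_integral_ge f (x : \bar R) : (forall j, qfin P (q j) f) ->
  (forall j, x <= (((qmom P (q j) f) - 1) / q j)%:E)%E ->
  (x <= \int[P]_t logmod (f t))%E.
Proof.
move=> ff hx; have mf := (ff 0%N).1; rewrite (logmod_integralE (ff 0%N)).
pose g j t := (plog (q 0%N) (normc (f t)) - plog (q j) (normc (f t)))%:E.
have mg j : measurable_fun setT (g j).
  by apply/measurable_EFinP; apply: measurable_funB; exact: mplog.
have g0 j t : setT t -> (0 <= g j t)%E.
  by move=> _; rewrite lee_fin subr_ge0; apply: plog_mono => //; exact: normc_ge0.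
have gm t : setT t -> {homo g^~ t : n n' / (n <= n')%N >-> (n <= n')%E}.
  by move=> _ i j ij; rewrite lee_fin lerD2l lerN2; apply: plog_mono => //; exact: normc_ge0.
have -> : (\int[P]_t kq (normc (f t)) = \int[P]_t limn (g^~ t))%E.
  by apply: eq_integral => t _; apply/esym/cvg_lim => //; exact: kq_cvg (normc_ge0 _).
have := @monotone_convergence _ T R P setT measurableT g mg g0 gm.
move=> ->; have Ig j : (\int[P]_t g j t =
    (((qmom P (q 0%N) f) - 1) / q 0%N - ((qmom P (q j) f) - 1) / q j)%:E)%E.
  have [i1 e1] := iplog (ff 0%N); have [i2 e2] := iplog (ff j).
  by rewrite EFinB -e1 -e2 -(integralB measurableT i1 i2).
case: x hx => [x| |] hx; last exact: leNye.
  have /lime_le : cvgn (fun j => \int[P]_t g j t)%E.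
    apply: ereal_nondecreasing_is_cvgn => i j ij.
    have := @ge0_le_integral _ T R P setT measurableT (g i) (g j) (g0 i) (mg i) (mg j).
    by apply=> t _; exact: gm.
  move=> /(_ (((qmom P (q 0%N) f) - 1) / q 0%N - x)%:E) h.
  have {h} : (limn (fun j => \int[P]_t g j t) <= (((qmom P (q 0%N) f) - 1) / q 0%N - x)%:E)%E.
    apply: h; apply: nearW => j; rewrite Ig lee_fin lerD2l lerN2.
    by rewrite -lee_fin; exact: hx.
  move: (limn _) => [L||]//=; last by move=> _; rewrite leey.
  by rewrite -EFinB !lee_fin => ?; rewrite lerBrDr addrC -lerBrDr.
by have := hx 0%N; rewrite leye_eq.
Qed.

Lemma logmod_integral_le f : qfin P (q 0%N) f ->
  (\int[P]_t logmod (f t) <= (((qmom P (q 0%N) f) - 1) / q 0%N)%:E)%E.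
Proof.
move=> ff; rewrite (logmod_integralE ff).
have : (0 <= \int[P]_t kq (normc (f t)))%E.
  by apply: integral_ge0 => t _; exact: k0 (normc_ge0 _).
exact: EFin_sub_le.
Qed.

End Sequence.

Lemma logmod_integral_mono (q : nat -> R) f g : (forall j, 0 < q j) ->
  (forall j, q j.+1 = q j / 2) ->
  (forall j, qfin P (q j) f) -> (forall j, qfin P (q j) g) ->
  (forall j, qmom P (q j) f <= qmom P (q j) g) ->
  (\int[P]_t logmod (f t) <= \int[P]_t logmod (g t))%E.
Proof.
move=> q0 qS ff fg fgq; apply: (logmod_integral_ge q0 qS fg) => j.
(* The sequence restarted at [j] gives the upper bound with the exponent q_j. *)
have h := @logmod_integral_le (fun i => q (i + j)%N) (fun i => q0 _) f (ff _).
apply: (le_trans h); rewrite lee_fin add0n ler_pM2r ?invr_gt0//.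
by rewrite lerD2r.
Qed.

End LogIntegral.

(** * The truncated logarithmic kernel *)

Section TruncatedLog.
Variable R : realType.
Implicit Types e x y : R.

(** For e > 0 this is the positive part of log(e / x), with value +oo at x = 0: the logarithmic
    kernel truncated at distance [e]. *)
Definition logneg e x : \bar R := ((ln (Num.max x e))%:E - lne x%:E)%E.

Lemma logneg0 e : logneg e 0 = +oo%E.
Proof. by rewrite /logneg le0_lneNy. Qed.

Lemma logneg_pos e x : 0 < x -> logneg e x = (ln (Num.max x e) - ln x)%:E.
Proof. by move=> x0; rewrite /logneg lne_EFin. Qed.

Lemma logneg_ge0 e x : 0 <= x -> (0 <= logneg e x)%E.
Proof.
rewrite le_eqVlt => /predU1P[<-|x0]; first by rewrite logneg0.
rewrite logneg_pos// lee_fin subr_ge0 ler_ln ?posrE ?lt_max ?x0//.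
by rewrite le_max lexx.
Qed.

Lemma logneg_eq0 e x : 0 < x -> e <= x -> logneg e x = 0%E.
Proof. by move=> x0 ex; rewrite logneg_pos// max_l// subrr. Qed.

Lemma logneg_le e x y : 0 < e -> 0 <= x -> x <= y -> (logneg e y <= logneg e x)%E.
Proof.
move=> e0; rewrite le_eqVlt => /predU1P[<- y0|x0 xy]; first by rewrite logneg0 leey.
have y0 := lt_le_trans x0 xy.
have [ey|ye] := leP e y; first by rewrite logneg_eq0// logneg_ge0// ltW.
have xe := le_lt_trans xy ye.
rewrite !logneg_pos// !max_r ?(ltW ye) ?(ltW xe)// lee_fin lerD2l lerN2.
by rewrite ler_ln ?posrE.
Qed.

Lemma logneg_scale c e x : 0 < c -> 0 < e -> 0 <= x ->
  logneg (c * e) (c * x) = logneg e x.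
Proof.
move=> c0 e0; rewrite le_eqVlt => /predU1P[<-|x0]; first by rewrite mulr0 !logneg0.
rewrite !logneg_pos ?mulr_gt0// -maxr_pMr ?(ltW c0)//.
by rewrite !lnM ?posrE ?lt_max ?x0// opprD addrACA subrr add0r.
Qed.

Lemma logneg_homo e e' x : 0 <= x -> e <= e' -> (logneg e x <= logneg e' x)%E.
Proof.
rewrite le_eqVlt => /predU1P[<-|x0] ee; first by rewrite !logneg0.
rewrite !logneg_pos// lee_fin lerD2r ler_ln ?posrE ?lt_max ?x0//.
by rewrite ge_max !le_max lexx ee orbT.
Qed.

Lemma logneg_cvg e x : 0 < e -> 0 <= x ->
  logneg e (x + i.+1%:R^-1) @[i --> \oo] --> logneg e x.
Proof.
move=> e0 x0.
have c0 : (x + i.+1%:R^-1) @[i --> \oo] --> x.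
  rewrite -[X in _ --> X]addr0; apply: cvgD; first exact: cvg_cst.
  exact: cvg_harmonic.
have p0 i : 0 < x + (i.+1%:R^-1 : R) by rewrite ltr_wpDl// invr_gt0.
have [ex|xe] := leP e x.
  have x_gt0 := lt_le_trans e0 ex.
  rewrite logneg_eq0//; apply: (@cvg_trans _ ((fun=> 0%E : \bar R) @ \oo)); last exact: cvg_cst.
  apply: near_eq_cvg; apply: nearW => i /=; rewrite logneg_eq0//.
  by rewrite ler_wpDr// invr_ge0.
have E : \forall i \near \oo, (ln e - ln (x + i.+1%:R^-1))%:E = logneg e (x + i.+1%:R^-1).
  have /cvgr_lt/(_ _ xe) : (x + i.+1%:R^-1) @[i --> \oo] --> x := c0.
  by apply: filterS => i h; rewrite logneg_pos// max_r// ltW.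
apply: (cvg_trans (near_eq_cvg E)).
move: x0; rewrite le_eqVlt => /predU1P[x0|x0].
  rewrite -x0 logneg0; apply/cvgeryP/cvgryPge => A.
  exists (Num.truncn (expR (A - ln e))) => // i /= hi.
  rewrite add0r lnV ?posrE// opprK -lerBlDl -ler_expR lnK ?posrE//.
  by apply: ltW; apply: (lt_le_trans (truncnS_gt _)); rewrite ler_nat ltnS.
rewrite logneg_pos// max_r ?(ltW xe)//; apply: cvg_EFin; first exact: nearW.
apply: cvgB; first exact: cvg_cst.
by apply: continuous_cvg => //; exact: continuous_ln.
Qed.

Lemma measurable_logneg d (T : measurableType d) e (h : T -> R) :
  measurable_fun setT h -> (forall t, 0 <= h t) ->
  measurable_fun setT (fun t => logneg e (h t)).
Proof.
move=> mh h0; apply: emeasurable_funB; last exact: measurable_lne_EFin.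
apply/measurable_EFinP; apply: (measurableT_comp (@measurable_ln R)).
exact: measurable_maxr.
Qed.

(** With M = max(y, e) one has max(x, e) <= M (1 + r / e), and q log(1 + t) <= log(1 + t^q) <= t^q.
    The bound is of Hoelder type because only q-th moments of differences are controlled. *)
Lemma ln_max_le e q x y : 0 < e -> 0 < q -> q <= 1 -> 0 <= x -> 0 <= y ->
  ln (Num.max x e) <= ln (Num.max y e) + `|x - y| `^ q / (q * e `^ q).
Proof.
move=> e0 q0 q1 x0 y0; set M := Num.max y e; set r := `|x - y|.
have M0 : 0 < M by rewrite lt_max e0 orbT.
have eM : e <= M by rewrite le_max lexx orbT.
have r0 : 0 <= r by exact: normr_ge0.
have eq0 : 0 < e `^ q by exact: powR_gt0.
have re : 0 <= r / e by rewrite divr_ge0// ltW.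
have h1 : Num.max x e <= M * (1 + r / e).
  have Mr : M + r <= M * (1 + r / e).
    rewrite mulrDr mulr1 lerD2l mulrCA ler_peMr// ler_pdivlMr// mul1r//.
  apply: le_trans Mr; rewrite ge_max; apply/andP; split; last by rewrite ler_wpDr.
  have : y <= M by rewrite le_max lexx.
  have : x - y <= r by exact: ler_norm.
  lra.
have h2 : ln (1 + r / e) <= (r / e) `^ q / q.
  rewrite ler_pdivlMr// mulrC -ln_powR.
  apply: (@le_trans _ _ (ln (1 + (r / e) `^ q))).
    rewrite ler_ln ?posrE ?powR_gt0 ?ltr_pwDl ?powR_ge0//.
    by have := @powRD_le R 1 (r / e) q ler01 re q0 q1; rewrite powR1.
  by apply: le_ln1Dx; rewrite (lt_le_trans _ (powR_ge0 _ _))// ltrN10.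
apply: (@le_trans _ _ (ln (M * (1 + r / e)))).
  by rewrite ler_ln ?posrE ?mulr_gt0 ?lt_max ?e0 ?orbT ?ltr_pwDl.
rewrite lnM ?posrE ?ltr_pwDl// lerD2l; apply: (le_trans h2).
rewrite powRM ?invr_ge0 ?(ltW e0)// -powR_inv1 ?(ltW e0)// -powRrM mulN1r powRN.
by rewrite -mulrA invfM [(q^-1 * _)]mulrC.
Qed.

End TruncatedLog.

Section LogDifference.
Context d (T : measurableType d) (R : realType) (P : probability T R).
Implicit Types (f g : T -> R[i]).

Lemma integrable_qpow (q : R) f : qfin P q f ->
  P.-integrable setT (fun t => (normc (f t) `^ q)%:E).
Proof.
move=> ff; apply/integrableP; split; first by apply/measurable_EFinP; exact: measurable_qpow ff.1.
under eq_integral do rewrite gee0_abs ?lee_fin ?powR_ge0//.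
by have := ff.2; rewrite emom_integral.
Qed.

Lemma integrable_ln_max (e q : R) f : 0 < e -> 0 < q -> q <= 1 -> qfin P q f ->
  P.-integrable setT (fun t => (ln (Num.max (normc (f t)) e))%:E).
Proof.
move=> e0 q0 q1 ff; have mf := ff.1; have mn := measurable_normc mf.
have eq0 : 0 < e `^ q by exact: powR_gt0.
have i1 := integrable_qpow ff.
have i2 : P.-integrable setT (fun t => (`|ln e| : R)%:E).
  by apply: (@bounded_integrable _ _ _ _ _ `|ln e|) => // t; rewrite normr_id.
have i3 := integrableD measurableT i2 (integrableZl measurableT (q * e `^ q)^-1 i1).
apply: (le_integrable measurableT _ _ i3).
  apply/measurable_EFinP; apply: (measurableT_comp (@measurable_ln R)).
  exact: measurable_maxr.
move=> t _; change (`|(ln (Num.max (normc (f t)) e))%:E| <=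
  `|(`|ln e| + (q * e `^ q)^-1 * normc (f t) `^ q)%:E|)%E.
rewrite !abse_EFin lee_fin.
set c := _^-1; have c0 : 0 <= c by rewrite invr_ge0 mulr_ge0 ?(ltW q0) ?(ltW eq0).
have pc : 0 <= c * normc (f t) `^ q by rewrite mulr_ge0 ?powR_ge0.
rewrite [X in _ <= X]ger0_norm ?addr_ge0// ler_norml.
have n0 := normc_ge0 (f t).
have := @ln_max_le R e q (normc (f t)) 0 e0 q0 q1 n0 (lexx _).
rewrite subr0 (ger0_norm n0) (max_r (ltW e0)) [_ / _]mulrC -/c => h.
have h2 : ln e <= ln (Num.max (normc (f t)) e).
  by rewrite ler_ln ?posrE ?lt_max ?e0 ?orbT// le_max lexx orbT.
have := ler_norm (ln e).
have : - ln e <= `|ln e| by rewrite -normrN ler_norm.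
by move=> h3 h4; apply/andP; split; lra.
Qed.

(** Both logarithms are split as log max(x, e) minus [logneg]. The first parts are compared by
    [ln_max_le]; the [logneg] term of [f] has a favourable sign and is dropped. In use [f] is F -
    alpha and [g] is F_sigma - alpha. *)
Lemma logmod_integral_sub (e q : R) f g : 0 < e -> 0 < q -> q <= 1 ->
  qfin P q f -> qfin P q g ->
  (\int[P]_t logmod (f t) - \int[P]_t logmod (g t) <=
   (qmom P q (g \- f) / (q * e `^ q))%:E + \int[P]_t logneg e (normc (g t)))%E.
Proof.
move=> e0 q0 q1 ff fg; have eq0 : 0 < e `^ q by exact: powR_gt0.
have E h : qfin P q h -> (\int[P]_t logmod (h t) =
    \int[P]_t (ln (Num.max (normc (h t)) e))%:E - \int[P]_t logneg e (normc (h t)))%E.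
  move=> fh; rewrite -integral_sub_ge0.
  - apply: eq_integral => t _; rewrite /logneg /logmod.
    by case: (lne _) => [r||]//=; rewrite -?EFinB ?opprB ?(addrC (ln _)) ?subrK.
  - exact: integrable_ln_max fh.
  - by apply: measurable_logneg => [|t]; [exact: measurable_normc fh.1|exact: normc_ge0].
  - by move=> t; exact: logneg_ge0 (normc_ge0 _).
have i1 := integrable_ln_max e0 q0 q1 ff; have i2 := integrable_ln_max e0 q0 q1 fg.
have fgf : qfin P q (g \- f) by exact: qfinB.
have i3 : P.-integrable setT (fun t => ((q * e `^ q)^-1)%:E * (normc ((g \- f) t) `^ q)%:E)%E.
  exact: (integrableZl measurableT _ (integrable_qpow fgf)).
have I3 : (\int[P]_t (((q * e `^ q)^-1)%:E * (normc ((g \- f) t) `^ q)%:E) =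
    (qmom P q (g \- f) / (q * e `^ q))%:E)%E.
  rewrite ge0_integralZl_EFin//.
  - by have := emomE fgf; rewrite emom_integral => ->; rewrite -EFinM mulrC.
  - by move=> t _; rewrite lee_fin powR_ge0.
  - by apply/measurable_EFinP; exact: measurable_qpow fgf.1.
  - by rewrite invr_ge0 mulr_ge0// ltW.
have LE : (\int[P]_t (ln (Num.max (normc (f t)) e))%:E <=
    \int[P]_t (ln (Num.max (normc (g t)) e))%:E + (qmom P q (g \- f) / (q * e `^ q))%:E)%E.
  rewrite -I3 -(integralD measurableT i2 i3).
  apply: (le_integral measurableT i1 (integrableD measurableT i2 i3)) => t _.
  change ((ln (Num.max (normc (f t)) e))%:E <= (ln (Num.max (normc (g t)) e) +
    (q * e `^ q)^-1 * normc (g t - f t) `^ q)%:E)%E.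
  rewrite lee_fin.
  apply: (le_trans (ln_max_le e0 q0 q1 (normc_ge0 (f t)) (normc_ge0 (g t)))).
  rewrite lerD2l [X in X <= _]mulrC; apply: ler_wpM2l.
    by rewrite invr_ge0 mulr_ge0 ?(ltW q0) ?(ltW eq0).
  apply: ler_powR_base; [exact: ltW|exact: normr_ge0|].
  have h1 := normc_leD (f t) (g t); have h2 := normc_leD (g t) (f t).
  by rewrite normcC in h1; rewrite ler_norml; apply/andP; split; lra.
have := integrable_fin_num measurableT i1; have := integrable_fin_num measurableT i2.
have : (0 <= \int[P]_t logneg e (normc (f t)))%E.
  by apply: integral_ge0 => t _; exact: logneg_ge0 (normc_ge0 _).
have : (0 <= \int[P]_t logneg e (normc (g t)))%E.
  by apply: integral_ge0 => t _; exact: logneg_ge0 (normc_ge0 _).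
move: LE; rewrite !E//.
move: (\int[P]_t logneg e (normc (g t)))%E (\int[P]_t logneg e (normc (f t)))%E.
move: (\int[P]_t (ln (Num.max (normc (f t)) e))%:E)%E.
move: (\int[P]_t (ln (Num.max (normc (g t)) e))%:E)%E (qmom _ _ _ / _).
move=> [a| |] c [b| |] // [x| |] // [y| |] // h x0 y0 _ _; rewrite /= ?leey ?leNye//.
move: h x0 y0; rewrite -!EFinB -!EFinD !lee_fin; lra.
Qed.

End LogDifference.

Section ParametricIntegral.
Context d1 d2 (T1 : measurableType d1) (T2 : measurableType d2) (R : realType).

Lemma measurable_integral_param (P : probability T2 R) (h : T1 * T2 -> \bar R) :
  measurable_fun setT h -> measurable_fun setT (fun x => \int[P]_y h (x, y))%E.
Proof.
move=> mh.
have E : (fun x => \int[P]_y h (x, y))%E =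
    (fun x => \int[P]_y h^\+ (x, y) - \int[P]_y h^\- (x, y))%E.
  apply/funext => x; rewrite integralE; congr (_ - _)%E.
    by apply: eq_integral => y _; rewrite !funeposE.
  by apply: eq_integral => y _; rewrite !funenegE.
rewrite E; apply: emeasurable_funB.
  have := @measurable_fun_fubini_tonelli_F _ _ T1 T2 R P h^\+%E (measurable_funepos mh).
  by apply=> x; exact: funepos_ge0.
have := @measurable_fun_fubini_tonelli_F _ _ T1 T2 R P h^\-%E (measurable_funeneg mh).
by apply=> x; exact: funeneg_ge0.
Qed.

End ParametricIntegral.

(** * Logarithmic potentials and the maximum principle *)

Section Potential.
Variables (R : realType) (mu : probability (borel R[i]) R).
Implicit Types (z w : R[i]) (A : set (borel R[i])).

Definition logpot (e : R) (z : borel R[i]) : \bar R :=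
  (\int[mu]_w logneg e (normc ((z : R[i]) - w)%R))%E.

Lemma cmeasurable_borel_id : @cmeasurable R _ (borel R[i]) (fun z => z).
Proof. exact: (borel_cmeasurable (@measurable_id _ (borel R[i]) setT)). Qed.

Lemma cmeasurable_prodB d1 d2 (T1 : measurableType d1) (T2 : measurableType d2)
    (f : T1 -> R[i]) (g : T2 -> R[i]) : cmeasurable f -> cmeasurable g ->
  cmeasurable (fun t : T1 * T2 => f t.1 - g t.2).
Proof.
move=> mf mg; apply: cmeasurableB.
  exact: (cmeasurable_comp measurable_fst mf).
exact: (cmeasurable_comp measurable_snd mg).
Qed.

Lemma measurable_logneg_prod d1 d2 (T1 : measurableType d1) (T2 : measurableType d2)
    (f : T1 -> R[i]) (g : T2 -> R[i]) e : cmeasurable f -> cmeasurable g ->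
  measurable_fun setT (fun t : T1 * T2 => logneg e (normc (f t.1 - g t.2))).
Proof.
move=> mf mg; apply: measurable_logneg; last by move=> t; exact: normc_ge0.
exact: (measurable_normc (cmeasurable_prodB mf mg)).
Qed.

Lemma measurable_logpot e : measurable_fun setT (logpot e).
Proof.
have mh := measurable_logneg_prod e cmeasurable_borel_id cmeasurable_borel_id.
exact (measurable_integral_param mu mh).
Qed.

Lemma measurable_logneg_dist e z :
  measurable_fun setT (fun w : borel R[i] => logneg e (normc (z - w))).
Proof.
apply: measurable_logneg; last by move=> t; exact: normc_ge0.
apply: measurable_normc; apply: cmeasurableB; first exact: cmeasurable_cst.
exact: cmeasurable_borel_id.
Qed.

Lemma logpot_ge0 e z : (0 <= logpot e z)%E.
Proof. by apply: integral_ge0 => w _; exact: logneg_ge0 (normc_ge0 _). Qed.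

Lemma logpot_homo e e' z : e <= e' -> (logpot e z <= logpot e' z)%E.
Proof.
move=> ee; have := @ge0_le_integral _ _ R mu setT measurableT
  (fun w => logneg e (normc (z - w))) (fun w => logneg e' (normc (z - w))).
apply=> [w _|||w _]; [exact: logneg_ge0 (normc_ge0 _)|exact: measurable_logneg_dist..|].
exact: logneg_homo (normc_ge0 _) ee.
Qed.

Lemma logpot_cvg z : (logpot 1 z < +oo)%E ->
  logpot (n.+1%:R^-1) z @[n --> \oo] --> 0%E.
Proof.
move=> fz.
have ig : mu.-integrable setT (fun w => logneg 1 (normc (z - w))).
  apply/integrableP; split; first exact: measurable_logneg_dist.
  by under eq_integral do rewrite gee0_abs ?logneg_ge0 ?normc_ge0//.
have := @dominated_convergence _ _ R mu setT measurableT
  (fun n w => logneg (n.+1%:R^-1) (normc (z - w))) (fun=> 0%E)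
  (fun w => logneg 1 (normc (z - w))).
case=> [n|||//||_ _].
- exact: measurable_logneg_dist.
- exact: measurable_cst.
(* The kernel is +oo at w = z, so a finite potential leaves no mass at [z]. At any other [w] the
   truncation vanishes once 1/(n + 1) is below |z - w|. *)
- apply: filterS (integrable_ae measurableT ig) => w /(_ I) fw _.
  have n0 : 0 < normc (z - w).
    rewrite lt_neqAle normc_ge0 andbT; apply/eqP => h.
    by move: fw; rewrite -h logneg0.
  apply: (@cvg_trans _ ((fun=> 0%E : \bar R) @ \oo)); last exact: cvg_cst.
  apply: near_eq_cvg; have [N _ hN] := near_infty_natSinv_lt (PosNum n0).
  by exists N => // n Nn /=; rewrite logneg_eq0// ltW//; exact: hN.
- apply: nearW => w n _; rewrite gee0_abs ?logneg_ge0 ?normc_ge0//.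
  by apply: logneg_homo; rewrite ?normc_ge0// invf_le1// ler1n.
- by rewrite integral0.
Qed.

(* A point z is compared with a nearly nearest point z' of A: for w in A,
   |z' - w| <= 2 |z - w| up to an arbitrarily small error. *)
Lemma logpot_max A (e B : R) : measurable A -> 0 < e -> 0 <= B ->
  (forall z, A z -> logpot (2 * e) z <= B%:E)%E ->
  forall z, (\int[mu]_(w in A) logneg e (normc (z - w)%R) <= B%:E)%E.
Proof.
move=> mA e0 B0 hB z; have [->|/set0P A0] := eqVneq A set0.
  by rewrite integral_set0.
pose S := [set normc (z - w) | w in A].
have hS : has_inf S.
  split; first by case: A0 => w Aw; exists (normc (z - w)), w.
  by exists 0 => _ [w _ <-]; exact: normc_ge0.
pose g i (w : borel R[i]) := logneg e (normc (z - w) + i.+1%:R^-1).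
have e0' : 0 < 2 * e by rewrite mulr_gt0.
have x0 i w : 0 <= normc (z - w) + (i.+1%:R^-1 : R) by rewrite addr_ge0 ?normc_ge0 ?invr_ge0.
have mg i : measurable_fun setT (g i).
  apply: measurable_logneg => //; apply: measurable_funD => //.
  apply: measurable_normc; apply: cmeasurableB; first exact: cmeasurable_cst.
  exact: cmeasurable_borel_id.
have gB i : (\int[mu]_(w in A) g i w <= B%:E)%E.
  have [z' Az' hz'] : exists2 z' : R[i], A z' & normc (z - z') < inf S + i.+1%:R^-1.
    have p0 : 0 < (i.+1%:R^-1 : R) by rewrite invr_gt0.
    by have [_ [z' Az' <-] hz'] := inf_adherent p0 hS; exists z'.
  have hle w : A w -> (g i w <= logneg (2 * e) (normc (z' - w)%R))%E.
    move=> Aw; rewrite /g -(@logneg_scale _ 2)//.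
    apply: logneg_le => //; first exact: normc_ge0.
    have h1 : inf S <= normc (z - w) by apply: ge_inf; [exact: hS.2|exists w].
    have k0 : 0 <= (i.+1%:R^-1 : R) by rewrite invr_ge0.
    move: k0; have := normc_dist z' z w; rewrite [normc (z' - z)]normcC; move: hz' h1.
    move: (normc (z - z')) (normc (z - w)) (normc _) (inf S) (i.+1%:R^-1 : R) => a b c s k.
    by lra.
  apply: (le_trans _ (hB _ Az')).
  have m1 := measurable_funS measurableT (@subsetT _ A) (mg i).
  have m2 := measurable_funS measurableT (@subsetT _ A) (measurable_logneg_dist (2 * e) z').
  have l1 := @ge0_le_integral _ _ R mu A mA (g i) (fun w => logneg (2 * e) (normc (z' - w)))
    (fun w _ => logneg_ge0 _ (x0 i w)) m1 m2 hle.
  apply: (le_trans l1); apply: ge0_subset_integral => //.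
    exact: measurable_logneg_dist.
  by move=> w _; exact: logneg_ge0 (normc_ge0 _).
(* The kernel increases as its argument decreases to |z - w|, so monotone convergence removes the
   error 1/(i + 1). *)
have c : (\int[mu]_(w in A) g i w)%E @[i --> \oo] -->
    (\int[mu]_(w in A) logneg e (normc (z - w)%R))%E.
  have mgA i := measurable_funS measurableT (@subsetT _ A) (mg i).
  have gm w : A w -> {homo g^~ w : n n' / (n <= n')%N >-> (n <= n')%E}.
    move=> _ i j ij; apply: logneg_le => //.
    by rewrite lerD2l lef_pV2 ?posrE// ler_nat ltnS.
  have := @cvg_monotone_convergence _ _ R mu A mA g mgA
    (fun i w _ => logneg_ge0 _ (x0 i w)) gm.
  rewrite (_ : (\int[mu]_(w in A) limn (g^~ w) =
    \int[mu]_(w in A) logneg e (normc (z - w)%R))%E)//.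
  by apply: eq_integral => w _; apply/cvg_lim => //; exact: logneg_cvg (normc_ge0 _).
have -> := esym (cvg_lim (@ereal_hausdorff R) c).
by apply: lime_le; [apply/cvg_ex; eexists; exact: c|exact: nearW].
Qed.

(** Egorov's theorem, discarding a set of measure less than that of [A], so that a set of positive
    measure remains. *)
Lemma logpot_uniform A : measurable A -> (0 < mu A)%E ->
  (forall z, A z -> logpot 1 z < +oo)%E ->
  exists A1, [/\ measurable A1, A1 `<=` A, (0 < mu A1)%E &
    forall e, 0 < e -> exists n, forall z, A1 z -> (logpot n.+1%:R^-1 z <= e%:E)%E].
Proof.
move=> mA A0 hA.
have fp z n : A z -> logpot n.+1%:R^-1 z \is a fin_num.
  move=> /hA h; rewrite ge0_fin_numE ?logpot_ge0//; apply: le_lt_trans h.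
  by apply: logpot_homo; rewrite invf_le1// ler1n.
pose f n (z : borel R[i]) := fine (logpot n.+1%:R^-1 z).
have mf n : measurable_fun A (f n).
  apply: (@measurableT_comp _ _ _ _ _ _ (@fine R)) => //.
  exact: (measurable_funS measurableT (@subsetT _ A) (measurable_logpot _)).
have muA := fin_num_measure mu _ mA.
have r0 : 0 < fine (mu A) by rewrite fine_gt0// A0 ltey_eq muA.
have muAoo : (mu A < +oo)%E by rewrite ltey_eq muA.
have cf z : A z -> f ^~ z @ \oo --> (0 : R) by move=> /hA /logpot_cvg /fine_cvg.
have [B [mB muB hu]] :=
  @pointwise_almost_uniform _ R _ mu f (fun=> 0) A (fine (mu A)) mf mA muAoo cf r0.
exists (A `\` B); split; [exact: measurableD|exact: subDsetl| |].
  have h : (mu A <= mu (A `\` B) + mu B)%E.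
    rewrite -measureU; [|exact: measurableD|by []|by rewrite setDE -setIA setICl setI0].
    apply: le_measure; rewrite ?inE//; first by apply: measurableU => //; exact: measurableD.
    by move=> x Ax; case: (pselect (B x)); [right|left].
  rewrite fineK// in muB; rewrite lt0e measure_ge0 andbT; apply/eqP => h0.
  by move: h; rewrite h0 add0e leNgt muB.
move=> e e0.
have ent : entourage [set xy : R * R | `|xy.1 - xy.2| < e].
  by rewrite -entourage_ballE; exists e.
have /hu : nbhs ((fun=> 0) : {uniform` A `\` B -> R^o})
   [set h | forall y, (A `\` B) y -> [set xy : R * R | `|xy.1 - xy.2| < e] (0, h y)].
  apply/uniform_nbhs; exists [set xy : R * R | `|xy.1 - xy.2| < e].
  by split; [exact: ent|move=> h].
move=> [n _ /(_ n (leqnn _)) hn]; exists n => z ABz.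
have := hn _ ABz; rewrite /= sub0r normrN /f => h.
rewrite -(fineK (fp z n ABz.1)) lee_fin (le_trans (ler_norm _))// ltW//.
Qed.

End Potential.

(** * Measures with finite potential do not charge the exceptional set *)

Section ExceptionalSet.
Context d (X : measurableType d) (R : realType) (P : probability X R).
Variables (q : R) (q0 : 0 < q) (q1 : q <= 1).
Variables (f : X -> R[i]) (g : nat -> X -> R[i]).
Hypotheses (ff : qfin P q f) (fg : forall n, qfin P q (g n)).
Hypothesis gf : forall e, 0 < e -> exists n, qmom P q (fun t => g n t - f t) <= e.

Let u (h : X -> R[i]) (alpha : borel R[i]) : \bar R :=
  (\int[P]_t logmod (h t - (alpha : R[i]))%R)%E.

Lemma measurable_log_integral h : cmeasurable h -> measurable_fun setT (u h).
Proof.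
move=> mh; have mk : measurable_fun setT
    (fun t : borel R[i] * X => logmod (h t.2 - (t.1 : R[i]))).
  apply: measurable_logmod; apply: cmeasurableB.
    exact: (cmeasurable_comp measurable_snd mh).
  exact: (cmeasurable_comp measurable_fst (@cmeasurable_borel_id R)).
exact (measurable_integral_param P mk).
Qed.

Let qfin_cst (c : R[i]) : qfin P q (fun=> c).
Proof.
apply: (@qfin_bounded _ _ _ P q (fun=> c) (normc c)) => //; first exact: ltW.
Qed.

(* On a subset of A the truncated potentials of mu tend to 0 uniformly, so by
   Tonelli's theorem the mean over it of the error term of [logmod_integral_sub] is as
   small as desired. *)
Lemma exceptional_null (mu : probability (borel R[i]) R) (L : borel R[i] -> \bar R)
    (A : set (borel R[i])) : measurable A -> measurable_fun setT L ->
  (forall alpha, A alpha -> logpot mu 1 alpha < +oo)%E ->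
  (forall alpha n, A alpha -> u (g n) alpha <= L alpha)%E ->
  (forall alpha, A alpha -> L alpha < u f alpha)%E ->
  mu A = 0%E.
Proof.
move=> mA mL hA uL Lu; apply/eqP; apply: contrapT => /negP muA.
have A0 : (0 < mu A)%E by rewrite lt0e muA measure_ge0.
have [A1 [mA1 A1A A10 hA1]] := logpot_uniform mA A0 hA.
pose w alpha := (u f alpha - L alpha)%E.
have mw : measurable_fun setT w.
  by apply: emeasurable_funB => //; exact: measurable_log_integral ff.1.
have mwA := measurable_funS measurableT (@subsetT _ A1) mw.
have w_gt0 alpha : A1 alpha -> (0 < w alpha)%E.
  by move=> /A1A /Lu; rewrite /w sube_gt0.
have w_le e : 0 < e -> (\int[mu]_(alpha in A1) w alpha <= (e + e)%:E)%E.
  move=> e0; have [n hn] := hA1 _ e0.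
  (* Half of 1/(n + 1), because the maximum principle loses a factor 2 in the scale. *)
  pose eps : R := n.+1%:R^-1 / 2; have eps0 : 0 < eps by rewrite divr_gt0.
  have epsE : 2 * eps = n.+1%:R^-1 by rewrite mulrC divfK.
  have hmax z := @logpot_max R mu A1 eps e mA1 eps0 (ltW e0).
  have {}hmax z : (\int[mu]_(alpha in A1) logneg eps (normc (z - (alpha : R[i]))%R) <= e%:E)%E.
    by apply: hmax => // z' /hn; rewrite epsE.
  have pe : 0 < q * eps `^ q by rewrite mulr_gt0// powR_gt0.
  (* Chosen after [eps], so that the moment term of [logmod_integral_sub] is at most [e] at this
     scale. *)
  have [N hN] := gf (mulr_gt0 e0 pe).
  pose Th (alpha : borel R[i]) :=
    (\int[P]_t logneg eps (normc (g N t - (alpha : R[i]))%R))%E.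
  have mh := measurable_logneg_prod eps (fg N).1 (@cmeasurable_borel_id R).
  have mh' : measurable_fun setT (fun t : borel R[i] * X =>
      logneg eps (normc (g N t.2 - (t.1 : R[i])))).
    apply: measurable_logneg; last by move=> t; exact: normc_ge0.
    apply: measurable_normc; apply: cmeasurableB.
      exact: (cmeasurable_comp measurable_snd (fg N).1).
    exact: (cmeasurable_comp measurable_fst (@cmeasurable_borel_id R)).
  have mTh : measurable_fun setT Th := measurable_integral_param P mh'.
  have Th0 alpha : (0 <= Th alpha)%E.
    by apply: integral_ge0 => t _; exact: logneg_ge0 (normc_ge0 _).
  have wTh alpha : A1 alpha -> (w alpha <= e%:E + Th alpha)%E.
    move=> A1a; have h := @logmod_integral_sub _ X R P eps q
      (fun t => f t - (alpha : R[i])) (fun t => g N t - (alpha : R[i])) eps0 q0 q1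
      (qfinB q0 q1 ff (qfin_cst _)) (qfinB q0 q1 (fg N) (qfin_cst _)).
    apply: (@le_trans _ _ (u f alpha - u (g N) alpha)%E).
      by rewrite /w; apply: leeB => //; apply: uL; exact: A1A.
    apply: (le_trans h); apply: leeD; last exact: lexx.
    rewrite lee_fin (ler_pdivrMr _ _ pe).
    apply: le_trans hN; rewrite le_eqVlt; apply/orP; left; apply/eqP.
    by congr (qmom P q _); apply/funext => t /=; rewrite opprB addrA subrK.
  have ThA : (\int[mu]_(alpha in A1) Th alpha <= e%:E)%E.
    rewrite integral_mkcond.
    pose H (t : borel R[i] * X) : \bar R := if t.1 \in A1 then
      logneg eps (normc (g N t.2 - (t.1 : R[i]))) else 0%E.
    have E1 : (Th \_ A1 = fun alpha => \int[P]_t H (alpha, t))%E.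
      apply/funext => alpha; rewrite patchE /H /=; case: ifPn => // _.
      by rewrite integral0.
    have mH : measurable_fun setT H.
      apply: measurable_fun_ifT => //.
      have m1 : measurable_fun setT (fun z : borel R[i] => z \in A1).
        apply: (measurable_fun_bool true); rewrite setTI (_ : _ @^-1` _ = A1)//.
        by apply/funext => z /=; rewrite propeqE; split => [/set_mem|/mem_set].
      exact: (measurableT_comp m1 measurable_fst).
    have H0 t : (0 <= H t)%E.
      by rewrite /H; case: ifP => // _; exact: logneg_ge0 (normc_ge0 _).
    (* Exchanging the integrals turns the inner one into the potential of [mu] on [A1] at the point
       g_N(t), which may lie outside [A1]; the bound [hmax] covers every point. *)
    rewrite E1 (@fubini_tonelli _ _ _ _ R mu P H mH H0).
    have IE t : (\int[mu]_alpha H (alpha, t) =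
        \int[mu]_(alpha in A1) logneg eps (normc (g N t - (alpha : R[i]))%R))%E.
      by rewrite [RHS]integral_mkcond; apply: eq_integral => z _; rewrite patchE.
    apply: (@le_trans _ _ (\int[P]_t e%:E)%E); last by rewrite integral_prob_cst.
    have := @ge0_le_integral _ _ R P setT measurableT
      (fun t => \int[mu]_alpha H (alpha, t))%E (fun=> e%:E).
    apply=> [t _|||t _].
    - by apply: integral_ge0 => z _; exact: H0.
    - exact: (@measurable_fun_fubini_tonelli_G _ _ _ _ R mu H mH H0).
    - exact: measurable_cst.
    - by rewrite IE; exact: hmax.
  have l1 := @ge0_le_integral _ _ R mu A1 mA1 w (fun alpha => e%:E + Th alpha)%E
    (fun a Aa => ltW (w_gt0 a Aa)) mwA.
  have mTA := measurable_funS measurableT (@subsetT _ A1) mTh.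
  apply: (le_trans (l1 _ wTh)); first by apply: emeasurable_funD.
  rewrite ge0_integralD//; [|by move=> a _; rewrite lee_fin ltW].
  rewrite EFinD; apply: leeD => //.
  rewrite integral_cst//.
  by rewrite -[leRHS]mule1 lee_wpmul2l ?lee_fin ?(ltW e0)//; exact: probability_le1.
have w0 : (\int[mu]_(alpha in A1) w alpha = 0)%E.
  apply/eqP; rewrite eq_le; apply/andP; split; last first.
    by apply: integral_ge0 => a /w_gt0/ltW.
  apply/lee_addgt0Pr => e e0; rewrite add0e [e]splitr; apply: w_le.
  by rewrite divr_gt0.
(* [w] vanishes almost everywhere on [A1] although it is positive there, which contradicts the
   positive measure of [A1]. *)
have /ae_eq_integral_abs : (\int[mu]_(alpha in A1) `|w alpha| = 0)%E.
  rewrite -[RHS]w0; apply: eq_integral => a /set_mem /w_gt0 /ltW h.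
  by rewrite gee0_abs.
case=> // N [mN N0 hN].
have : (mu A1 <= mu N)%E.
  apply: le_measure; rewrite ?inE// => a Aa; apply: hN => h.
  by have := w_gt0 _ Aa; rewrite h// ltxx.
by rewrite leNgt N0 A10.
Qed.

End ExceptionalSet.

(** * Infinite potential and infinite energy *)

Section Capacity.
Variable R : realType.

Lemma compact_borel (K : set R[i]) : compact K -> measurable (K : set (borel R[i])).
Proof.
move=> cK; have clK := compact_closed (@hausdorffC R) cK.
rewrite -(setCK K); apply: measurableC; apply: sub_gen_smallest.
exact: closed_openC.
Qed.

Lemma logneg1E (x : R) : 0 <= x -> logneg 1 x = Order.max (- lne x%:E)%E 0%E.
Proof.
rewrite le_eqVlt => /predU1P[<-|x0]; first by rewrite logneg0 le0_lneNy//= maxye.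
rewrite logneg_pos// lne_EFin// -EFinN -EFin_max; congr _%:E.
have [x1|x1] := leP 1 x.
  by rewrite subrr max_r// oppr_le0 ln_ge0.
by rewrite ln1 sub0r max_l// oppr_ge0 ln_le0// ltW.
Qed.

(** The negative part of log |z - w| integrates to [logpot mu 1 z], so the inner integral of the
    energy is -oo for almost every z. *)
Lemma log_energy_Ny (mu : probability (borel R[i]) R) :
  mu [set z | logpot mu 1 z < +oo]%E = 0%E -> log_energy mu = -oo%E.
Proof.
move=> h0; rewrite /log_energy.
have mlog : measurable_fun setT
    (fun t : borel R[i] * borel R[i] => logmod ((t.1 : R[i]) - t.2)).
  apply: measurable_logmod.
  exact: (cmeasurable_prodB (@cmeasurable_borel_id R) (@cmeasurable_borel_id R)).
have mpot := measurable_integral_param mu mlog.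
have mA : measurable [set z | logpot mu 1 z < +oo]%E.
  rewrite -[X in measurable X]setTI; apply: emeasurable_fun_infty_o => //.
  exact: measurable_logpot.
transitivity (\int[mu]_z (-oo : \bar R))%E; last first.
  have := @integral_cst _ _ R mu setT measurableT -oo%E.
  move=> E; apply: (eq_trans E); apply: (eq_trans _ (mule1 -oo%E)).
  by congr (_ * _)%E; exact (probability_setT mu).
apply: ae_eq_integral => //.
exists [set z | logpot mu 1 z < +oo]%E; split => // z /= hz; apply: contrapT => hz'.
apply: hz => _; rewrite integralE.
have -> : (\int[mu]_w (fun w : borel R[i] => logmod ((z : R[i]) - w)%R)^\- w = +oo)%E.
  have -> : (\int[mu]_w (fun w : borel R[i] => logmod ((z : R[i]) - w)%R)^\- w = logpot mu 1 z)%E.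
    by apply: eq_integral => w _; rewrite funenegE logneg1E ?normc_ge0.
  by apply/eqP; move: hz'; rewrite ltey => /negP; rewrite negbK.
(* -oo absorbs every other term of a sum, so the difference is -oo whatever the positive part
   contributes. *)
by rewrite /= addeNy.
Qed.

End Capacity.

(** * Monotonicity in sigma and capacity of the exceptional set *)

Section ShiftedLogIntegral.
Variables (R : realType) (m : probability (borel (torus R)) R).
Hypothesis m_haar : normalized_haar m.
Variables (p : R) (p_gt0 : 0 < p) (F : torus R -> R[i]).
Hypothesis F_Hp : Hardy m p F.

Local Notation shift := (Hardy_shift m p F).

Definition log_integral (f : torus R -> R[i]) (alpha : borel R[i]) : \bar R :=
  (\int[m]_chi logmod (f chi - (alpha : R[i]))%R)%E.

Lemma exists_exponent : exists2 l, 2 / (2 ^ l)%:R <= (1 : R) & 2 / (2 ^ l)%:R <= p.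
Proof.
have e0 : 0 < Num.min 1 p by rewrite lt_min ltr01.
have [l hl] : exists l : nat, 2 / Num.min 1 p <= (2 ^ l)%:R.
  exists (Num.truncn (2 / Num.min 1 p)).+1.
  apply: ltW; apply: (lt_le_trans (truncnS_gt _)).
  by rewrite ler_nat; apply: ltnW; exact: ltn_expl.
have h : 2 / (2 ^ l)%:R <= Num.min 1 p.
  by rewrite ler_pdivrMr ?ltr0n ?expn_gt0// mulrC -ler_pdivrMr.
by move: h; rewrite le_min => /andP[]; exists l.
Qed.

(** The exponents 2 / 2^(l + j) have the form that Parseval's formula requires, with [l + j] for
    [l]. The moment inequalities thus hold along a sequence that tends to 0 by halving, as the
    passage to logarithms demands. *)
Lemma exponent_seq : exists l (q : nat -> R), forall j,
  [/\ 0 < q j, q j <= 1, q j * (2 ^ (l + j))%:R = 2, q j <= p & q j.+1 = q j / 2].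
Proof.
have [l h1 hp] := exists_exponent.
have p2 i : 0 < (2 ^ i)%:R :> R by rewrite ltr0n expn_gt0.
have le0 j : 2 / (2 ^ (l + j))%:R <= 2 / (2 ^ l)%:R :> R.
  by rewrite ler_pM2l// lef_pV2 ?posrE// ler_nat leq_pexp2l// leq_addr.
exists l, (fun j => 2 / (2 ^ (l + j))%:R) => j; split.
- exact: divr_gt0.
- exact: le_trans h1.
- by rewrite divfK// gt_eqF.
- exact: le_trans hp.
- by rewrite addnS expnS natrM invfM mulrCA mulrC.
Qed.

(** Below the exclusive bound 2 only n = 1 occurs; its character is 1 and so is its weight
    1^(-sigma). Subtracting alpha therefore commutes with the dilation. *)
Lemma tpoly_wt_cst sigma (alpha : R[i]) :
  tpoly 2 (wt sigma (fun=> alpha)) = (fun=> alpha) :> (torus R -> R[i]).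
Proof.
apply/funext => chi; rewrite /tpoly big_nat1 /wt powR1 mulr1.
by rewrite /torus_eval /= big_nil mulr1.
Qed.

Lemma tpoly_cst (alpha : R[i]) :
  tpoly 2 (fun=> alpha) = (fun=> alpha) :> (torus R -> R[i]).
Proof.
apply/funext => chi; rewrite /tpoly big_nat1.
by rewrite /torus_eval /= big_nil mulr1.
Qed.

Let qfin_cst (q : R) (c : R[i]) : 0 < q -> @qfin _ (borel (torus R)) R m q (fun=> c).
Proof.
move=> q0; apply: (@qfin_bounded _ _ _ m q (fun=> c) (normc c)) => //; exact: ltW.
Qed.

Lemma log_integral_shift_mono sigma tau alpha : 0 < tau -> tau <= sigma ->
  (log_integral (shift sigma) alpha <= log_integral (shift tau) alpha)%E.
Proof.
move=> t0 ts; have s0 := lt_le_trans t0 ts.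
have [l [q hq]] := exponent_seq.
have fs rho : 0 < rho -> forall j, @qfin _ (borel (torus R)) R m (q j)
    (fun chi => shift rho chi - (alpha : R[i])).
  move=> r0 j; have [q0 q1 qK qp _] := hq j.
  exact (qfinB q0 q1 (qfin_shift m_haar p_gt0 F_Hp q0 q1 qK qp r0) (qfin_cst alpha q0)).
have q_gt0 j : 0 < q j by case: (hq j).
have qS j : q j.+1 = q j / 2 by case: (hq j).
have h := logmod_integral_mono q_gt0 qS (fs _ s0) (fs _ t0).
apply h => j; have [q0 q1 qK qp _] := hq j.
have := qmom_shift_mono m_haar p_gt0 F_Hp q0 q1 qK qp 2 (fun=> alpha : R[i]) t0 ts.
by rewrite !tpoly_wt_cst.
Qed.

Lemma log_integral_shift_le sigma alpha : 0 < sigma ->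
  (log_integral (shift sigma) alpha <= log_integral F alpha)%E.
Proof.
move=> s0; have [l [q hq]] := exponent_seq.
have fs j : @qfin _ (borel (torus R)) R m (q j)
    (fun chi => shift sigma chi - (alpha : R[i])).
  have [q0 q1 qK qp _] := hq j.
  exact (qfinB q0 q1 (qfin_shift m_haar p_gt0 F_Hp q0 q1 qK qp s0) (qfin_cst alpha q0)).
have fF j : @qfin _ (borel (torus R)) R m (q j) (fun chi => F chi - (alpha : R[i])).
  have [q0 q1 qK qp _] := hq j.
  exact (qfinB q0 q1 (Hardy_qfin p_gt0 F_Hp q0 qp) (qfin_cst alpha q0)).
have q_gt0 j : 0 < q j by case: (hq j).
have qS j : q j.+1 = q j / 2 by case: (hq j).
have h := logmod_integral_mono q_gt0 qS fs fF.
apply h => j; have [q0 q1 qK qp _] := hq j.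
have := qmom_shift_le_F m_haar p_gt0 F_Hp q0 q1 qK qp 2 (fun=> alpha : R[i]) s0.
by rewrite tpoly_wt_cst tpoly_cst.
Qed.

(** Countably many values of sigma keep the supremum measurable, and by monotonicity they determine
    the limit at 0. *)
Definition shift_sup (alpha : borel R[i]) : \bar R :=
  ereal_sup (range (fun n => log_integral (shift n.+1%:R^-1) alpha)).

Lemma measurable_shift_sup : measurable_fun setT shift_sup.
Proof.
apply: (@emeasurable_fun_cvg _ _ _ setT
  (fun n alpha => log_integral (shift n.+1%:R^-1) alpha)) => [n|alpha _].
  by apply: (@measurable_log_integral _ _ R m); exact: cmeasurable_shift.
apply: ereal_nondecreasing_cvgn => i j ij.
apply: log_integral_shift_mono; first by rewrite invr_gt0.
by rewrite lef_pV2 ?posrE// ler_nat ltnS.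
Qed.

Lemma shift_sup_cvg alpha : (log_integral F alpha <= shift_sup alpha)%E ->
  log_integral (shift sigma) alpha @[sigma --> (0 : R)^'+] --> log_integral F alpha.
Proof.
(* The right end 2 is a choice: the interval has to contain every 1/(n + 1). *)
move=> h; have b2 : (BRight (0 : R) < BRight (2 : R))%O by rewrite bnd_simp.
have nif : {in Interval (BRight (0 : R)) (BRight 2) &,
    nonincreasing_fun (fun sigma => log_integral (shift sigma) alpha)}.
  move=> tau sigma; rewrite !in_itv/= => /andP[t0 _] _ ts.
  exact: log_integral_shift_mono.
have := nonincreasing_at_right_cvge (BRight 2) b2 nif.
set S := ereal_sup _; suff -> : S = log_integral F alpha by [].
apply/eqP; rewrite eq_le; apply/andP; split.
  apply: ge_ereal_sup => _ [sigma /= + <-]; rewrite in_itv/= => /andP[s0 _].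
  exact: log_integral_shift_le.
apply: (le_trans h); apply: ge_ereal_sup => _ [n _ <-].
apply: ereal_sup_ubound; exists (n.+1%:R^-1) => //=.
rewrite in_itv/= invr_gt0 ltr0n/= (@le_trans _ _ 1)//; last by rewrite ler1n.
by rewrite invf_le1// ler1n.
Qed.

Definition exceptional_set : set (borel R[i]) :=
  [set alpha | (shift_sup alpha < log_integral F alpha)%E].

Let mF : measurable_fun setT (log_integral F).
Proof.
apply: (@measurable_log_integral _ _ R m).
have [l [q hq]] := exponent_seq; have [q0 _ _ qp _] := hq 0%N.
exact (Hardy_qfin p_gt0 F_Hp q0 qp).1.
Qed.

Lemma measurable_exceptional_set : measurable exceptional_set.
Proof.
rewrite /exceptional_set -[X in measurable X]setTI.
exact: (measurable_lte measurableT measurable_shift_sup mF).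
Qed.

(** A competing [mu] is carried by the exceptional set, and [exceptional_null] shows that the part
    of this set where the potential is finite is null. Hence the energy is -oo, its exponential is
    0, and the capacity is the supremum of the singleton 0. *)
Lemma log_capacity_exceptional_set : log_capacity exceptional_set = 0%E.
Proof.
rewrite /log_capacity; set S := (X in ereal_sup X).
suff -> : S = [set 0%E] by rewrite ereal_sup1.
apply/seteqP; split=> [x [//|[mu [K [cK KE muK]] <-]]|x ->]; last by left.
rewrite (_ : log_energy mu = -oo%E)//; apply: log_energy_Ny.
have mK := compact_borel cK; have mE := measurable_exceptional_set.
set V := [set z | _]; have mV : measurable V.
  rewrite /V -[X in measurable X]setTI; apply: emeasurable_fun_infty_o => //.
  exact: measurable_logpot.
have muE : mu (~` exceptional_set) = 0%E.
  rewrite probability_setC//; have -> : mu exceptional_set = 1%E.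
    apply/eqP; rewrite eq_le probability_le1//=.
    by move: muK => <-; apply: le_measure; rewrite ?inE.
  by rewrite subee.
have muVE : mu (V `&` exceptional_set) = 0%E.
  have [l [q hq]] := exponent_seq; have [q0 q1 qK qp _] := hq 0%N.
  have s0 n : 0 < (n.+1%:R^-1 : R) by rewrite invr_gt0.
  have fs n := qfin_shift m_haar p_gt0 F_Hp q0 q1 qK qp (s0 n).
  have gf (e : R) : 0 < e -> exists n,
      @qmom _ (borel (torus R)) R m (q 0%N) (fun t => shift n.+1%:R^-1 t - F t) <= e.
    move=> e0; have [j hj] := shift_cvg m_haar p_gt0 F_Hp q0 q1 qK qp s0 (@cvg_harmonic R) e0.
    by exists j; exact: (hj j (leqnn j)).
  have mA : measurable (V `&` exceptional_set) by exact: measurableI.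
  apply: (exceptional_null q0 q1 (Hardy_qfin p_gt0 F_Hp q0 qp) fs gf mA
    measurable_shift_sup) => [alpha []//|alpha n _|alpha []//].
  by apply: ereal_sup_ubound; exists n.
have VU : V `<=` (V `&` exceptional_set) `|` ~` exceptional_set.
  by move=> z Vz; have [Ez|Ez] := pselect (exceptional_set z); [left|right].
apply/eqP; rewrite eq_le measure_ge0 andbT.
have mU : measurable ((V `&` exceptional_set) `|` ~` exceptional_set).
  by apply: measurableU; [exact: measurableI|exact: measurableC].
have l1 : (mu V <= mu ((V `&` exceptional_set) `|` ~` exceptional_set))%E.
  by apply: le_measure; rewrite ?inE.
have E : (mu ((V `&` exceptional_set) `|` ~` exceptional_set) =
    mu (V `&` exceptional_set) + mu (~` exceptional_set))%E.
  apply: measureU; [exact: measurableI|exact: measurableC|].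
  by rewrite -setIA setICr setI0.
by apply: (le_trans l1); rewrite E muVE muE adde0.
Qed.

End ShiftedLogIntegral.

Theorem theorem4p4 (R : realType) (m : probability (borel (torus R)) R)
    (m_haar : normalized_haar m) (p : R) (p_gt0 : 0 < p)
    (F : torus R -> R[i]) (F_Hp : Hardy m p F) :
  quasi_every (fun alpha : R[i] =>
    (\int[m]_chi logmod (Hardy_shift m p F sigma chi - alpha)%R)%E
      @[sigma --> (0 : R)^'+]
    --> (\int[m]_chi logmod (F chi - alpha)%R)%E).
Proof.
exists (exceptional_set m p F); split.
- exact: measurable_exceptional_set.
- exact: log_capacity_exceptional_set.
move=> alpha /negP; rewrite -leNgt; exact: shift_sup_cvg.
Qed.
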